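(* Let $\Lambda$ be a row-finite locally convex $k$-graph such that $\Lambda^0$ is finite, and suppose that $C^*(\Lambda)$ does not contain an infinite projection. Then there exist $n\ge 1$ and $l_1,\dots,l_n\in\{0,\dots,k\}$ such that $C^*(\Lambda)$ is strongly Morita equivalent to $\bigoplus_{i=1}^n C(\mathbb T^{l_i})$.
   Context: Let $\mathbb N=\{0,1,2,\dots\}$ and $k\ge 1$; order $\mathbb N^k$ coordinatewise; $e_1,\dots,e_k$ are the generators of $\mathbb N^k$. A $k$-graph is a countable small category $\Lambda$ with a functor $d:\Lambda\to\mathbb N^k$ (the degree) satisfying the factorisation property: if $d(\lambda)=m+n$ then there are unique $\mu,\nu\in\Lambda$ with $d(\mu)=m$, $d(\nu)=n$, $\lambda=\mu\nu$. Put $\Lambda^n=d^{-1}(n)$. Elements of $\Lambda^0$ are the identity morphisms, identified with the objects and called vertices; $r,s:\Lambda\to\Lambda^0$ are the codomain and domain maps, so $\mu\nu$ is defined when $s(\mu)=r(\nu)$. For $v\in\Lambda^0$ and $E\subseteq\Lambda$, $vE=\{\lambda\in E: r(\lambda)=v\}$. $\Lambda$ is row-finite if $v\Lambda^n$ is finite for all $v\in\Lambda^0$, $n\in\mathbb N^k$. $\Lambda$ is locally convex if whenever $\mu\in\Lambda^{e_i}$ and $r(\mu)\Lambda^{e_j}\neq\emptyset$ with $i\ne j$, we have $s(\mu)\Lambda^{e_j}\ne\emptyset$. For row-finite locally convex $\Lambda$ and $n\in\mathbb N^k$, let $\Lambda^{\le n}=\bigcup_{m\le n}\{\lambda\in\Lambda^m: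 s(\lambda)\Lambda^{e_i}=\emptyset\text{ for all } i\le k\text{ with } m_i<n_i\}$. Then $C^*(\Lambda)$ is the universal $C^*$-algebra generated by elements $\{s_\lambda:\lambda\in\Lambda\}$ such that the $s_v$, $v\in\Lambda^0$, are mutually orthogonal projections; $s_\mu s_\nu=s_{\mu\nu}$ when $s(\mu)=r(\nu)$; $s_\mu^*s_\mu=s_{s(\mu)}$ for all $\mu$; and $s_v=\sum_{\lambda\in v\Lambda^{\le n}}s_\lambda s_\lambda^*$ for all $v\in\Lambda^0$ and $n\in\mathbb N^k$. Convention: $\mathbb T^0$ is a point, so $C(\mathbb T^0)=\mathbb C$. *)

(* Defs.v *)
From HB Require Import structures.
From mathcomp Require Import all_boot all_order all_algebra complex.
From mathcomp Require Import all_classical all_reals topology normedtype ring.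

Set Implicit Arguments.
Unset Strict Implicit.
Unset Printing Implicit Defensive.

Import Order.TTheory GRing.Theory Num.Theory.
Import numFieldNormedType.Exports.

Local Open Scope classical_set_scope.
Local Open Scope ring_scope.

(** C*-algebras, not assumed unital, and possibly zero. They are stated over
    an abstract numerical closed field; the complex numbers are R[i] for
    R : realType. *)

HB.mixin Record CompleteNormedModule_isCStarAlgebra (C : numClosedFieldType) A
    & CompleteNormedModule C A := {
  cmul : A -> A -> A;
  star : A -> A;
  cmulA : associative cmul;
  cmulDl : left_distributive cmul +%R;
  cmulDr : right_distributive cmul +%R;
  cmulZl : forall (c : C) (x y : A), cmul (c *: x) y = c *: cmul x y;
  cmulZr : forall (c : C) (x y : A), cmul x (c *: y) = c *: cmul x y;
  starK : involutive star;
  starD : {morph star : x y / x + y};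
  starZ : forall (c : C) (x : A), star (c *: x) = c^* *: star x;
  starM : forall x y : A, star (cmul x y) = cmul (star y) (star x);
  cnormM : forall x y : A, `|cmul x y| <= `|x| * `|y|;
  cstar_norm : forall x : A, `|cmul (star x) x| = `|x| ^+ 2
}.

#[short(type="cstarAlgType")]
HB.structure Definition CStarAlgebra (C : numClosedFieldType) :=
  {A of CompleteNormedModule C A & CompleteNormedModule_isCStarAlgebra C A}.

Declare Scope cstar_scope.
Delimit Scope cstar_scope with cstar.
Notation "x ** y" := (cmul x y) (at level 40, left associativity) : cstar_scope.
Local Open Scope cstar_scope.

Section CStarNotions.
Variable C : numClosedFieldType.
Implicit Types A B : cstarAlgType C.

(** Continuity of *-homomorphisms between C*-algebras is automatic. *)
Record is_star_hom A B (phi : A -> B) : Prop := IsStarHom {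
  star_homD : {morph phi : x y / x + y};
  star_homZ : forall (c : C) (x : A), phi (c *: x) = c *: phi x;
  star_homM : {morph phi : x y / x ** y};
  star_hom_star : {morph phi : x / star x} }.

Definition is_subspace (V : lmodType C) (S : set V) : Prop :=
  [/\ S 0, (forall x y, S x -> S y -> S (x + y))
    & forall (c : C) x, S x -> S (c *: x)].

Definition is_cstar_subalgebra A (S : set A) : Prop :=
  [/\ closed S, is_subspace S, (forall x y, S x -> S y -> S (x ** y))
    & forall x, S x -> S (star x)].

Definition generates A (G : set A) : Prop :=
  forall S : set A, is_cstar_subalgebra S -> G `<=` S -> S = setT.

Definition has_dense_span A (G : set A) : Prop :=
  forall S : set A, closed S -> is_subspace S -> G `<=` S -> S = setT.

Definition is_positive A (a : A) : Prop := exists b : A, a = star b ** b.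

Definition is_projection A (p : A) : Prop := p ** p = p /\ star p = p.

(** [p] is equivalent to a proper subprojection [q] of itself. *)
Definition is_infinite_projection A (p : A) : Prop :=
  is_projection p /\
  exists v : A, let q := v ** star v in
    [/\ star v ** v = p, is_projection q, p ** q = q & q != p].

(** Hilbert modules: the norm is [x |-> `|ip x x| ^ (1/2)]; completeness is
    expressed with its square. *)
Definition ip_complete A (X : lmodType C) (ip : X -> X -> A) : Prop :=
  forall u : nat -> X,
    (forall e : C, 0 < e -> exists N : nat, forall m n : nat,
       (N <= m)%N -> (N <= n)%N -> `|ip (u m - u n) (u m - u n)| < e) ->
  exists x : X, forall e : C, 0 < e -> exists N : nat, forall n : nat,
    (N <= n)%N -> `|ip (u n - x) (u n - x)| < e.

(** The ideal spanned by the inner products is dense. *)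
Definition ip_full A (X : lmodType C) (ip : X -> X -> A) : Prop :=
  has_dense_span [set a | exists x y, a = ip x y].

Record is_left_hilbert A (X : lmodType C) (act : A -> X -> X)
    (ip : X -> X -> A) : Prop := IsLeftHilbert {
  lactDl : forall a b x, act (a + b) x = act a x + act b x;
  lactDr : forall a x y, act a (x + y) = act a x + act a y;
  lactZl : forall (c : C) a x, act (c *: a) x = c *: act a x;
  lactZr : forall (c : C) a x, act a (c *: x) = c *: act a x;
  lactM : forall a b x, act (a ** b) x = act a (act b x);
  lipD : forall x y z, ip (x + y) z = ip x z + ip y z;
  lipZ : forall (c : C) x y, ip (c *: x) y = c *: ip x y;
  lipM : forall a x y, ip (act a x) y = a ** ip x y;
  lip_star : forall x y, star (ip x y) = ip y x;
  lip_pos : forall x, is_positive (ip x x);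
  lip_def : forall x, ip x x = 0 -> x = 0;
  lip_complete : ip_complete ip }.

Record is_right_hilbert B (X : lmodType C) (act : X -> B -> X)
    (ip : X -> X -> B) : Prop := IsRightHilbert {
  ractDl : forall x y b, act (x + y) b = act x b + act y b;
  ractDr : forall x a b, act x (a + b) = act x a + act x b;
  ractZl : forall (c : C) x b, act (c *: x) b = c *: act x b;
  ractZr : forall (c : C) x b, act x (c *: b) = c *: act x b;
  ractM : forall x a b, act x (a ** b) = act (act x a) b;
  ripD : forall x y z, ip x (y + z) = ip x y + ip x z;
  ripZ : forall (c : C) x y, ip x (c *: y) = c *: ip x y;
  ripM : forall x y b, ip x (act y b) = ip x y ** b;
  rip_star : forall x y, star (ip x y) = ip y x;
  rip_pos : forall x, is_positive (ip x x);
  rip_def : forall x, ip x x = 0 -> x = 0;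
  rip_complete : ip_complete ip }.

(** Rieffel's A-B-imprimitivity (equivalence) bimodules. *)
Record imprimitivity_bimodule A B := ImprimitivityBimodule {
  ib_space : lmodType C;
  ib_lact : A -> ib_space -> ib_space;
  ib_ract : ib_space -> B -> ib_space;
  ib_lip : ib_space -> ib_space -> A;
  ib_rip : ib_space -> ib_space -> B;
  ib_left : is_left_hilbert ib_lact ib_lip;
  ib_right : is_right_hilbert ib_ract ib_rip;
  ib_left_full : ip_full ib_lip;
  ib_right_full : ip_full ib_rip;
  ib_actA : forall a x b, ib_ract (ib_lact a x) b = ib_lact a (ib_ract x b);
  ib_rip_lact : forall a x y,
    ib_rip (ib_lact a x) y = ib_rip x (ib_lact (star a) y);
  ib_lip_ract : forall b x y,
    ib_lip (ib_ract x b) y = ib_lip x (ib_ract y (star b));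
  ib_compat : forall x y z, ib_lact (ib_lip x y) z = ib_ract x (ib_rip y z) }.

Definition strongly_morita_equivalent A B : Prop :=
  inhabited (imprimitivity_bimodule A B).

End CStarNotions.

(** k-graphs. The composite [kcomp mu nu] is meaningful only when
    [ksrc mu = krng nu]; no axiom constrains its other values. Objects are
    distinguished from their identity morphisms [kid v]. *)
Record kgraph (k : nat) := KGraph {
  kobj : countType;
  kmor :> countType;
  krng : kmor -> kobj;
  ksrc : kmor -> kobj;
  kid : kobj -> kmor;
  kcomp : kmor -> kmor -> kmor;
  kdeg : kmor -> {ffun 'I_k -> nat};
  krng_id : forall v, krng (kid v) = v;
  ksrc_id : forall v, ksrc (kid v) = v;
  krng_comp : forall mu nu, ksrc mu = krng nu -> krng (kcomp mu nu) = krng mu;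
  ksrc_comp : forall mu nu, ksrc mu = krng nu -> ksrc (kcomp mu nu) = ksrc nu;
  kcomp_idl : forall mu, kcomp (kid (krng mu)) mu = mu;
  kcomp_idr : forall mu, kcomp mu (kid (ksrc mu)) = mu;
  kcompA : forall la mu nu, ksrc la = krng mu -> ksrc mu = krng nu ->
    kcomp la (kcomp mu nu) = kcomp (kcomp la mu) nu;
  kdeg_id : forall v, kdeg (kid v) = 0;
  kdeg_comp : forall mu nu, ksrc mu = krng nu ->
    kdeg (kcomp mu nu) = kdeg mu + kdeg nu;
  kfactor : forall la m n, kdeg la = m + n ->
    exists! p : kmor * kmor,
      [/\ ksrc p.1 = krng p.2, kdeg p.1 = m, kdeg p.2 = n
        & la = kcomp p.1 p.2] }.

Section KGraphNotions.
Variables (k : nat) (L : kgraph k).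
Implicit Types (n m : {ffun 'I_k -> nat}) (v : kobj L) (la mu : L).

Definition kgen (i : 'I_k) : {ffun 'I_k -> nat} :=
  [ffun j => nat_of_bool (j == i)].

Definition kpaths n : set L := [set la | kdeg la = n].

Definition krange v (E : set L) : set L := [set la | E la /\ krng la = v].

Definition kgraph_row_finite : Prop :=
  forall v n, finite_set (krange v (kpaths n)).

Definition kgraph_locally_convex : Prop := forall (i j : 'I_k) mu,
  i != j -> kpaths (kgen i) mu ->
  krange (krng mu) (kpaths (kgen j)) !=set0 ->
  krange (ksrc mu) (kpaths (kgen j)) !=set0.

Definition kpaths_le n : set L := [set la |
  (forall i, (kdeg la i <= n i)%N) /\
  forall i, (kdeg la i < n i)%N -> krange (ksrc la) (kpaths (kgen i)) = set0].

Lemma kpaths0P la : kpaths 0 la <-> exists v, la = kid v.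
Proof.
split=> [la0|[v ->]]; last exact: kdeg_id.
have [p [_ uniq_p]] := @kfactor _ L la 0 0 (etrans la0 (esym (addr0 _))).
exists (krng la).
have p1 : p = (kid (krng la), la).
  by apply: uniq_p; split; rewrite /= ?ksrc_id ?kdeg_id ?kcomp_idl.
have p2 : p = (la, kid (ksrc la)).
  by apply: uniq_p; split; rewrite /= ?krng_id ?kdeg_id ?kcomp_idr.
by move: p1; rewrite p2 => -[].
Qed.

Variable C : numClosedFieldType.

(** Under row-finiteness every set [v Lambda^{<= n}] is finite, so that the
    finitely supported sum below is the actual sum over that set. *)
Record is_ck_family (A : cstarAlgType C) (s : L -> A) : Prop := IsCKFamily {
  ck_proj : forall v, is_projection (s (kid v));
  ck_orth : forall v w, v != w -> s (kid v) ** s (kid w) = 0;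
  ck_comp : forall mu nu : L, ksrc mu = krng nu ->
    s mu ** s nu = s (kcomp mu nu);
  ck_star : forall mu, star (s mu) ** s mu = s (kid (ksrc mu));
  ck_sum : forall v n,
    s (kid v) = \sum_(la \in krange v (kpaths_le n)) s la ** star (s la) }.

(** [A], generated by [s], is the universal C*-algebra C*(Lambda). *)
Record is_kgraph_algebra (A : cstarAlgType C) (s : L -> A) : Prop :=
  IsKGraphAlgebra {
  kga_family : is_ck_family s;
  kga_generates : generates (range s);
  kga_universal : forall (B : cstarAlgType C) (t : L -> B), is_ck_family t ->
    exists2 phi : A -> B, is_star_hom phi & forall la, phi (s la) = t la }.

End KGraphNotions.
Arguments kpaths {k} L n _ : rename.

Section ComplexNumbers.
Variable R : realType.
Local Notation C := (R[i]%type).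
Local Notation cRe := (@complex.Re R).
Local Notation cIm := (@complex.Im R).
Local Open Scope complex_scope.

Lemma cRe_norm_ge0 (V : normedModType C) (x : V) : 0 <= cRe `|x|.
Proof. by have := normr_ge0 x; rewrite lecE /= => /andP[]. Qed.

Lemma norm_cReE (V : normedModType C) (x : V) : `|x| = (cRe `|x|)%:C.
Proof. by rewrite RRe_real // normr_real. Qed.

Lemma norm_real_complex (x : R) : `|x%:C| = `|x|%:C.
Proof. by rewrite (normc_def x%:C) /= expr0n /= addr0 sqrtr_sqr. Qed.

Lemma norm_cRe_le (z : C) : `|cRe z|%:C <= `|z|.
Proof. by rewrite (normc_def z) lecR -sqrtr_sqr ler_wsqrtr// lerDl sqr_ge0. Qed.

Lemma norm_cIm_le (z : C) : `|cIm z|%:C <= `|z|.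
Proof. by rewrite (normc_def z) lecR -sqrtr_sqr ler_wsqrtr// lerDr sqr_ge0. Qed.

Lemma norm_le_cReIm (z : C) : `|z| <= (`|cRe z| + `|cIm z|)%:C.
Proof.
rewrite [in `|z|](complexE z) (le_trans (ler_normD _ _))// normrM.
rewrite rmorphD /= !norm_real_complex lerD2l ler_piMl ?lecR//.
by rewrite /Normc.normc expr0n expr1n add0r sqrtr1.
Qed.

Lemma gt0_complex (e : C) : 0 < e -> exists2 r : R, 0 < r & e = r%:C.
Proof.
move=> e0; exists (cRe e); first by move: e0; rewrite ltcE => /andP[].
by rewrite RRe_real // gtr0_real.
Qed.

Lemma complex_complete (F : set_system C^o) :
  ProperFilter F -> cauchy F -> cvg F.
Proof.
move=> FF /cauchyP Fc.
have part (f : C^o -> R) : {morph f : x y / x - y} ->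
    (forall z, `|f z|%:C <= `|z|) -> cvg (f @ F).
  move=> fB fle; apply: R_complete; apply: cauchy_exP => e e0.
  have [|x Fx] := Fc e%:C; first by rewrite ltcR.
  exists (f x); change (F (f @^-1` ball (f x) e)).
  apply: filterS Fx => y; rewrite -!ball_normE /=.
  move=> xy; change (`|f x - f y| < e); rewrite -fB -ltcR.
  exact: le_lt_trans (fle _) xy.
have /cvg_ex[a /cvgrPdist_lt Fa] := part cRe (raddfB _) norm_cRe_le.
have /cvg_ex[b /cvgrPdist_lt Fb] := part cIm (raddfB _) norm_cIm_le.
apply/cvg_ex; exists (a +i* b); apply/cvgrPdist_lt => e /gt0_complex[r r0 ->].
near=> z; rewrite (le_lt_trans (norm_le_cReIm _))// ltcR !raddfB /= (splitr r).
by rewrite ltrD//; near: z; [apply: Fa|apply: Fb]; rewrite divr_gt0.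
Unshelve. all: by end_near. Qed.

HB.instance Definition _ := Uniform_isComplete.Build C^o complex_complete.

Lemma complex_continuous (T : topologicalType) (f g : T -> R) :
  continuous f -> continuous g ->
  continuous (fun t => (f t +i* g t) : C^o).
Proof.
move=> fc gc t; apply/cvgrPdist_lt => e /gt0_complex[r r0 ->].
have /cvgrPdist_lt ft := fc t; have /cvgrPdist_lt gt := gc t.
near=> u; rewrite (le_lt_trans (norm_le_cReIm _))// ltcR /= (splitr r).
by rewrite ltrD//; near: u; [apply: ft|apply: gt]; rewrite divr_gt0.
Unshelve. all: by end_near. Qed.

Lemma conj_continuous (T : topologicalType) (f : T -> C^o) :
  continuous f -> continuous (fun t => (f t)^* : C^o).
Proof.
move=> fc t; have /cvgrPdist_lt ft := fc t.
apply/cvgrPdist_lt => e e0; near=> u.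
by rewrite -rmorphB norm_conjC; near: u; exact: ft.
Unshelve. all: by end_near. Qed.

End ComplexNumbers.

(** C(X) for a compact space X, with the supremum norm. *)
Section ContinuousFunctions.
Variables (R : realType) (X : topologicalType) (cptX : compact [set: X]).
Local Notation C := (R[i]%type).
Local Notation cRe := (@complex.Re R).
Local Open Scope complex_scope.

Definition cont_alg of compact [set: X] : Type := continuousType X C^o.
Local Notation CX := (cont_alg cptX).

HB.instance Definition _ := Choice.copy CX (continuousType X C^o).

Definition cont_fun (f : CX) : X -> C^o := (f : continuousType X C^o).
Definition cont_mk (f : X -> C^o) (cf : continuous f) : CX :=
  (mkcts cf : continuousType X C^o).

Implicit Types f g h : CX.

Lemma cont_funP f : continuous (cont_fun f). Proof. exact: cts_fun. Qed.

Lemma cont_ext f g : cont_fun f =1 cont_fun g -> f = g.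
Proof. by move=> fg; apply/continuousEP. Qed.

Fact cont0_subproof : continuous (fun _ : X => 0 : C^o).
Proof. by move=> x; exact: cvg_cst. Qed.
Fact contD_subproof f g : continuous (fun x => cont_fun f x + cont_fun g x).
Proof. by move=> x; apply: cvgD; exact: cont_funP. Qed.
Fact contN_subproof f : continuous (fun x => - cont_fun f x).
Proof. by move=> x; apply: cvgN; exact: cont_funP. Qed.
Fact contZ_subproof (c : C) f : continuous (fun x => c *: cont_fun f x).
Proof. by move=> x; apply: cvgZ; [exact: cvg_cst|exact: cont_funP]. Qed.
Fact contM_subproof f g :
  continuous (fun x => (cont_fun f x : C) * cont_fun g x : C^o).
Proof. by move=> x; apply: (@cvgZ C C^o); exact: cont_funP. Qed.
Fact contJ_subproof f : continuous (fun x => (cont_fun f x : C)^*%R : C^o).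
Proof. exact/conj_continuous/cont_funP. Qed.

Definition cont0 : CX := cont_mk cont0_subproof.
Definition contD f g : CX := cont_mk (@contD_subproof f g).
Definition contN f : CX := cont_mk (@contN_subproof f).
Definition contZ (c : C) f : CX := cont_mk (@contZ_subproof c f).
Definition contM f g : CX := cont_mk (@contM_subproof f g).
Definition contJ f : CX := cont_mk (@contJ_subproof f).

Fact contDA : associative contD.
Proof. by move=> f g h; apply: cont_ext => x; exact: addrA. Qed.
Fact contDC : commutative contD.
Proof. by move=> f g; apply: cont_ext => x; exact: addrC. Qed.
Fact cont0D : left_id cont0 contD.
Proof. by move=> f; apply: cont_ext => x; exact: add0r. Qed.
Fact contND : left_inverse cont0 contN contD.
Proof. by move=> f; apply: cont_ext => x; exact: addNr. Qed.

HB.instance Definition _ := GRing.isZmodule.Build CX contDA contDC cont0D contND.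

Fact contZA (a b : C) f : contZ a (contZ b f) = contZ (a * b) f.
Proof. by apply: cont_ext => x; exact: scalerA. Qed.
Fact cont1Z : left_id 1 contZ.
Proof. by move=> f; apply: cont_ext => x; exact: scale1r. Qed.
Fact contZDr : right_distributive contZ +%R.
Proof. by move=> a f g; apply: cont_ext => x; exact: scalerDr. Qed.
Fact contZDl f : {morph contZ^~ f : a b / a + b}.
Proof. by move=> a b; apply: cont_ext => x; exact: scalerDl. Qed.

HB.instance Definition _ :=
  GRing.Zmodule_isLmodule.Build C CX contZA cont1Z contZDr contZDl.

Definition cont_sup f : R := sup [set cRe `|cont_fun f x| | x in [set: X]].

Lemma cont_sup_has_ub f : has_ubound [set cRe `|cont_fun f x| | x in [set: X]].
Proof.
have cN : continuous (fun x => cRe `|cont_fun f x| : R^o).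
  move=> x; have /cvgrPdist_lt fx := cont_funP (f := f) (x := x).
  apply/cvgrPdist_lt => e e0; near=> y.
  rewrite -ltcR; apply: (@le_lt_trans _ _ `|cont_fun f x - cont_fun f y|).
    rewrite -raddfB; apply: (le_trans (norm_cRe_le _)).
    exact: (@ler_dist_dist C C^o).
  by near: y; apply: fx; rewrite ltcR.
have /compact_bounded[M [_ MN]] :=
  continuous_compact (continuous_subspaceT cN) cptX.
exists (M + 1) => _ [x _ <-].
have := MN (M + 1) (ltr_pwDr ltr01 (lexx _)) (cRe `|cont_fun f x|).
by move=> /(_ (ex_intro2 _ _ x I erefl)); apply: le_trans; exact: ler_norm.
Unshelve. all: by end_near. Qed.

Lemma cont_sup_ge f x : `|cont_fun f x| <= (cont_sup f)%:C.
Proof.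
rewrite (norm_cReE (cont_fun f x)) lecR.
by apply: ub_le_sup; [exact: cont_sup_has_ub|exists x].
Qed.

Lemma cont_sup_le f (r : R) : 0 <= r -> (forall x, `|cont_fun f x| <= r%:C) ->
  cont_sup f <= r.
Proof.
move=> r0 fr; rewrite /cont_sup; set E := (E in sup E).
have [->|/set0P E0] := eqVneq E set0; first by rewrite sup0.
apply: ge_sup => // _ [x _ <-].
by have := fr x; rewrite (norm_cReE (cont_fun f x)) lecR.
Qed.

Lemma cont_sup_ge0 f : 0 <= cont_sup f.
Proof.
rewrite /cont_sup; set E := (E in sup E).
have [->|/set0P[_ [x _ _]]] := eqVneq E set0; first by rewrite sup0.
rewrite -lecR; apply: le_trans (cont_sup_ge f x); exact: normr_ge0.
Qed.

Definition cont_norm f : C := (cont_sup f)%:C.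

Fact cont_normD f g : cont_norm (f + g) <= cont_norm f + cont_norm g.
Proof.
rewrite /cont_norm -rmorphD lecR cont_sup_le ?addr_ge0 ?cont_sup_ge0// => x.
rewrite rmorphD (le_trans (ler_normD (cont_fun f x) (cont_fun g x)))//.
by rewrite lerD ?cont_sup_ge.
Qed.

Fact cont_normZ (c : C) f : cont_norm (c *: f) = `|c| * cont_norm f.
Proof.
have le_normZ (a : C) g : cont_norm (a *: g) <= `|a| * cont_norm g.
  have ca : `|a| = (cRe `|a|)%:C := norm_cReE (a : C^o).
  have a0 : 0 <= cRe `|a| by rewrite -lecR -ca; exact: normr_ge0.
  rewrite /cont_norm ca -rmorphM lecR cont_sup_le ?mulr_ge0 ?cont_sup_ge0//.
  move=> x; have : `|a *: cont_fun g x| <= `|a| * (cont_sup g)%:C.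
    by rewrite normrZ ler_wpM2l ?cont_sup_ge.
  by rewrite ca -rmorphM.
apply/eqP; rewrite eq_le le_normZ /=.
have [->|c0] := eqVneq c 0.
  by rewrite normr0 mul0r /cont_norm lecR cont_sup_ge0.
rewrite -[f in leLHS](scale1r f) -(mulVf c0) -scalerA.
rewrite (le_trans (ler_wpM2l _ (le_normZ _ _)))//.
by rewrite mulrA normfV divff ?mul1r// normr_eq0.
Qed.

Fact cont_norm0_eq0 f : cont_norm f = 0 -> f = 0.
Proof.
move=> f0; apply: cont_ext => x; have := cont_sup_ge f x.
by rewrite -/(cont_norm f) f0 normr_le0 => /eqP.
Qed.

HB.instance Definition _ :=
  Lmodule_isNormed.Build C CX cont_normD cont_normZ cont_norm0_eq0.

Lemma cont_normE f : `|f| = (cont_sup f)%:C. Proof. by []. Qed.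

Lemma cont_norm_ge f x : `|cont_fun f x| <= `|f|.
Proof. exact: cont_sup_ge. Qed.

Lemma cont_norm_le f (r : R) : 0 <= r -> (forall x, `|cont_fun f x| <= r%:C) ->
  `|f| <= r%:C.
Proof. by move=> r0 fr; rewrite cont_normE lecR cont_sup_le. Qed.

Fact cont_complete (F : set_system CX) : ProperFilter F -> cauchy F -> cvg F.
Proof.
move=> FF /cauchyP Fc.
have near_ball (e : C) : 0 < e -> exists f, F [set g | `|f - g| < e].
  by move=> e0; have [f Ff] := Fc _ e0; exists f; rewrite -ball_normE in Ff.
have leN f g x : `|cont_fun f x - cont_fun g x| <= `|f - g|.
  exact: (cont_norm_ge (f - g)).
have evcvg x : cvg ((fun f : CX => cont_fun f x) @ F).
  apply: complex_complete; apply: cauchy_exP => e /near_ball[f Ff].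
  exists (cont_fun f x).
  change (F (cont_fun^~ x @^-1` ball (cont_fun f x) e)).
  apply: filterS Ff => g /= fg; rewrite -ball_normE /=.
  exact: le_lt_trans (leN _ _ _) fg.
pose l x : C^o := lim ((fun f : CX => cont_fun f x) @ F).
have lP (e : C) : 0 < e ->
    exists2 f, F [set g | `|f - g| < e] & forall x, `|l x - cont_fun f x| <= e.
  move=> /[dup] e0 /near_ball[f Ff]; exists f => // x; apply/ler_addgt0Pr => d d0.
  have /cvgrPdist_lt/(_ _ d0) lx := evcvg x.
  have [g [fg lg]] := filter_ex (filterI Ff lx).
  rewrite -(subrKA (cont_fun g x)) addrC (le_trans (ler_normD _ _))// lerD//.
    by rewrite distrC; apply: le_trans (leN _ _ _) (ltW fg).
  exact: ltW.
have lc : continuous l.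
  move=> x; apply/cvgrPdist_lt => e e0.
  have e3 : 0 < e / 3 by rewrite divr_gt0.
  have [f _ lf] := lP _ e3.
  have /cvgrPdist_lt/(_ _ e3) fx := cont_funP (f := f) (x := x).
  near=> y; have fxy : `|cont_fun f x - cont_fun f y| < e / 3 by near: y.
  have -> : l x - l y = (l x - cont_fun f x) +
      ((cont_fun f x - cont_fun f y) + (cont_fun f y - l y)).
    by rewrite !subrKA.
  have -> : e = e / 3 + (e / 3 + e / 3) by field.
  apply: le_lt_trans (ler_normD _ _) _; apply: ler_ltD; first exact: lf.
  apply: le_lt_trans (ler_normD _ _) _; apply: ltr_leD => //.
  by rewrite distrC; exact: lf.
apply/cvg_ex; exists (cont_mk lc); apply/cvgrPdist_lt => e e0.
have e2 : 0 < e / 2 by rewrite divr_gt0.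
have [r r0 er] := gt0_complex e2.
have [f Ff lf] := lP _ e2.
apply: filterS Ff => g fg; rewrite -(subrKA f) (splitr e).
rewrite (le_lt_trans (ler_normD _ _))// ler_ltD//.
rewrite er; apply: cont_norm_le; first exact: ltW.
by move=> x; rewrite -er; exact: lf.
Unshelve. all: by end_near. Qed.

HB.instance Definition _ := Uniform_isComplete.Build CX cont_complete.

Fact contMA : associative contM.
Proof. by move=> f g h; apply: cont_ext => x; exact: mulrA. Qed.
Fact contMDl : left_distributive contM +%R.
Proof. by move=> f g h; apply: cont_ext => x; exact: mulrDl. Qed.
Fact contMDr : right_distributive contM +%R.
Proof. by move=> f g h; apply: cont_ext => x; exact: mulrDr. Qed.
Fact contMZl (c : C) f g : contM (c *: f) g = c *: contM f g.
Proof. by apply: cont_ext => x; exact: (esym (mulrA _ _ _)). Qed.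
Fact contMZr (c : C) f g : contM f (c *: g) = c *: contM f g.
Proof. by apply: cont_ext => x; exact: mulrCA. Qed.
Fact contJK : involutive contJ.
Proof. by move=> f; apply: cont_ext => x; exact: conjCK. Qed.
Fact contJD : {morph contJ : f g / f + g}.
Proof. by move=> f g; apply: cont_ext => x; exact: rmorphD. Qed.
Fact contJZ (c : C) f : contJ (c *: f) = (c^*)%R *: contJ f.
Proof. by apply: cont_ext => x; exact: rmorphM. Qed.
Fact contJM f g : contJ (contM f g) = contM (contJ g) (contJ f).
Proof. by apply: cont_ext => x; rewrite [LHS]rmorphM mulrC. Qed.

Fact cont_normM f g : `|contM f g| <= `|f| * `|g|.
Proof.
rewrite !cont_normE -rmorphM lecR cont_sup_le ?mulr_ge0 ?cont_sup_ge0// => x.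
by rewrite [cont_fun _ x]/(_ * _) normrM rmorphM ler_pM ?cont_sup_ge.
Qed.

Fact cont_cstar f : `|contM (contJ f) f| = `|f| ^+ 2.
Proof.
have jN x : `|cont_fun (contM (contJ f) f) x| = `|cont_fun f x| ^+ 2.
  have : `|(cont_fun f x : C)^*%R * cont_fun f x| = `|cont_fun f x| ^+ 2.
    by rewrite normrM norm_conjC expr2.
  by [].
rewrite !cont_normE -rmorphXn; congr (_%:C); apply/eqP; rewrite eq_le.
apply/andP; split.
  apply: cont_sup_le; first by rewrite exprn_ge0 ?cont_sup_ge0.
  by move=> x; rewrite jN rmorphXn lerXn2r ?nnegrE ?cont_sup_ge// (le_trans _ (cont_sup_ge f x)).
have S0 := cont_sup_ge0 (contM (contJ f) f).
rewrite -[leRHS]sqr_sqrtr// lerXn2r ?nnegrE ?cont_sup_ge0 ?sqrtr_ge0//.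
apply: cont_sup_le; first exact: sqrtr_ge0.
move=> x; rewrite -(@ler_pXn2r _ 2) ?nnegrE ?ler0c ?sqrtr_ge0//.
  by rewrite -jN -rmorphXn sqr_sqrtr// cont_sup_ge.
exact: (cRe_norm_ge0 (cont_fun f x)).
Qed.

HB.instance Definition _ := CompleteNormedModule_isCStarAlgebra.Build C CX
  contMA contMDl contMDr contMZl contMZr contJK contJD contJZ contJM
  cont_normM cont_cstar.

End ContinuousFunctions.

Section Torus.
Variable R : realType.
Local Open Scope complex_scope.

Definition circle : Type :=
  initial_topology (fun z : {z : R[i] | `|z| == 1} => sval z : R[i]^o).
HB.instance Definition _ := Topological.on circle.

Definition torus (l : nat) : topologicalType :=
  prod_topology (fun _ : 'I_l => circle).

Lemma circle_compact : compact [set: circle].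
Proof.
pose I1 : set R := [set` `[(-1), 1]].
pose phi (p : R * R) : R[i]^o := p.1 +i* p.2.
pose N2 (p : R * R) : R^o := p.1 ^+ 2 + p.2 ^+ 2.
pose psi (p : R * R) : circle :=
  insubd (exist (fun z : R[i] => `|z| == 1) 1 (introT eqP (normr1 _))) (phi p).
pose D := (I1 `*` I1) `&` N2 @^-1` [set 1].
have normphi p : `|phi p| = (Num.sqrt (N2 p))%:C by [].
have phic : continuous phi.
  by apply: complex_continuous => p; [exact: cvg_fst|exact: cvg_snd].
have N2c : continuous N2.
  move=> p; apply: cvgD; rewrite /GRing.exp /=.
    by apply: cvgM; exact: cvg_fst.
  by apply: cvgM; exact: cvg_snd.
have Dc : compact D.
  apply: compact_closedI.
    exact: compact_setX (@segment_compact R _ _) (@segment_compact R _ _).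
  by apply: preimage_closed => [p _|]; [exact: N2c|exact: closed_eq].
have psiD p : D p -> sval (psi p) = phi p.
  move=> [_ /= N2p]; apply: (@insubdK _ _ {z : R[i] | `|z| == 1}).
  by rewrite unfold_in normphi N2p sqrtr1.
have spsic : {within D, continuous (fun p => sval (psi p) : R[i]^o)}.
  have phipsi : {in D, phi =1 (fun p => sval (psi p))}.
    by move=> p /set_mem /psiD.
  exact: (@subspace_eq_continuous _ D _ phi _ phipsi (continuous_subspaceT phic)).
have psic : {within D, continuous psi} by exact: continuous_comp_initial.
have -> : [set: circle] = psi @` D.
  apply/seteqP; split=> // -[z z1] _.
  have zE : phi (complex.Re z, complex.Im z) = z by case: z {z1}.
  have sqr_le1 (x y : R) : x ^+ 2 + y ^+ 2 = 1 -> x \in `[-1, 1].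
    move=> xy; rewrite in_itv /= -ler_norml -(@ler_pXn2r _ 2)// ?nnegrE//.
    by rewrite expr1n real_normK ?num_real// -xy lerDl sqr_ge0.
  have zD : D (complex.Re z, complex.Im z).
    have N1 : N2 (complex.Re z, complex.Im z) = 1.
      move: (eqP z1); rewrite -zE normphi => -[/(congr1 (fun x => x ^+ 2))].
      by rewrite expr1n sqr_sqrtr// addr_ge0// sqr_ge0.
    split=> //; split; first exact: sqr_le1 N1.
    by apply: sqr_le1; rewrite addrC; exact: N1.
  exists (complex.Re z, complex.Im z) => //.
  by apply: val_inj; rewrite /= psiD.
exact: continuous_compact.
Qed.

Lemma torus_compact (l : nat) : compact [set: torus l].
Proof.
have := @tychonoff 'I_l (fun=> circle) (fun=> setT) (fun=> circle_compact).
by congr (compact _); apply/seteqP; split.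
Qed.

(** C(T^l); in particular T^0 is a one-point space. *)
Definition cont_torus (l : nat) : cstarAlgType R[i] := cont_alg R (@torus_compact l).

End Torus.

(** Finite direct sums, with the maximum norm. *)
Section DirectSum.
Variables (R : realType) (I : finType) (A : I -> cstarAlgType R[i]).
Local Notation cRe := (@complex.Re R).
Local Open Scope complex_scope.

Definition dsum : Type := forall i, A i.

HB.instance Definition _ := gen_eqMixin dsum.
HB.instance Definition _ := gen_choiceMixin dsum.

Implicit Types f g h : dsum.

Lemma dsum_ext f g : (forall i, f i = g i) -> f = g.
Proof. exact: functional_extensionality_dep. Qed.

Definition dsum0 : dsum := fun i => 0.
Definition dsumD f g : dsum := fun i => f i + g i.
Definition dsumN f : dsum := fun i => - f i.
Definition dsumZ (c : R[i]) f : dsum := fun i => c *: f i.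
Definition dsumM f g : dsum := fun i => f i ** g i.
Definition dsumJ f : dsum := fun i => star (f i).

Fact dsumDA : associative dsumD.
Proof. by move=> f g h; apply: dsum_ext => x; exact: addrA. Qed.
Fact dsumDC : commutative dsumD.
Proof. by move=> f g; apply: dsum_ext => x; exact: addrC. Qed.
Fact dsum0D : left_id dsum0 dsumD.
Proof. by move=> f; apply: dsum_ext => x; exact: add0r. Qed.
Fact dsumND : left_inverse dsum0 dsumN dsumD.
Proof. by move=> f; apply: dsum_ext => x; exact: addNr. Qed.

HB.instance Definition _ :=
  GRing.isZmodule.Build dsum dsumDA dsumDC dsum0D dsumND.

Fact dsumZA (a b : R[i]) f : dsumZ a (dsumZ b f) = dsumZ (a * b) f.
Proof. by apply: dsum_ext => x; exact: scalerA. Qed.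
Fact dsum1Z : left_id 1 dsumZ.
Proof. by move=> f; apply: dsum_ext => x; exact: scale1r. Qed.
Fact dsumZDr : right_distributive dsumZ +%R.
Proof. by move=> a f g; apply: dsum_ext => x; exact: scalerDr. Qed.
Fact dsumZDl f : {morph dsumZ^~ f : a b / a + b}.
Proof. by move=> a b; apply: dsum_ext => x; exact: scalerDl. Qed.

HB.instance Definition _ :=
  GRing.Zmodule_isLmodule.Build R[i] dsum dsumZA dsum1Z dsumZDr dsumZDl.

Definition dsum_max f : R := \big[Num.max/0]_(i : I) cRe `|f i|.
Definition dsum_norm f : R[i] := (dsum_max f)%:C.

Lemma dsum_max_ge0 f : 0 <= dsum_max f.
Proof. exact: bigmax_ge_id. Qed.

Lemma dsum_norm_ge f i : `|f i| <= dsum_norm f.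
Proof. by rewrite norm_cReE lecR; exact: le_bigmax. Qed.

Lemma dsum_norm_le f (c : R[i]) : 0 <= c -> (forall i, `|f i| <= c) ->
  dsum_norm f <= c.
Proof.
move=> c0 fc; have cE : (cRe c)%:C = c by rewrite RRe_real// ger0_real.
rewrite /dsum_norm -cE lecR; apply: bigmax_le => [|i _].
  by rewrite -ler0c cE.
by rewrite -lecR cE -norm_cReE; exact: fc.
Qed.

Lemma dsum_norm_ge0 f : 0 <= dsum_norm f.
Proof. by rewrite ler0c dsum_max_ge0. Qed.

Fact dsum_normD f g : dsum_norm (f + g) <= dsum_norm f + dsum_norm g.
Proof.
apply: dsum_norm_le => [|i]; first by rewrite addr_ge0 ?dsum_norm_ge0.
by rewrite (le_trans (ler_normD (f i) (g i)))// lerD ?dsum_norm_ge.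
Qed.

Fact dsum_normZ (c : R[i]) f : dsum_norm (c *: f) = `|c| * dsum_norm f.
Proof.
have le_normZ (a : R[i]) g : dsum_norm (a *: g) <= `|a| * dsum_norm g.
  apply: dsum_norm_le => [|i]; first by rewrite mulr_ge0 ?dsum_norm_ge0.
  by rewrite [X in `|X|]/(a *: g i) normrZ ler_wpM2l ?dsum_norm_ge.
apply/eqP; rewrite eq_le le_normZ /=.
have [->|c0] := eqVneq c 0; first by rewrite normr0 mul0r dsum_norm_ge0.
rewrite -[f in leLHS](scale1r f) -(mulVf c0) -scalerA.
rewrite (le_trans (ler_wpM2l _ (le_normZ _ _)))//.
by rewrite mulrA normfV divff ?mul1r// normr_eq0.
Qed.

Fact dsum_norm0_eq0 f : dsum_norm f = 0 -> f = 0.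
Proof.
move=> f0; apply: dsum_ext => i; have := dsum_norm_ge f i.
by rewrite f0 normr_le0 => /eqP.
Qed.

HB.instance Definition _ :=
  Lmodule_isNormed.Build R[i] dsum dsum_normD dsum_normZ dsum_norm0_eq0.

Lemma dsum_normE f : `|f| = dsum_norm f. Proof. by []. Qed.

Fact dsum_complete (F : set_system dsum) :
  ProperFilter F -> cauchy F -> cvg F.
Proof.
move=> FF /cauchyP Fc.
have evcvg i : cvg ((fun f : dsum => f i) @ F).
  apply: cauchy_cvg; apply: cauchy_exP => e e0; have [f Ff] := Fc _ e0.
  exists (f i); change (F ((fun f : dsum => f i) @^-1` ball (f i) e)).
  apply: filterS Ff => g /=; rewrite -!ball_normE /=.
  exact: le_lt_trans (dsum_norm_ge (f - g) i).
pose l : dsum := fun i => lim ((fun f : dsum => f i) @ F).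
apply/cvg_ex; exists l; apply/cvgrPdist_le => e e0.
have : \forall f \near F, forall i, `|l i - f i| <= e.
  by apply: filter_forall => i; have /cvgrPdist_le := evcvg i; exact.
apply: filterS => f lf; rewrite dsum_normE; apply: dsum_norm_le => //.
exact: ltW.
Qed.

HB.instance Definition _ := Uniform_isComplete.Build dsum dsum_complete.

Fact dsumMA : associative dsumM.
Proof. by move=> f g h; apply: dsum_ext => x; exact: cmulA. Qed.
Fact dsumMDl : left_distributive dsumM +%R.
Proof. by move=> f g h; apply: dsum_ext => x; exact: cmulDl. Qed.
Fact dsumMDr : right_distributive dsumM +%R.
Proof. by move=> f g h; apply: dsum_ext => x; exact: cmulDr. Qed.
Fact dsumMZl (c : R[i]) f g : dsumM (c *: f) g = c *: dsumM f g.
Proof. by apply: dsum_ext => x; exact: cmulZl. Qed.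
Fact dsumMZr (c : R[i]) f g : dsumM f (c *: g) = c *: dsumM f g.
Proof. by apply: dsum_ext => x; exact: cmulZr. Qed.
Fact dsumJK : involutive dsumJ.
Proof. by move=> f; apply: dsum_ext => x; exact: starK. Qed.
Fact dsumJD : {morph dsumJ : f g / f + g}.
Proof. by move=> f g; apply: dsum_ext => x; exact: starD. Qed.
Fact dsumJZ (c : R[i]) f : dsumJ (c *: f) = (c^*)%R *: dsumJ f.
Proof. by apply: dsum_ext => x; exact: starZ. Qed.
Fact dsumJM f g : dsumJ (dsumM f g) = dsumM (dsumJ g) (dsumJ f).
Proof. by apply: dsum_ext => x; exact: starM. Qed.

Fact dsum_normM f g : `|dsumM f g| <= `|f| * `|g|.
Proof.
rewrite !dsum_normE; apply: dsum_norm_le => [|i].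
  by rewrite mulr_ge0 ?dsum_norm_ge0.
by rewrite (le_trans (cnormM _ _))// ler_pM// dsum_norm_ge.
Qed.

Fact dsum_cstar f : `|dsumM (dsumJ f) f| = `|f| ^+ 2.
Proof.
have jN i : `|dsumM (dsumJ f) f i| = `|f i| ^+ 2 by exact: cstar_norm.
rewrite !dsum_normE; apply/eqP; rewrite eq_le; apply/andP; split.
  apply: dsum_norm_le => [|i]; first by rewrite exprn_ge0 ?dsum_norm_ge0.
  by rewrite jN lerXn2r ?nnegrE ?dsum_norm_ge// dsum_norm_ge0.
rewrite -[leRHS]sqrtCK lerXn2r ?nnegrE ?dsum_norm_ge0 ?sqrtC_ge0 ?dsum_norm_ge0//.
apply: dsum_norm_le => [|i]; first by rewrite sqrtC_ge0 dsum_norm_ge0.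
rewrite -(@ler_pXn2r _ 2) ?nnegrE ?sqrtC_ge0 ?dsum_norm_ge0//.
by rewrite -jN sqrtCK dsum_norm_ge.
Qed.

HB.instance Definition _ := CompleteNormedModule_isCStarAlgebra.Build R[i] dsum
  dsumMA dsumMDl dsumMDr dsumMZl dsumMZr dsumJK dsumJD dsumJZ dsumJM
  dsum_normM dsum_cstar.

End DirectSum.

(* Main.v *)
(** The boundary path representation on l2 shows that every vertex projection
    [s_v] is nonzero. The range projection of a cycle is equivalent to that of
    its base vertex, so without infinite projections a cycle has no entrance.
    As there are finitely many vertices, every long enough path ends at a
    terminal vertex [w]: one with [s_ta s_ta^* = s_w] for all paths [ta] of
    range [w]. At such a [w] the elements [s_ta s_ta'^*] form a group of
    unitaries, graded by degree in a subgroup of [Z^k] of some rank [l];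
    characters exist because compression to the unique boundary path at [w] is
    multiplicative, and they determine the norm because the coefficients of
    powers grow only polynomially. Hence [s_w C*(L) s_w] is [C(T^l)] by
    Stone-Weierstrass. Choosing one terminal vertex in each class of connected
    ones gives mutually orthogonal vertex projections whose sum is full. *)

Require Import Defs.
From HB Require Import structures.
From mathcomp Require Import all_boot all_order all_algebra complex.
From mathcomp Require Import all_classical all_reals topology normedtype.
From mathcomp Require Import sequences realfun ring lra finmap zify.

Set Implicit Arguments.
Unset Strict Implicit.
Unset Printing Implicit Defensive.

Import Order.TTheory GRing.Theory Num.Theory.
Import numFieldNormedType.Exports.

Local Open Scope classical_set_scope.
Local Open Scope ring_scope.
Local Open Scope cstar_scope.

(** * C*-algebras *)

(** The relations only say that a vertex projection is the sum of the range projections of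
    [v Lambda^{<= n}]; the mutual orthogonality of these ranges, on which every computation with
    [s_mu^* s_nu] rests, has to be derived. Elementary norm estimates carry the argument:
    orthogonality comes from the extremality of a projection in the unit ball of its corner, the
    bound on characters from a Neumann series, the isometry from the C*-identity on iterated
    squares. The equivalence bimodule is [A p], where [p] is the sum of the chosen vertex
    projections. The delicate point is the positivity of its inner product with values in the direct
    sum: a positive element is by definition [b^* b] with [b] in that same algebra, while an element
    [x] of [A p] need not lie in a corner. Writing the unit as a sum of range projections of paths
    that end at terminal vertices turns [p x^* x p] into a finite sum of squares from the corners,
    and in [C(T^l)] such a sum is again a square. *)

Section CStarBasics.
Variables (C : numClosedFieldType) (A : cstarAlgType C).
Implicit Types (a b x y : A) (S G H : set A).

Lemma cmul0l x : 0 ** x = 0 :> A.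
Proof. by apply: (addrI (0 ** x)); rewrite -cmulDl !addr0. Qed.
Lemma cmul0r x : x ** 0 = 0 :> A.
Proof. by apply: (addrI (x ** 0)); rewrite -cmulDr !addr0. Qed.
Lemma cmulNl x y : (- x) ** y = - (x ** y).
Proof. by apply: (addrI (x ** y)); rewrite -cmulDl !subrr cmul0l. Qed.
Lemma cmulNr x y : x ** (- y) = - (x ** y).
Proof. by apply: (addrI (x ** y)); rewrite -cmulDr !subrr cmul0r. Qed.
Lemma cmulBl x y z : (x - y) ** z = x ** z - y ** z :> A.
Proof. by rewrite cmulDl cmulNl. Qed.
Lemma cmulBr x y z : z ** (x - y) = z ** x - z ** y :> A.
Proof. by rewrite cmulDr cmulNr. Qed.

Lemma cmul_suml I r (P : pred I) (F : I -> A) x :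
  (\sum_(i <- r | P i) F i) ** x = \sum_(i <- r | P i) F i ** x.
Proof.
by apply: (big_morph (fun y => y ** x)) => [y z|]; rewrite ?cmulDl ?cmul0l.
Qed.
Lemma cmul_sumr I r (P : pred I) (F : I -> A) x :
  x ** (\sum_(i <- r | P i) F i) = \sum_(i <- r | P i) x ** F i.
Proof. by apply: (big_morph (cmul x)) => [y z|]; rewrite ?cmulDr ?cmul0r. Qed.

Lemma star0 : star 0 = 0 :> A.
Proof. by apply: (addrI (star 0)); rewrite -starD !addr0. Qed.
Lemma starN x : star (- x) = - star x :> A.
Proof. by apply: (addrI (star x)); rewrite -starD !subrr star0. Qed.
Lemma starB x y : star (x - y) = star x - star y :> A.
Proof. by rewrite starD starN. Qed.
Lemma star_sum I r (P : pred I) (F : I -> A) :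
  star (\sum_(i <- r | P i) F i) = \sum_(i <- r | P i) star (F i).
Proof. by apply: (big_morph (@star C A)) => [y z|]; rewrite ?starD ?star0. Qed.
Lemma starI x y : star x = star y -> x = y :> A.
Proof. exact: (inv_inj (@starK C A)). Qed.

Lemma cnorm_star x : `|star x| = `|x|.
Proof.
have le y : `|y| <= `|star y|.
  have [->|y0] := eqVneq y 0; first by rewrite star0.
  have y1 : 0 < `|y| by rewrite normr_gt0.
  by rewrite -(ler_pM2r y1) -expr2 -cstar_norm cnormM.
by apply/eqP; rewrite eq_le le andbT -[X in _ <= `|X|]starK le.
Qed.

Lemma cstar_norm' x : `|x ** star x| = `|x| ^+ 2.
Proof. by rewrite -{1}[x]starK cstar_norm cnorm_star. Qed.

Lemma cmul_star_eq0 x : star x ** x = 0 -> x = 0.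
Proof.
move=> /(congr1 (fun y : A => `|y|)); rewrite cstar_norm normr0 => /eqP.
by rewrite expf_eq0 normr_eq0 => /eqP.
Qed.

Lemma proj_norm_le1 (p : A) : is_projection p -> `|p| <= 1.
Proof.
move=> [pp ps]; have := cstar_norm p; rewrite ps pp.
have [->|p0] := eqVneq p 0; first by rewrite normr0.
by rewrite expr2 -[X in X = _]mulr1 => /mulfI <- //; rewrite normr_eq0.
Qed.

Lemma cmull_continuous a : continuous (@cmul C A a).
Proof.
move=> x; apply/(@cvgrPdist_lt C A) => e e0.
have a1 : 0 < `|a| + 1 by rewrite ltr_wpDl.
near=> y; rewrite -cmulBr; apply: (le_lt_trans (cnormM _ _)).
rewrite (@le_lt_trans _ _ ((`|a| + 1) * `|x - y|))//.
  by rewrite ler_wpM2r// lerDl.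
rewrite -ltr_pdivlMl// mulrC; near: y.
by apply: (@cvgr_dist_lt C A); [exact: cvg_id|rewrite divr_gt0].
Unshelve. all: by end_near. Qed.

Lemma star_continuous : continuous (@star C A).
Proof.
move=> x; apply/(@cvgrPdist_lt C A) => e e0; near=> y; rewrite -starB cnorm_star.
by near: y; apply: (@cvgr_dist_lt C A); [exact: cvg_id|].
Unshelve. all: by end_near. Qed.

Lemma cmulr_continuous a : continuous (fun x : A => x ** a).
Proof.
have -> : (fun x : A => x ** a) = (@star C A) \o (@cmul C A (star a)) \o (@star C A).
  by apply/funext => x /=; rewrite starM !starK.
move=> x; apply: continuous_comp; first exact: star_continuous.
apply: continuous_comp; first exact: cmull_continuous.
exact: star_continuous.
Qed.

Lemma closed_fixpoints (f : A -> A) : continuous f -> closed [set x | f x = x].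
Proof.
move=> cf; rewrite (_ : mkset _ = (fun x => f x - x) @^-1` [set 0]).
  apply: preimage_closed => [x _|].
    by apply: cvgB; [exact: cf|exact: cvg_id].
  exact: (accessible_closed_set1 (hausdorff_accessible (@norm_hausdorff C A))).
by apply/seteqP; split=> y /=; [move=> ->; rewrite subrr|move/eqP; rewrite subr_eq0 => /eqP].
Qed.

(** Spans are intersections of subspaces, so that membership is itself the induction principle: it
    is used by applying it to a predicate, without writing linear combinations. *)
Definition lspan G : set A := [set a | forall S, is_subspace S -> G `<=` S -> S a].
Definition cspan G : set A := closure (lspan G).

Lemma lspan_subspace G : is_subspace (lspan G).
Proof.
split=> [S [S0 _ _] _ //|x y Gx Gy S sS GS|c x Gx S sS GS]; have [S0 SD SZ] := sS.
  by apply: SD; [exact: Gx|exact: Gy].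
by apply: SZ; exact: Gx.
Qed.

Lemma closureP_norm S a :
  closure S a <-> forall e : C, 0 < e -> exists2 b, S b & `|a - b| < e.
Proof.
split=> [Sa e e0|Sa B /nbhs_ballP[e /= e0 eB]].
  by have [b [Sb]] := Sa _ (nbhsx_ballx a e e0); rewrite -ball_normE; exists b.
by have [b Sb ab] := Sa _ e0; exists b; split=> //; apply: eB; rewrite -ball_normE.
Qed.

Lemma closure_subspace S : is_subspace S -> is_subspace (closure S).
Proof.
move=> [S0 SD SZ]; split; first exact: subset_closure.
- move=> x y /closureP_norm Sx /closureP_norm Sy; apply/closureP_norm => e e0.
  have e2 : 0 < e / 2 by rewrite divr_gt0.
  have [x' Sx' xx'] := Sx _ e2; have [y' Sy' yy'] := Sy _ e2.
  exists (x' + y'); first exact: SD.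
  by rewrite opprD addrACA (splitr e) (le_lt_trans (ler_normD _ _))// ltrD.
- move=> c x /closureP_norm Sx; apply/closureP_norm => e e0.
  have c1 : 0 < `|c| + 1 by rewrite ltr_wpDl.
  have [x' Sx' xx'] := Sx (e / (`|c| + 1)) (divr_gt0 e0 c1).
  exists (c *: x'); first exact: SZ.
  rewrite -scalerBr normrZ (@le_lt_trans _ _ ((`|c| + 1) * `|x - x'|))//.
    by rewrite ler_wpM2r// lerDl.
  by rewrite -ltr_pdivlMl// mulrC.
Qed.

Lemma cspan_subspace G : is_subspace (cspan G).
Proof. exact/closure_subspace/lspan_subspace. Qed.

Lemma cspan_closed G : closed (cspan G).
Proof. exact: closed_closure. Qed.

Lemma cspan_gen G : G `<=` cspan G.
Proof. by move=> x Gx; apply: subset_closure => S _; apply. Qed.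

Lemma cspan_sub G S : closed S -> is_subspace S -> G `<=` S -> cspan G `<=` S.
Proof.
move=> cS sS GS x Gx; apply: cS; apply: (closure_subset _ Gx) => y.
by apply.
Qed.

Lemma closed_preimage_cont (f : A -> A) S : continuous f -> closed S ->
  closed (f @^-1` S).
Proof. by move=> cf cS; apply: preimage_closed => // x _; exact: cf. Qed.

Lemma cspan_map (f : A -> A) G S : continuous f -> {morph f : x y / x + y} ->
  (forall (c : C) x, f (c *: x) = c *: f x) ->
  closed S -> is_subspace S -> (forall x, G x -> S (f x)) ->
  forall x, cspan G x -> S (f x).
Proof.
move=> cf fD fZ cS [S0 SD SZ] GS x Gx.
apply: (@cspan_sub G (f @^-1` S)) Gx; [exact: closed_preimage_cont| |exact: GS].
split=> /= [|y z Sy Sz|c y Sy]; last by rewrite fZ; exact: SZ.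
  by rewrite -(scale0r 0) fZ scale0r.
by rewrite fD; exact: SD.
Qed.

Lemma cspanM G H S : closed S -> is_subspace S ->
  (forall x y, G x -> H y -> S (x ** y)) ->
  forall x y, cspan G x -> cspan H y -> S (x ** y).
Proof.
move=> cS sS GHS x y Gx Hy.
apply: (@cspan_map (fun z => z ** y) G) Gx => //.
- exact: cmulr_continuous.
- by move=> u v; rewrite cmulDl.
- by move=> c u; rewrite cmulZl.
move=> u Gu; apply: (@cspan_map (cmul u) H) Hy => //.
- exact: cmull_continuous.
- by move=> v w; rewrite cmulDr.
- by move=> c v; rewrite cmulZr.
- by move=> v Hv; exact: GHS.
Qed.

(** The *-operation is conjugate linear, hence not covered by [cspan_map]. *)
Lemma cspan_star G S : closed S -> is_subspace S ->
  (forall x, G x -> S (star x)) -> forall x, cspan G x -> S (star x).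
Proof.
move=> cS [S0 SD SZ] GS x Gx.
apply: (@cspan_sub G ((@star C A) @^-1` S)) Gx; [|split=> /=|exact: GS].
- exact: closed_preimage_cont star_continuous cS.
- by rewrite star0.
- by move=> y z Sy Sz; rewrite starD; exact: SD.
- by move=> c y Sy; rewrite starZ; exact: SZ.
Qed.

End CStarBasics.

(** * Roots of unity of arbitrarily large order *)

Section RootsOfUnity.
Variable C : numClosedFieldType.

(** An iterated square root [w] of -1: its order divides [2 ^ r.+1] but not [2 ^ r]. The discrete
    averages below ask only for large orders, so powers of 2 suffice. *)
Lemma prim_root_2exp r : exists w : C, (2 ^ r.+1).-primitive_root w.
Proof.
have [w wr] : exists w : C, w ^+ (2 ^ r) = -1.
  elim: r => [|r [w wr]]; first by exists (-1); rewrite expr1.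
  by exists (sqrtC w); rewrite expnS exprM sqrtCK.
exists w; have n0 : (0 < 2 ^ r.+1)%N by rewrite expn_gt0.
have w1 : w ^+ (2 ^ r.+1) = 1 by rewrite expnS mulnC exprM wr sqrrN expr1n.
have [m wm] := prim_order_exists n0 w1.
move=> /(dvdn_pfactor _ _ (isT : prime 2))[s sr mE].
have [sr1|] := leqP s r; last by move=> rs; rewrite -(eqP (_ : s == r.+1)) -?mE// eqn_leq sr.
have : w ^+ (2 ^ r) = 1.
  by apply/eqP; rewrite -(prim_order_dvd wm) mE dvdn_exp2l.
by rewrite wr => /eqP; rewrite -subr_eq0 -opprD oppr_eq0 -[1 + 1]/(2%:R) pnatr_eq0.
Qed.

Lemma prim_root_norm n (w : C) : n.-primitive_root w -> `|w| = 1.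
Proof.
move=> wn; have n0 := prim_order_gt0 wn.
by apply/eqP; rewrite -(pexpr_eq1 n0)// -normrX prim_expr_order// normr1.
Qed.

Lemma sum_prim_root n (w : C) k : n.-primitive_root w ->
  \sum_(j < n) w ^+ (j * k) = if (n %| k)%N then n%:R else 0.
Proof.
move=> wn; case: ifPn => nk.
  rewrite (eq_bigr (fun=> 1)) ?sumr_const ?card_ord// => j _.
  by apply/eqP; rewrite -(prim_order_dvd wn) dvdn_mull.
have w1 : w ^+ k - 1 != 0 by rewrite subr_eq0 -(prim_order_dvd wn).
apply: (mulfI w1); rewrite mulr0.
rewrite (eq_bigr (fun j : 'I_n => (w ^+ k) ^+ j)); last by move=> j _; rewrite -exprM mulnC.
by rewrite -subrX1 exprAC (prim_expr_order wn) expr1n subrr.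
Qed.

End RootsOfUnity.

(** * Extremality of a projection in the unit ball of its corner *)

Section ExtremeUnit.
Variables (R : realType) (A : cstarAlgType R[i]).
Local Notation C := (R[i]%type).
Implicit Types (x y : A).

Lemma norm_arch_eq0 x (M : C) : (forall n : nat, n%:R * `|x| <= M) -> x = 0.
Proof.
move=> xM; apply/eqP; rewrite -normr_eq0; apply/eqP.
have x0 := normr_ge0 x; have M0 : 0 <= M by have := xM 0%N; rewrite mul0r.
rewrite norm_cReE; congr (_%:C)%C; apply/eqP; rewrite eq_le cRe_norm_ge0 andbT.
rewrite leNgt; apply/negP => r0; set r := complex.Re _ in r0.
have MR : M = ((complex.Re M)%:C)%C by rewrite RRe_real// ger0_real.
have := xM (Num.trunc (complex.Re M / r)).+1.
rewrite norm_cReE MR -/r.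
have -> : (Num.trunc (complex.Re M / r)).+1%:R = ((Num.trunc (complex.Re M / r)).+1%:R%:C)%C :> R[i].
  by rewrite rmorph_nat.
rewrite -rmorphM lecR leNgt -ltr_pdivrMr// => /negP; apply.
exact: truncnS_gt.
Qed.

Variable e : A.
Hypothesis (ee : e ** e = e) (es : star e = e).

Let norm_segment y (t : C) : `|e + y| <= 1 -> `|e - y| <= 1 ->
  -1 <= t <= 1 -> `|e + t *: y| <= 1.
Proof.
move=> yp ym /andP[t1 t2].
have -> : e + t *: y = ((1 + t) / 2) *: (e + y) + ((1 - t) / 2) *: (e - y).
  rewrite !scalerDr !scalerN addrACA -scalerDl -scalerBl.
  by rewrite -[X in X + t *: y](scale1r e); congr (_ *: _ + _ *: _); field.
have p1 : 0 <= (1 + t) / 2 by rewrite divr_ge0// addrC -lerBlDr sub0r.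
have p2 : 0 <= (1 - t) / 2 by rewrite divr_ge0// subr_ge0.
apply: le_trans (ler_normD _ _) _; rewrite (normrZ _ (e + y)) (normrZ _ (e - y)) (ger0_norm p1) (ger0_norm p2).
apply: le_trans (lerD (ler_wpM2l p1 yp) (ler_wpM2l p2 ym)) _.
by have -> : (1 + t) / 2 * 1 + (1 - t) / 2 * 1 = 1 :> C by field.
Qed.

(** From real to complex multiples: [(e + x)^2 + (e - x)^2 = 2 (e + x^2)] bounds [e + x^2], which is
    [(e + ix)^* (e + ix)]. Then [e + (z/2) x] is the midpoint of [e + Re(z) x] and [e + Im(z) ix],
    whence the factor 1/2. *)
Let norm_disc x : star x = x -> e ** x = x -> `|e + x| <= 1 -> `|e - x| <= 1 ->
  forall z : C, `|z| <= 1 -> `|e + (z / 2) *: x| <= 1.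
Proof.
move=> xs ex xp xm z z1.
have xe : x ** e = x by apply: starI; rewrite starM es xs.
have sq : (e + x) ** (e + x) + (e - x) ** (e - x) = 2 *: (e + x ** x).
  rewrite !(cmulDl, cmulDr, cmulNl, cmulNr) ee ex xe. rewrite opprB addrACA.
  rewrite (addrACA e x) (addrC x (x ** x)) (addrACA (x ** x)) subrr !addr0.
  by rewrite addrACA scaler_nat mulr2n.
have xx : `|e + x ** x| <= 1.
  rewrite -(ler_pM2l (ltr0n C 2)) mulr1 -[X in X * _]normr_nat -normrZ -sq.
  rewrite (le_trans (ler_normD _ _))// (_ : 2 = 1 + 1)//.
  by rewrite lerD// (le_trans (cnormM _ _))// mulr_ile1.
have ii (t : C) : t ^+ 2 = -1 -> t^* = - t -> `|e + t *: x| <= 1.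
  move=> t2 tc; rewrite -(@ler_pXn2r _ 2) ?nnegrE// expr1n -cstar_norm.
  rewrite starD starZ es xs tc.
  rewrite !(cmulDl, cmulDr, cmulZl, cmulZr) ee ex xe scalerDr scalerA mulNr -expr2 t2 opprK.
  by rewrite scaleNr scale1r addrA addrK.
have ip : `|e + 'i *: x| <= 1 by apply: ii; rewrite ?sqrCi ?conjCi.
have im : `|e - 'i *: x| <= 1.
  have cN : (- 'i)^* = - 'i^* :> C by exact: rmorphN.
  by rewrite -scaleNr; apply: ii; rewrite ?cN ?conjCi// sqrrN sqrCi.
have bd (t : C) : t \is Num.real -> `|t| <= 1 -> -1 <= t <= 1.
  by move=> tr t1; rewrite -real_ler_norml.
have re := norm_segment xp xm (bd _ (Creal_Re z) (le_trans ((leif_normC_Re_Creal z)) z1)).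
have Im1 : `|'Im z| <= 1.
  by rewrite -normrN -ReMil (le_trans (leif_normC_Re_Creal _))// normrM normCi mul1r.
have iim := norm_segment ip im (bd _ (Creal_Im z) Im1).
have -> : e + (z / 2) *: x =
    2^-1 *: ((e + 'Re z *: x) + (e + 'Im z *: ('i *: x))).
  rewrite addrACA scalerDr -mulr2n -(scaler_nat 2 e) !scalerA mulVf ?pnatr_eq0// scale1r.
  by rewrite -scalerDl scalerA {1}(Crect z); congr (_ + _ *: _); ring.
rewrite normrZ normfV normr_nat ler_pdivrMl// mulr1 (_ : 2 = 1 + 1)//.
by rewrite (le_trans (ler_normD _ _))// lerD.
Qed.

Let pow x (z : C) n := iter n (fun y => (e + z *: x) ** y) e.

(** A polynomial in [z] with coefficients in [A]; its linear coefficient [n x] is the one to be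
    extracted. *)
Let pow_expand x : e ** x = x -> x ** e = x -> forall n, exists c : nat -> A,
  [/\ c 0%N = e, c 1%N = n%:R *: x, forall k, e ** c k = c k,
      forall k, (n < k)%N -> c k = 0 &
      forall z, pow x z n = \sum_(k < n.+1) z ^+ k *: c k].
Proof.
move=> ex xe.
elim=> [|n [c [c0 c1 ec cn cE]]].
  exists (fun k => if k is 0%N then e else 0); split=> //.
  - by rewrite scale0r.
  - by case=> [|k]; rewrite ?ee ?cmul0r.
  - by case.
  - by move=> z; rewrite big_ord_recl big_ord0 expr0 scale1r addr0.
exists (fun k => c k + if k is k'.+1 then x ** c k' else 0); split.
- by rewrite addr0.
- by rewrite c0 c1 xe -{2}(scale1r x) -scalerDl natr1.
- by case=> [|k]; rewrite cmulDr ?cmulA ?ex ec ?cmul0r.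
- by move=> [//|k] nk; rewrite !cn ?cmul0r ?addr0// ltnW.
move=> z; rewrite /pow iterS -/(pow x z n) cE cmulDl cmul_sumr cmulZl cmul_sumr.
rewrite scaler_sumr.
under [in RHS]eq_bigr do rewrite scalerDr.
rewrite big_split [X in _ = X + _]big_ord_recr [X in _ = _ + X]big_ord_recl /=.
rewrite (cn n.+1)// scaler0 addr0 scaler0 add0r; congr (_ + _).
  by apply: eq_bigr => k _; rewrite cmulZr ec.
by apply: eq_bigr => k _; rewrite cmulZr scalerA -exprS.
Qed.

(** The linear coefficient [(n/2) x] of the polynomial [(e + (z/2) x)^n] is an average, over roots
    of unity [z], of terms of norm at most 1. Hence [n |x| <= 2] for every [n]. *)
Lemma proj_extreme x : star x = x -> e ** x = x ->
  `|e + x| <= 1 -> `|e - x| <= 1 -> x = 0.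
Proof.
move=> xs ex xp xm; apply: (@norm_arch_eq0 x 2) => n.
have [w wp] := prim_root_2exp C n.
have w1 := prim_root_norm wp.
(* With [m > n + 1], the only degree [k <= n] for which [m] divides [m - 1 + k] is [k = 1]; the
   weights [w ^- j] thus isolate the linear coefficient. *)
have {wp} [m nm wp] : exists2 m, (n.+1 < m)%N & m.-primitive_root w.
  by exists (2 ^ n.+1)%N; first exact: ltn_expl.
have xe : x ** e = x by apply: starI; rewrite starM es xs.
have [c [c0 c1 ec cn cE]] := pow_expand ex xe n.
have sumE : \sum_(j < m) w ^- j *: pow x (w ^+ j / 2) n = (m%:R * n%:R / 2) *: x.
  have mE : m.-1.+1 = m by rewrite prednK// (leq_ltn_trans _ nm).
  have ml : (m.-1 < m)%N by rewrite -[X in (_ < X)%N]mE.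
  have wV (j : nat) : w ^- j = w ^+ (j * m.-1).
    have wj : w ^+ j != 0 by rewrite -normr_eq0 normrX w1 expr1n oner_eq0.
    apply: (mulfI wj); rewrite divff// -exprD -mulnS mE.
    by rewrite mulnC exprM (prim_expr_order wp) expr1n.
  under eq_bigr do rewrite cE scaler_sumr.
  rewrite exchange_big /=.
  have coef (k : 'I_n.+1) : \sum_(j < m) w ^- j *: ((w ^+ j / 2) ^+ k *: c k) =
      if k == 1%N :> nat then (m%:R / 2) *: c k else 0.
    transitivity ((\sum_(j < m) w ^+ (j * (m.-1 + k))) *: (2 ^- k *: c k)).
      rewrite scaler_suml; apply: eq_bigr => j _; rewrite !scalerA; congr (_ *: _).
      by rewrite expr_div_n mulrA wV -exprM -exprD mulnDr.
    rewrite (sum_prim_root _ wp).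
    have -> : (m %| m.-1 + k)%N = (k == 1%N :> nat).
      have km : (k < m.-1)%N by rewrite -ltnS mE (leq_ltn_trans _ nm).
      case: (k : nat) km => [|[|k']] km /=.
      - by rewrite addn0 (gtnNdvd _ ml) // -ltnS mE (leq_trans _ nm).
      - by rewrite addn1 mE dvdnn.
      - rewrite addnS -addSn mE dvdn_addr// gtnNdvd// (ltn_trans (ltnSn _))//.
        exact: ltn_trans km ml.
    by case: eqP => [->|_]; rewrite ?scale0r// scalerA expr1.
  rewrite (eq_bigr _ (fun k _ => coef k)) -big_mkcond /=.
  case: n {coef cE nm} c1 cn => [|n] c1 cn.
    rewrite big_pred0 ?mulr0 ?mul0r ?scale0r// => k.
    by case: k => -[].
  rewrite (big_pred1 (lift ord0 ord0)) => [|k]; last by rewrite /= -val_eqE.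
  by rewrite /= c1 scalerA mulrAC.
have pow1 (z : C) : `|z| <= 1 -> `|pow x (z / 2) n| <= 1.
  move=> z1; rewrite /pow; elim: {sumE c cE c0 c1 ec cn nm m wp} n => [|k IH].
    by apply: proj_norm_le1; split.
  rewrite iterS (le_trans (cnormM _ _))// mulr_ile1//; exact: norm_disc.
have m0 : (0 : C) < m%:R by rewrite ltr0n (leq_trans _ nm).
have : `|(m%:R * n%:R / 2 : C) *: x| <= m%:R.
  rewrite -sumE (le_trans (ler_norm_sum _ _ _))// -[X in _ <= X%:R]card_ord -sumr_const.
  apply: ler_sum => j _; rewrite normrZ normfV normrX w1 expr1n invr1 mul1r.
  by apply: pow1; rewrite normrX w1 expr1n.
rewrite normrZ ger0_norm ?mulr_ge0 ?invr_ge0 ?ler0n//.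
move=> h; rewrite -(ler_pM2l m0) [leRHS]mulrC.
have -> : m%:R * (n%:R * `|x|) = 2 * (m%:R * n%:R / 2 * `|x|) by field.
by rewrite ler_pM2l.
Qed.
End ExtremeUnit.

(** * Projections whose sum is a projection *)

Section OrthogonalProjections.
Variables (R : realType) (A : cstarAlgType R[i]).
Local Notation C := (R[i]%type).
Implicit Types p q : A.

(** [e - e p e] is [e (q - p) e], and [q - p] is a projection. *)
Lemma compression_norm_le q e p : is_projection q -> is_projection e ->
  is_projection p -> q ** e = e -> q ** p = p -> `|e - e ** p ** e| <= 1.
Proof.
move=> [qq qs] [ee es] [pp ps] qe qp.
have pq : p ** q = p by apply: starI; rewrite starM qs ps.
have pr : is_projection (q - p).
  by split; rewrite ?starB ?qs ?ps// cmulBl !cmulBr qq qp pq pp subrr subr0.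
have -> : e - e ** p ** e = e ** ((q - p) ** e).
  by rewrite cmulBl cmulBr qe ee cmulA.
rewrite (le_trans (cnormM _ _))// mulr_ile1//; first by apply: proj_norm_le1.
by rewrite (le_trans (cnormM _ _))// mulr_ile1// proj_norm_le1.
Qed.

(** For [i <> j] put [x = p_i p_j p_i]: for some [c > 0] both [p_i + c x] and
    [p_i - c x] have norm at most 1, which forces [x = 0]. *)
Lemma sum_proj_orth (I : finType) (P : pred I) (p : I -> A) q :
  (forall i, P i -> is_projection (p i)) -> (forall i, P i -> q ** p i = p i) ->
  q = \sum_(i | P i) p i ->
  forall i j, P i -> P j -> i != j -> p i ** p j = 0.
Proof.
move=> pP qp qE i j Pi Pj ij.
have qproj : is_projection q.
  split; first by rewrite {2}qE cmul_sumr (eq_bigr p)// => k /qp.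
  by rewrite qE star_sum; apply: eq_bigr => k /pP[].
have [ppi psi] := pP _ Pi.
pose x k := p i ** p k ** p i.
have xs k : P k -> star (x k) = x k.
  by move=> /pP[_ pks]; rewrite /x !starM psi pks cmulA.
have ix k : p i ** x k = x k by rewrite /x !cmulA ppi.
have x0 : \sum_(k | P k && (k != i)) x k = 0.
  apply: (addrI (x i)); rewrite -(bigD1 i)//= /x -cmul_suml -cmul_sumr -qE.
  by rewrite addr0 -cmulA qp// !ppi.
have xi : \sum_(k | P k && (k != i) && (k != j)) x k = - x j.
  apply: (addrI (x j)); by rewrite subrr -[RHS]x0 [in RHS](bigD1 j)/= ?Pj 1?eq_sym.
have le1 k : P k -> `|p i - x k| <= 1.
  by move=> Pk; apply: (@compression_norm_le q); rewrite ?qp//; exact: pP.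
(* As [x j] is minus the sum of the other [x k], the element [n p_i + x j] is a sum of [n] terms of
   norm at most 1: one [p i - x k] for each [k] in [Q], and one further [p i]. The constant [c] is
   [1/n]. *)
have [n ngt0 nle] : exists2 n : nat, (0 < n)%N & `|n%:R *: p i + x j| <= n%:R.
  pose Q := [pred k | P k && (k != i) && (k != j)].
  exists (#|Q|.+1); first by [].
  rewrite -[x j]opprK -xi -natr1 scalerDl scale1r -addrAC.
  have -> : #|Q|%:R *: p i - \sum_(k | Q k) x k = \sum_(k | Q k) (p i - x k).
    by rewrite sumrB sumr_const scaler_nat.
  apply: (le_trans (ler_normD _ _)); apply: lerD; last exact: proj_norm_le1.
  rewrite (le_trans (ler_norm_sum _ _ _))// -sumr_const ler_sum// => k.
  by move=> /andP[/andP[Pk _] _]; exact: le1.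
have n0 : 0 < n%:R^-1 :> C by rewrite invr_gt0 ltr0n.
have n1 : n%:R^-1 <= 1 :> C by rewrite invf_le1 ?ltr0n// ler1n.
have xj0 : n%:R^-1 *: x j = 0.
  apply: (@proj_extreme _ _ (p i)) => //.
  - by rewrite starZ xs// conj_Creal// gtr0_real.
  - by rewrite cmulZr ix.
  - have -> : p i + n%:R^-1 *: x j = n%:R^-1 *: (n%:R *: p i + x j).
      by rewrite scalerDr scalerA mulVf ?scale1r// pnatr_eq0 -lt0n.
    by rewrite normrZ gtr0_norm// ler_pdivrMl ?ltr0n// mulr1.
  (* The opposite sign is a convex combination of [p i - x j] and [p i]. *)
  - have -> : p i - n%:R^-1 *: x j = n%:R^-1 *: (p i - x j) + (1 - n%:R^-1) *: p i.
      by rewrite scalerBr scalerBl scale1r [RHS]addrC subrKA.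
    apply: (le_trans (ler_normD _ _)); rewrite (normrZ _ (p i - x j)) (normrZ _ (p i)).
    have m0 : 0 <= 1 - n%:R^-1 :> C by rewrite subr_ge0.
    rewrite (gtr0_norm n0) (ger0_norm m0) -[leRHS](subrKC n%:R^-1).
    apply: lerD; rewrite -[leRHS]mulr1; apply: ler_wpM2l => //.
    - exact: ltW.
    - exact: le1.
    - exact: proj_norm_le1.
have {}xj0 : x j = 0.
  by move/eqP: xj0; rewrite scaler_eq0 gt_eqF//= => /eqP.
(* [x j] is [b^* b] for [b = p j ** p i], so its vanishing kills [p i ** p j]. *)
apply: starI; rewrite star0; have [ppj psj] := pP _ Pj.
apply: cmul_star_eq0.
by rewrite starK starM psi psj -cmulA (cmulA (p j)) ppj cmulA.
Qed.
End OrthogonalProjections.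

(** * Factorisations in k-graphs *)

Section Factorisations.
Variables (k : nat) (L : kgraph k).
Implicit Types (n m : {ffun 'I_k -> nat}) (v w : kobj L) (la mu nu : L).

Definition nmin n m : {ffun 'I_k -> nat} := [ffun i => minn (n i) (m i)].
Definition nsub n m : {ffun 'I_k -> nat} := [ffun i => (n i - m i)%N].

Lemma degP n m : (forall i, n i = m i :> nat) -> n = m.
Proof. by move=> nm; apply/ffunP. Qed.

Lemma nminE n m i : nmin n m i = minn (n i) (m i). Proof. exact: ffunE. Qed.
Lemma nsubE n m i : nsub n m i = (n i - m i)%N. Proof. exact: ffunE. Qed.
Lemma naddE n m i : (n + m) i = (n i + m i)%N. Proof. exact: ffunE. Qed.
Lemma nzeroE i : (0 : {ffun 'I_k -> nat}) i = 0%N. Proof. exact: ffunE. Qed.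
Lemma kgenE (i j : 'I_k) : kgen i j = (j == i) :> nat. Proof. exact: ffunE. Qed.

Lemma naddI n m m' : n + m = n + m' -> m = m'.
Proof.
by move=> /ffunP nm; apply/degP => i; have := nm i; rewrite !naddE => /addnI.
Qed.

Lemma kdegE mu nu i : ksrc mu = krng nu ->
  kdeg (kcomp mu nu) i = (kdeg mu i + kdeg nu i)%N.
Proof. by move=> /kdeg_comp ->; exact: naddE. Qed.

Lemma kcomp_inj mu nu mu' nu' : ksrc mu = krng nu -> ksrc mu' = krng nu' ->
  kdeg mu = kdeg mu' -> kcomp mu nu = kcomp mu' nu' -> mu = mu' /\ nu = nu'.
Proof.
move=> c c' d e.
have [p [_ up]] := kfactor (kdeg_comp c).
have dn : kdeg nu = kdeg nu'.
  by apply: (@naddI (kdeg mu)); rewrite -(kdeg_comp c) e (kdeg_comp c') d.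
have p1 : p = (mu, nu) by exact: up.
by have := up (mu', nu'); rewrite p1 /= -d -dn => /(_ (And4 c' erefl erefl e)) [].
Qed.

Fact kcut_subproof n la : exists p : L * L,
  [/\ ksrc p.1 = krng p.2, kdeg p.1 = nmin n (kdeg la) & la = kcomp p.1 p.2].
Proof.
have d : kdeg la = nmin n (kdeg la) + nsub (kdeg la) (nmin n (kdeg la)).
  by apply/degP => i; rewrite naddE nsubE nminE subnKC// geq_minr.
by have [p [[p1 p2 p3 p4] _]] := kfactor d; exists p.
Qed.

Definition kcut n la : L * L := projT1 (cid (kcut_subproof n la)).

(** The initial segment of degree [n /\ d(la)], and the remaining path. *)
Definition ktake n la : L := (kcut n la).1.
Definition kdrop n la : L := (kcut n la).2.

Lemma ktakeP n la : [/\ ksrc (ktake n la) = krng (kdrop n la),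
  kdeg (ktake n la) = nmin n (kdeg la) & la = kcomp (ktake n la) (kdrop n la)].
Proof. exact: (projT2 (cid (kcut_subproof n la))). Qed.

Lemma ktake_uniq n la mu nu : ksrc mu = krng nu -> la = kcomp mu nu ->
  kdeg mu = nmin n (kdeg la) -> ktake n la = mu /\ kdrop n la = nu.
Proof.
move=> c lE d; have [ct dt tE] := ktakeP n la.
by apply: kcomp_inj => //; rewrite ?dt// -tE.
Qed.

Lemma ktakeE nu n la mu : ksrc mu = krng nu -> la = kcomp mu nu ->
  kdeg mu = nmin n (kdeg la) -> ktake n la = mu.
Proof. by move=> c lE d; have [] := ktake_uniq c lE d. Qed.

Lemma kdropE mu n la nu : ksrc mu = krng nu -> la = kcomp mu nu ->
  kdeg mu = nmin n (kdeg la) -> kdrop n la = nu.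
Proof. by move=> c lE d; have [] := ktake_uniq c lE d. Qed.

Lemma kdeg_take n la : kdeg (ktake n la) = nmin n (kdeg la).
Proof. by have [] := ktakeP n la. Qed.
Lemma ksrc_take n la : ksrc (ktake n la) = krng (kdrop n la).
Proof. by have [] := ktakeP n la. Qed.
Lemma ktakeK n la : kcomp (ktake n la) (kdrop n la) = la.
Proof. by have [] := ktakeP n la. Qed.
Lemma krng_take n la : krng (ktake n la) = krng la.
Proof. by rewrite -[in RHS](ktakeK n la) krng_comp// ksrc_take. Qed.
Lemma ksrc_drop n la : ksrc (kdrop n la) = ksrc la.
Proof. by rewrite -[in RHS](ktakeK n la) ksrc_comp// ksrc_take. Qed.

Lemma kdeg0 la : kdeg la = 0 -> la = kid (krng la).
Proof.
by move=> d0; have /kpaths0P[v ->] : kpaths L 0 la by []; rewrite krng_id.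
Qed.

Lemma ktake_full n la : (forall i, kdeg la i <= n i)%N -> ktake n la = la.
Proof.
move=> dn; apply: (@ktakeE (kid (ksrc la))).
- by rewrite krng_id.
- by rewrite kcomp_idr.
- by apply/degP => i; rewrite nminE; have := dn i; lia.
Qed.

Lemma ktake_comp n mu nu : ksrc mu = krng nu ->
  (forall i, minn (n i) (kdeg mu i + kdeg nu i) = minn (n i) (kdeg mu i)) ->
  ktake n (kcomp mu nu) = ktake n mu.
Proof.
move=> c d; apply: (@ktakeE (kcomp (kdrop n mu) nu)).
- by rewrite krng_comp ?ksrc_drop// ksrc_take.
- by rewrite kcompA ?ksrc_drop ?ksrc_take// ktakeK.
- by rewrite kdeg_take; apply/degP => i; rewrite !nminE kdegE.
Qed.

Lemma ktake_take m n la : (forall i, m i <= n i)%N ->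
  ktake m (ktake n la) = ktake m la.
Proof.
move=> mn; rewrite -[in RHS](ktakeK n la) ktake_comp ?ksrc_take// => i.
rewrite -kdegE ?ksrc_take// ktakeK kdeg_take nminE.
by have := mn i; lia.
Qed.

Definition has_edge v (i : 'I_k) : Prop := krange v (kpaths L (kgen i)) !=set0.

Lemma kleP n la : kpaths_le n la <-> (forall i, kdeg la i <= n i)%N /\
  forall i, (kdeg la i < n i)%N -> ~ has_edge (ksrc la) i.
Proof.
split=> -[le no]; split=> // i /no.
  by move=> E [x]; rewrite E.
by move=> E; apply: contrapT => /eqP/set0P.
Qed.

Lemma kdeg_has_edge la i : (0 < kdeg la i)%N -> has_edge (krng la) i.
Proof.
move=> d0; exists (ktake (kgen i) la); split; last by rewrite krng_take.
rewrite /kpaths /= kdeg_take; apply/degP => j; rewrite nminE kgenE.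
by have [->|_] := eqVneq j i; lia.
Qed.

Hypothesis lconv : kgraph_locally_convex L.

(** Induction on the total degree: peel off a first edge of degree [e_j]. Here [j] differs from [i]
    because [la] has degree 0 in direction [i], so local convexity moves the edge of degree [e_i]
    across. *)
Lemma has_edge_src la i : kdeg la i = 0%N -> has_edge (krng la) i ->
  has_edge (ksrc la) i.
Proof.
move: {2}(\sum_j kdeg la j)%N (leqnn (\sum_j kdeg la j)%N) => N.
elim: N la => [|N IH] la lN d0 e.
  suff d : kdeg la = 0 by move: e; rewrite (kdeg0 d) krng_id ksrc_id.
  by apply/degP => j; move: lN; rewrite nzeroE (bigD1 j)//=; lia.
have [d|] := eqVneq (kdeg la) 0.
  by move: e; rewrite (kdeg0 d) krng_id ksrc_id.
move=> /eqP d; have [j dj] : exists j, (0 < kdeg la j)%N.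
  apply: contrapT => h; apply: d; apply/degP => j; rewrite nzeroE.
  by apply/eqP; rewrite -leqn0 leqNgt; apply/negP => dj; apply: h; exists j.
have ij : i != j by apply: contraTneq dj => <-; rewrite d0.
have df : kdeg (ktake (kgen j) la) = kgen j.
  rewrite kdeg_take; apply/degP => l; rewrite nminE kgenE.
  by have [->|_] := eqVneq l j; lia.
have dE l : kdeg la l = ((l == j) + kdeg (kdrop (kgen j) la) l)%N.
  by rewrite -[in LHS](ktakeK (kgen j) la) kdegE ?ksrc_take// df kgenE.
rewrite -(ksrc_drop (kgen j)); apply: IH.
- move: lN; rewrite (eq_bigr _ (fun l _ => dE l)) big_split /= (bigD1 j)//= eqxx.
  by rewrite -addnA add1n ltnS => /(leq_trans (leq_addl _ _)).
- by have := dE i; rewrite d0; lia.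
- rewrite -ksrc_take; apply: (lconv (i := j)); rewrite 1?eq_sym//.
  by rewrite krng_take.
Qed.

(** The second clause of [kpaths_le n] alone: [la] need not have degree
    at most [n]. *)
Definition kmaximal n la : Prop :=
  forall i, (kdeg la i < n i)%N -> ~ has_edge (ksrc la) i.

Lemma kle_max n la : kpaths_le n la -> kmaximal n la.
Proof. by move=> /kleP[]. Qed.

Lemma kmaximal_comp n mu nu : ksrc mu = krng nu -> kmaximal n nu ->
  kmaximal n (kcomp mu nu).
Proof.
by move=> c no i; rewrite ksrc_comp// kdegE// => lt; apply: no; lia.
Qed.

(** If the truncation stops short of [n] in direction [i], the remainder has degree 0 there, so by
    local convexity an edge of degree [e_i] at the cut would propagate to the source of [la]. *)
Lemma kle_take n m la : kmaximal m la -> (forall i, n i <= m i)%N ->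
  kpaths_le n (ktake n la).
Proof.
move=> no nm; apply/kleP; split=> i; rewrite kdeg_take nminE; first exact: geq_minl.
move=> lt E; have li : (kdeg la i < m i)%N by have := nm i; lia.
apply: (no i li); rewrite -(ksrc_drop n); apply: has_edge_src; last by rewrite -ksrc_take.
have := kdegE i (ksrc_take n la); rewrite ktakeK kdeg_take nminE.
by lia.
Qed.

Lemma kle_comp n la ga : ksrc la = krng ga -> (forall i, kdeg la i <= n i)%N ->
  kpaths_le (nsub n (kdeg la)) ga -> kpaths_le n (kcomp la ga).
Proof.
move=> c dn /kleP[d no]; apply/kleP; split=> i; rewrite ?ksrc_comp// kdegE//.
  by have := d i; rewrite nsubE; have := dn i; lia.
by move=> lt; apply: no; rewrite nsubE; lia.
Qed.

(** A path of degree at most [n] outside [Lambda^{<= n}] can be prolonged by an edge without leaving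
    the bound [n], and total degrees below [n] are bounded. *)
Lemma kle_nonempty v n : exists2 la, kpaths_le n la & krng la = v.
Proof.
apply: contrapT => none.
suff H N : exists2 la, krng la = v &
    (forall i, kdeg la i <= n i)%N /\ (N <= \sum_i kdeg la i)%N.
  have [la _ [dn]] := H (\sum_i n i).+1.
  by rewrite ltnNge leq_sum.
elim: N => [|N [la rla [dn lN]]].
  by exists (kid v); rewrite ?krng_id// kdeg_id; split=> // i; rewrite nzeroE.
have [i [lt [f [df rf]]]] : exists i, (kdeg la i < n i)%N /\ has_edge (ksrc la) i.
  apply: contrapT => no; apply: none; exists la => //; apply/kleP; split=> // i lt E.
  by apply: no; exists i.
have c : ksrc la = krng f by [].
exists (kcomp la f); first by rewrite krng_comp.
rewrite /kpaths /= in df; split=> [j|].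
  rewrite kdegE// df kgenE; have := dn j.
  by have [->|_] := eqVneq j i; lia.
rewrite (eq_bigr (fun j => (kdeg la j + (j == i))%N)); last first.
  by move=> j _; rewrite kdegE// df kgenE.
rewrite big_split /= [X in (_ + X)%N](bigD1 i)//= eqxx.
by rewrite addnCA add1n ltnS (leq_trans lN)// leq_addr.
Qed.

Lemma kle_extend la n : (forall i, kdeg la i <= n i)%N ->
  exists2 ga, ksrc la = krng ga & kpaths_le n (kcomp la ga).
Proof.
move=> dn; have [ga gle rga] := kle_nonempty (ksrc la) (nsub n (kdeg la)).
by exists ga => //; apply: kle_comp.
Qed.

End Factorisations.

(** * Boundary paths *)

Section BoundaryPaths.
Variables (k : nat) (L : kgraph k).
Hypothesis lconv : kgraph_locally_convex L.
Implicit Types (n m : {ffun 'I_k -> nat}) (v w : kobj L) (la mu nu : L).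

(** Encoded by initial segments, which stabilise along the directions in which
    the path is finite. *)
Record bpath := BPath {
  bseg :> {ffun 'I_k -> nat} -> L;
  bseg_le : forall n, kpaths_le n (bseg n);
  bseg_take : forall m n, (forall i, m i <= n i)%N -> bseg m = ktake m (bseg n) }.
Implicit Types x y : bpath.

HB.instance Definition _ := gen_eqMixin bpath.
HB.instance Definition _ := gen_choiceMixin bpath.

Lemma bpathP x y : (forall n, x n = y n) -> x = y.
Proof.
case: x y => [x x1 x2] [y y1 y2] /= xy; have {}xy : x = y by apply/funext.
by subst y; congr BPath; exact: Prop_irrelevance.
Qed.

Definition brng x : kobj L := krng (x 0).

Lemma krng_bseg x n : krng (x n) = brng x.
Proof. by rewrite /brng (@bseg_take x 0 n) ?krng_take// => i; rewrite nzeroE. Qed.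

Lemma ktake_seg m n la x : ksrc la = krng (x n) -> (forall i, m i <= n i)%N ->
  ktake m (kcomp la (x n)) = ktake m (kcomp la (x m)).
Proof.
move=> c mn; rewrite (bseg_take x mn).
have cm : ksrc la = krng (ktake m (x n)) by rewrite krng_take.
have ct := ksrc_take m (x n).
rewrite -{1}(ktakeK m (x n)) kcompA// ktake_comp ?ksrc_comp// => i.
rewrite !kdegE// kdeg_take nminE.
have := kdegE i ct; rewrite ktakeK kdeg_take nminE.
by have := mn i; lia.
Qed.

Fact bcons_le la x : ksrc la = brng x ->
  forall n, kpaths_le n (ktake n (kcomp la (x n))).
Proof.
move=> c n; apply: (kle_take lconv (m := n)) => //.
by apply: kmaximal_comp; [rewrite krng_bseg|exact/kle_max/bseg_le].
Qed.

Fact bcons_take la x : ksrc la = brng x -> forall m n, (forall i, m i <= n i)%N ->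
  ktake m (kcomp la (x m)) = ktake m (ktake n (kcomp la (x n))).
Proof. by move=> c m n mn; rewrite ktake_take// ktake_seg// krng_bseg. Qed.

(** Junk value [x] unless [s(la) = r(x)]. *)
Definition bcons la x : bpath :=
  match pselect (ksrc la = brng x) with
  | left c => BPath (bcons_le c) (bcons_take c)
  | right _ => x
  end.

Lemma bconsE la x n : ksrc la = brng x -> bcons la x n = ktake n (kcomp la (x n)).
Proof. by move=> c; rewrite /bcons; case: pselect. Qed.

Lemma brng_cons la x : ksrc la = brng x -> brng (bcons la x) = krng la.
Proof. by move=> c; rewrite /brng bconsE// krng_take krng_comp. Qed.

(** In a direction where [x n] stops short of [n], its source has no edge, so the remainder has
    degree 0; in the other directions [x n] has degree exactly [n i]. *)
Fact bshift_subproof n m x : (forall i, kdeg (x (n + m)%R) i - kdeg (x n) i <= m i)%N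
  /\ kmaximal m (kdrop n (x (n + m))).
Proof.
have le : (forall i, n i <= (n + m)%R i)%N by move=> i; rewrite naddE leq_addr.
have xn : x n = ktake n (x (n + m)) by exact: bseg_take.
have c := ksrc_take n (x (n + m)).
have /kleP[d no] := bseg_le x (n + m); have /kleP[dn non] := bseg_le x n.
have dE i := kdegE i c; rewrite ktakeK in dE.
have deg i : kdeg (kdrop n (x (n + m))) i = (kdeg (x (n + m)%R) i - kdeg (x n) i)%N.
  by have := dE i; rewrite xn; lia.
have stop i : (kdeg (x n) i < n i)%N -> kdeg (kdrop n (x (n + m))) i = 0%N.
  move=> lt; have := non i lt; rewrite xn c => nE; apply/eqP; rewrite -leqn0 leqNgt.
  by apply/negP => /kdeg_has_edge.
split=> i; first rewrite -deg.
  have [/stop -> //|ge] := ltnP (kdeg (x n) i) (n i).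
  by rewrite deg; have := d i; rewrite naddE; lia.
rewrite ksrc_drop => lt; apply: no; rewrite naddE.
by move: lt; rewrite deg; have := dn i; lia.
Qed.

Fact bshift_le n x m : kpaths_le m (kdrop n (x (n + m))).
Proof.
have [d no] := bshift_subproof n m x; apply/kleP; split=> // i.
have c := ksrc_take n (x (n + m)).
have le : (forall i, n i <= (n + m)%R i)%N by move=> j; rewrite naddE leq_addr.
have dE := kdegE i c; rewrite ktakeK -bseg_take// in dE.
by have := d i; rewrite dE addKn.
Qed.

Fact bshift_take n x m m' : (forall i, m i <= m' i)%N ->
  kdrop n (x (n + m)) = ktake m (kdrop n (x (n + m'))).
Proof.
move=> mm.
have le : (forall i, (n + m)%R i <= (n + m')%R i)%N.
  by move=> i; rewrite !naddE leq_add2l.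
set z := kdrop (n + m) (x (n + m')).
have cz : ksrc (x (n + m)) = krng z by rewrite (bseg_take x le) ksrc_take.
have zE : x (n + m') = kcomp (x (n + m)) z by rewrite {1}(bseg_take x le) ktakeK.
have ct := ksrc_take n (x (n + m)).
have cd : ksrc (kdrop n (x (n + m))) = krng z by rewrite ksrc_drop.
have le0 m0 : (forall i, n i <= (n + m0)%R i)%N by move=> j; rewrite naddE leq_addr.
have tn : ktake n (x (n + m)) = ktake n (x (n + m')).
  by rewrite -!bseg_take.
have dropE : kdrop n (x (n + m')) = kcomp (kdrop n (x (n + m))) z.
  apply: (@kdropE _ _ (ktake n (x (n + m)))).
  - by rewrite krng_comp.
  - by rewrite kcompA// ktakeK.
  - by rewrite tn kdeg_take.
rewrite dropE ktake_comp//; last first.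
  move=> i; have /kleP[d no] := bshift_le n x m.
  have [lt|] := ltnP (kdeg (kdrop n (x (n + m)%R)) i) (m i); last by have := d i; lia.
  suff -> : kdeg z i = 0%N by lia.
  apply/eqP; rewrite -leqn0 leqNgt; apply/negP => /kdeg_has_edge.
  by rewrite -cd; exact: no.
by rewrite ktake_full//; have /kleP[] := bshift_le n x m.
Qed.

Definition bshift n x : bpath := BPath (bshift_le n x) (@bshift_take n x).

Lemma bshiftE n x m : bshift n x m = kdrop n (x (n + m)). Proof. by []. Qed.

Lemma ksrc_bseg n x : ksrc (x n) = brng (bshift n x).
Proof. by rewrite /brng bshiftE addr0 -ksrc_take -bseg_take. Qed.

Lemma bshiftK n x : bcons (x n) (bshift n x) = x.
Proof.
have le m : (forall i, n i <= (n + m)%R i)%N by move=> i; rewrite naddE leq_addr.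
have le' m : (forall i, m i <= (n + m)%R i)%N by move=> i; rewrite naddE leq_addl.
apply: bpathP => m; rewrite bconsE -?ksrc_bseg//.
by rewrite bshiftE {1}(bseg_take x (le m)) ktakeK -bseg_take.
Qed.

(** Where [la] is shorter than [n], its source has no edge in that direction, so [x] contributes
    nothing there before the cut. *)
Lemma bcons_seg n la x : kpaths_le n la -> ksrc la = brng x -> bcons la x n = la.
Proof.
move=> /kleP[d no] c; have c' : ksrc la = krng (x n) by rewrite krng_bseg.
rewrite bconsE//; apply: (ktakeE c') => //.
apply/degP => i; rewrite nminE kdegE//.
have [lt|] := ltnP (kdeg la i) (n i); last by have := d i; lia.
suff -> : kdeg (x n) i = 0%N by lia.
apply/eqP; rewrite -leqn0 leqNgt; apply/negP => /kdeg_has_edge.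
by rewrite -c'; exact: no.
Qed.

Lemma kle_deg la : kpaths_le (kdeg la) la.
Proof. by apply/kleP; split=> // i; rewrite ltnn. Qed.

Lemma bconsK la x : ksrc la = brng x -> bshift (kdeg la) (bcons la x) = x.
Proof.
move=> c; apply: bpathP => m; rewrite bshiftE bconsE//.
set xx := x _; have cx : ksrc la = krng xx by rewrite krng_bseg.
have le : (forall i, m i <= (kdeg la + m)%R i)%N by move=> i; rewrite naddE leq_addl.
have -> : x m = ktake m xx by exact: bseg_take.
have ct := ksrc_take m xx.
have -> : ktake (kdeg la + m) (kcomp la xx) = kcomp la (ktake m xx).
  apply: (@ktakeE _ _ (kdrop m xx)).
  - by rewrite ksrc_comp// krng_take.
  - by rewrite -kcompA ?krng_take// ktakeK.
  apply/degP => i; rewrite nminE !kdegE ?krng_take// kdeg_take nminE naddE.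
  by lia.
apply: (@kdropE _ _ la); rewrite ?krng_take//.
by apply/degP => i; rewrite nminE kdegE ?krng_take//; lia.
Qed.

Lemma bcons_comp mu nu x : ksrc mu = krng nu -> ksrc nu = brng x ->
  bcons (kcomp mu nu) x = bcons mu (bcons nu x).
Proof.
move=> c c'; apply: bpathP => n; rewrite !bconsE ?brng_cons ?ksrc_comp//.
have cx : ksrc nu = krng (x n) by rewrite krng_bseg.
rewrite -kcompA//; set y := kcomp nu (x n).
have cy : ksrc mu = krng y by rewrite /y krng_comp.
have ct := ksrc_take n y.
rewrite -{1}(ktakeK n y) kcompA ?krng_take// ktake_comp//.
  by rewrite ksrc_comp// krng_take.
move=> i; rewrite !kdegE ?krng_take// kdeg_take nminE.
by have := kdegE i ct; rewrite ktakeK kdeg_take nminE; lia.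
Qed.

Lemma bcons_id x : bcons (kid (brng x)) x = x.
Proof.
apply: bpathP => n; rewrite bconsE ?ksrc_id// -{1}(krng_bseg x n) kcomp_idl.
by rewrite ktake_full//; have /kleP[] := bseg_le x n.
Qed.

Definition nconst (N : nat) : {ffun 'I_k -> nat} := [ffun=> N].

(** Appending again and again a path of [Lambda^{<= (1,...,1)}] yields prolongations [f N] in
    [Lambda^{<= (N,...,N)}]; the segment at [n] is cut out of any [f N] with [N] above all
    coordinates of [n]. *)
Lemma bpath_exists v : exists x, brng x = v.
Proof.
have ext (la : L) : exists ga, ksrc la = krng ga /\ kpaths_le (nconst 1) ga.
  by have [ga] := kle_nonempty (ksrc la) (nconst 1); exists ga.
pose nxt la := projT1 (cid (ext la)).
have nxtP la : ksrc la = krng (nxt la) /\ kpaths_le (nconst 1) (nxt la).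
  exact: (projT2 (cid (ext la))).
pose f N : L := iter N (fun la => kcomp la (nxt la)) (kid v).
have fS N : f N.+1 = kcomp (f N) (nxt (f N)) by [].
have fr N : krng (f N) = v.
  by elim: N => [|N IH]; rewrite ?fS ?krng_comp ?krng_id//; have [] := nxtP (f N).
have nE N i : nconst N i = N by rewrite ffunE.
have fle N : kpaths_le (nconst N) (f N).
  elim: N => [|N IH].
    by apply/kleP; rewrite kdeg_id; split=> i; rewrite nzeroE ?nE.
  have [c /kleP[d1 no1]] := nxtP (f N); have /kleP[d no] := IH.
  have dS i := kdegE i c.
  apply/kleP; rewrite fS; split=> i; rewrite dS nE.
    by have := d i; have := d1 i; rewrite !nE; lia.
  rewrite ksrc_comp// => lt.
  have [d10|d10] := posnP (kdeg (nxt (f N)) i); first by apply: no1; rewrite d10 nE.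
  have := no i; rewrite nE => no'; case: no'; last by rewrite c; exact: kdeg_has_edge.
  by move: lt; have := d1 i; rewrite nE; lia.
have fpre N M : (N <= M)%N -> exists2 z, ksrc (f N) = krng z & f M = kcomp (f N) z.
  move=> /subnKC <-; elim: (M - N)%N => [|j [z c E]].
    by exists (kid (ksrc (f N))); rewrite ?krng_id// addn0 kcomp_idr.
  have [c' _] := nxtP (f (N + j)%N).
  have cz : ksrc z = krng (nxt (f (N + j)%N)) by rewrite -c' E ksrc_comp.
  exists (kcomp z (nxt (f (N + j)%N))); first by rewrite krng_comp.
  by rewrite addnS fS {1}E kcompA.
(* The sum of the coordinates bounds each of them and is monotone in [n]. *)
pose top n := (\sum_i n i)%N.
have topP n i : (n i <= top n)%N by rewrite /top (bigD1 i)//= leq_addr.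
have tk n N : (forall i, n i <= N)%N -> kpaths_le n (ktake n (f N)).
  move=> nN; apply: (kle_take lconv (m := nconst N)) => [|i]; last by rewrite nE.
  exact/kle_max/fle.
have indep n N M : (forall i, n i <= N)%N -> (N <= M)%N ->
    ktake n (f N) = ktake n (f M).
  move=> nN /fpre[z c ->]; rewrite ktake_comp// => i.
  have [|lt] := leqP (n i) (kdeg (f N) i); first by lia.
  suff -> : kdeg z i = 0%N by lia.
  apply/eqP; rewrite -leqn0 leqNgt; apply/negP => /kdeg_has_edge; rewrite -c.
  have /kleP[_] := fle N; apply; rewrite nE.
  by have := nN i; lia.
have le n : kpaths_le n (ktake n (f (top n))) by exact: tk.
have take m n : (forall i, m i <= n i)%N ->
    ktake m (f (top m)) = ktake m (ktake n (f (top n))).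
  by move=> mn; rewrite ktake_take// (@indep m (top m) (top n))// leq_sum.
by exists (BPath le take); rewrite /brng /= krng_take.
Qed.

End BoundaryPaths.

(** * Bounded operators on l2 *)

Section UnorderedSums.
Variables (R : realType) (X : choiceType).
Local Notation C := (R[i]%type).
Local Notation cRe := (@complex.Re R).
Implicit Types (F G : {fset X}) (h : X -> C).

Definition psum h F : C^o := \sum_(x <- F) h x.

(** Sums over boundary paths are limits along the finite subsets ordered by inclusion, because there
    can be uncountably many paths. *)
Definition totally : set_system {fset X} :=
  filter_from setT (fun F => [set G | (F `<=` G)%fset]).

Instance totally_filter : ProperFilter totally.
Proof.
apply: filter_from_proper => [|F _]; last by exists F => /=.
apply: filter_fromT_filter; first by exists fset0.
by move=> F G; exists (F `|` G)%fset => H /=; rewrite fsubUset => /andP[].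
Qed.

Lemma psum_incl h F G : (F `<=` G)%fset ->
  psum h G = psum h F + \sum_(x <- G | x \notin F) h x.
Proof.
move=> FG; rewrite /psum (bigID (fun x => x \in F))/=; congr (_ + _).
rewrite -big_filter; apply: perm_big; apply: uniq_perm; rewrite ?filter_uniq//.
move=> x; rewrite mem_filter; case: (boolP (x \in F)) => //= xF.
by rewrite (fsubsetP FG).
Qed.

Definition abs_bounded h := exists M : C, forall F, psum (fun x => `|h x|) F <= M.

(** Beyond a finite set whose sum of absolute values is within [e] of the supremum, partial sums
    move by less than [e]. *)
Lemma psum_cvg h : abs_bounded h -> cvg (psum h @ totally).
Proof.
move=> [M hM].
have pos F : psum (fun x => `|h x|) F = (cRe (psum (fun x => `|h x|) F))%:C%C.
  by rewrite RRe_real// ger0_real// sumr_ge0.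
have M0 : 0 <= M by rewrite (le_trans _ (hM fset0))// /psum sumr_ge0.
have MR : M = (cRe M)%:C%C by rewrite RRe_real// ger0_real.
pose E := [set cRe (psum (fun x => `|h x|) F) | F in setT].
have E0 : has_sup E.
  split; first by exists (cRe (psum (fun x => `|h x|) fset0)), fset0.
  by exists (cRe M) => _ [F _ <-]; rewrite -lecR -pos -MR.
apply: complex_complete; apply: cauchy_exP => e /gt0_complex[r r0 ->].
have [_ [F _ <-] Fr] := sup_adherent r0 E0.
exists (psum h F).
have: totally [set G | (F `<=` G)%fset] by exists F.
apply: filterS => G /= FG; rewrite -ball_normE /= distrC (psum_incl h FG) addrC addKr.
apply: (le_lt_trans (ler_norm_sum _ _ _)).
have := psum_incl (fun x => `|h x|) FG => /eqP.
rewrite addrC -subr_eq => /eqP <-; rewrite pos [X in _ - X]pos -rmorphB ltcR.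
rewrite ltrBlDl -ltrBlDr; apply: le_lt_trans Fr; rewrite lerB//.
by apply: ub_le_sup; [case: E0|exists G].
Qed.

Definition usum h : C := lim (psum h @ totally).

Lemma usum_cvg h : abs_bounded h -> psum h @ totally --> (usum h : C^o).
Proof. exact: psum_cvg. Qed.

Lemma usum_eq h (s : C^o) : psum h @ totally --> s -> usum h = s.
Proof. by move=> hs; apply: (cvg_lim (@norm_hausdorff C C^o)). Qed.

Lemma usumD h h' : abs_bounded h -> abs_bounded h' ->
  usum (fun x => h x + h' x) = usum h + usum h'.
Proof.
move=> hb hb'; apply: usum_eq.
have -> : psum (fun x => h x + h' x) = (fun F => psum h F + psum h' F).
  by apply/funext => F; rewrite /psum big_split.
by apply: cvgD; exact: usum_cvg.
Qed.

Lemma usumZ c h : abs_bounded h -> usum (fun x => c * h x) = c * usum h.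
Proof.
move=> hb; apply: usum_eq.
have -> : psum (fun x => c * h x) = (fun F => c *: psum h F).
  by apply/funext => F; rewrite /psum scaler_sumr.
apply: cvgZ; [exact: cvg_cst|exact: usum_cvg].
Qed.

Lemma usum_conj h : abs_bounded h -> usum (fun x => (h x)^*) = (usum h)^*.
Proof.
move=> hb; apply: usum_eq; have hc := usum_cvg hb.
apply/(@cvgrPdist_lt C C^o) => e e0.
move/(@cvgrPdist_lt C C^o)/(_ e e0): hc; apply: filterS => F.
by rewrite /psum -rmorph_sum -rmorphB norm_conjC.
Qed.

Lemma usum_real h : (forall x, 0 <= h x) -> abs_bounded h -> usum h \is Num.real.
Proof.
move=> h0 hb; apply/CrealP; rewrite -usum_conj//; congr usum; apply/funext => x.
by rewrite conj_Creal// ger0_real.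
Qed.

Lemma usum_ge h F : (forall x, 0 <= h x) -> abs_bounded h -> psum h F <= usum h.
Proof.
move=> h0 hb; have /(@cvgrPdist_lt C C^o) hc := usum_cvg hb.
have ge0s G : 0 <= psum h G by exact: sumr_ge0.
rewrite real_leNgt ?usum_real ?ger0_real//; apply/negP => lt.
have e0 : 0 < psum h F - usum h by rewrite subr_gt0.
have FG : totally [set G | (F `<=` G)%fset] by exists F.
have [G [/= FG' dG]] := filter_ex (filterI FG (hc _ e0)).
have := le_lt_trans (real_ler_norm (rpredB (ger0_real (ge0s G)) (usum_real h0 hb))) (_ : _ < _).
rewrite distrC => /(_ _ dG); rewrite ltrD2r => lt'.
have : psum h F <= psum h G by rewrite (psum_incl h FG') lerDl sumr_ge0.
by rewrite real_leNgt ?ger0_real// lt'.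
Qed.

Lemma usum_le h (M : C) : (forall x, 0 <= h x) -> (forall F, psum h F <= M) ->
  usum h <= M.
Proof.
move=> h0 hM; have hb : abs_bounded h.
  by exists M => F; rewrite /psum (eq_bigr h) => [|x _]; rewrite ?ger0_norm//; exact: hM.
have /(@cvgrPdist_lt C C^o) hc := usum_cvg hb.
have ge0s G : 0 <= psum h G by exact: sumr_ge0.
have Mr : M \is Num.real by rewrite ger0_real// (le_trans (ge0s fset0)).
rewrite real_leNgt ?usum_real//; apply/negP => lt.
have e0 : 0 < usum h - M by rewrite subr_gt0.
have [G dG] := filter_ex (hc _ e0).
have := le_lt_trans (real_ler_norm (rpredB (usum_real h0 hb) (ger0_real (ge0s G)))) dG.
by rewrite ltrD2l ltrN2 => /lt_le_trans/(_ (hM G)); rewrite ltxx.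
Qed.

Lemma usum1 h x0 : (forall x, x != x0 -> h x = 0) -> usum h = h x0.
Proof.
move=> hx; apply: usum_eq.
apply: cvg_near_cst; exists [fset x0]%fset => // F /=; rewrite fsub1set => xF.
rewrite /psum (big_fsetD1 x0)//= big_seq big1 ?addr0// => x.
by rewrite !inE => /andP[/hx].
Qed.

(** A partial bijection, given in both directions. Prefixing a fixed path is one on the boundary
    paths; it induces a partial isometry together with its adjoint. *)
Definition pinverse (f g : X -> option X) : Prop :=
  forall x y, f x = Some y <-> g y = Some x.

Lemma pinverse_sym f g : pinverse f g -> pinverse g f.
Proof. by move=> fg x y; split=> /fg. Qed.

Lemma pinverse_pmap_uniq f g (s : seq X) : pinverse f g -> uniq s -> uniq (pmap f s).
Proof.
move=> fg; elim: s => //= x s IH /andP[xs us].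
case fx: (f x) => [y|] /=; last exact: IH.
rewrite IH// andbT; apply/negP; rewrite mem_pmap => /mapP[x' x's /esym/fg].
by move/fg: fx => -> [xx]; rewrite xx x's in xs.
Qed.

Lemma psum_pmap f g F h' : pinverse f g ->
  psum (fun x => oapp h' 0 (f x)) F = psum h' [fset y in pmap f F]%fset.
Proof.
move=> fg; rewrite /psum -big_pmap; apply: perm_big; apply: uniq_perm => //.
  exact: pinverse_pmap_uniq fg _.
by move=> y; rewrite !inE.
Qed.

Lemma usum_pinverse f g h' : pinverse f g -> (forall y, g y = None -> h' y = 0) ->
  abs_bounded h' -> usum (fun x => oapp h' 0 (f x)) = usum h'.
Proof.
move=> fg h'0 hb; apply: usum_eq; have hc := usum_cvg hb.
apply/(@cvgrPdist_lt C C^o) => e e0.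
have /(@cvgrPdist_lt C C^o)/(_ e e0)[F' _ F'e] := hc.
exists [fset x in pmap g F']%fset => // G /= FG; rewrite (psum_pmap _ _ fg).
set G' := [fset y in _]%fset.
have -> : psum h' G' = psum h' (G' `|` F')%fset.
  rewrite (psum_incl h' (fsubsetUl G' F')) big_seq_cond big1 ?addr0// => y /andP[].
  rewrite in_fsetU => /orP[-> //|yF] yG; case gy: (g y) => [x|]; last exact: h'0.
  case/negP: yG; rewrite inE /= mem_pmap; apply/mapP; exists x; last first.
    by apply/esym/fg.
  by apply: (fsubsetP FG); rewrite inE /= mem_pmap -gy map_f.
by apply: F'e; rewrite /= fsubsetUr.
Qed.

End UnorderedSums.

Section Conj.
Variable C : numClosedFieldType.
Implicit Types a b : C.
Lemma cjM a b : (a * b)^* = a^* * b^*. Proof. exact: rmorphM. Qed.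
Lemma cjD a b : (a + b)^* = a^* + b^*. Proof. exact: rmorphD. Qed.
Lemma cjN a : (- a)^* = - a^*. Proof. exact: rmorphN. Qed.
Lemma cj0 : (0 : C)^* = 0. Proof. exact: rmorph0. Qed.
Lemma cjV a : (a^-1)^* = (a^*)^-1. Proof. exact: fmorphV. Qed.
End Conj.

(** * The Hilbert space of square-summable functions *)

Section Ell2.
Variables (R : realType) (X : choiceType).
Local Notation C := (R[i]%type).
Implicit Types (F G : {fset X}) (f g h : X -> C).

Definition sq_bounded f : Prop := abs_bounded (fun x => `|f x| ^+ 2).
Definition ell2_pred : {pred X -> C} := [pred f | `[< sq_bounded f >]].

Lemma psum_sqE f F : psum (fun x => `| `|f x| ^+ 2 |) F = psum (fun x => `|f x| ^+ 2) F.
Proof. by apply: eq_bigr => x _; rewrite ger0_norm// exprn_ge0. Qed.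

Lemma sqr_normD_le (V : normedModType C) (a b : V) :
  `|a + b| ^+ 2 <= 2 * `|a| ^+ 2 + 2 * `|b| ^+ 2.
Proof.
apply: (@le_trans _ _ ((`|a| + `|b|) ^+ 2)).
  by rewrite lerXn2r ?nnegrE ?addr_ge0 ?ler_normD.
have -> : 2 * `|a| ^+ 2 + 2 * `|b| ^+ 2 = (`|a| + `|b|) ^+ 2 + (`|a| - `|b|) ^+ 2 by ring.
by rewrite lerDl real_exprn_even_ge0// rpredB// ger0_real.
Qed.

Fact ell2_submod_closed : submod_closed ell2_pred.
Proof.
split.
  by apply/asboolP; exists 0 => F; rewrite /psum big1// => x _; rewrite !normr0 expr0n normr0.
move=> c f g /asboolP[M fM] /asboolP[N gN]; apply/asboolP.
exists (2 * (`|c| ^+ 2 * M) + 2 * N) => F; rewrite psum_sqE.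
apply: (@le_trans _ _ (psum (fun x => 2 * (`|c| ^+ 2 * `|f x| ^+ 2) + 2 * `|g x| ^+ 2) F)).
  apply: ler_sum => x _; apply: le_trans (sqr_normD_le (c *: f x : C^o) (g x)) _.
  by rewrite normrZ exprMn.
rewrite /psum big_split /= -!mulr_sumr lerD// ler_wpM2l//.
  by rewrite ler_wpM2l ?exprn_ge0//; have := fM F; rewrite psum_sqE.
by have := gN F; rewrite psum_sqE.
Qed.
HB.instance Definition _ := GRing.isSubmodClosed.Build C (X -> C) ell2_pred ell2_submod_closed.

Record ell2 := Ell2 { ell2_fun :> X -> C; ell2_funP : ell2_fun \in ell2_pred }.
HB.instance Definition _ := [isSub for ell2_fun].
HB.instance Definition _ := [Choice of ell2 by <:].
HB.instance Definition _ := [SubChoice_isSubLmodule of ell2 by <:].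

Implicit Types (u v w : ell2).

Lemma ell2P u v : (u : X -> C) =1 v -> u = v.
Proof. by move=> uv; apply: val_inj; apply/funext. Qed.

Lemma ell2D u v x : (u + v) x = u x + v x. Proof. by []. Qed.
Lemma ell2Z c u x : (c *: u) x = c * u x. Proof. by []. Qed.

Lemma ell2_sqb u : sq_bounded u. Proof. exact/asboolP/ell2_funP. Qed.

Lemma ell2_prod_bounded u v : abs_bounded (fun x => u x * (v x)^*).
Proof.
have [M uM] := ell2_sqb u; have [N vN] := ell2_sqb v.
exists (M + N) => F.
apply: (@le_trans _ _ (psum (fun x => `|u x| ^+ 2 + `|v x| ^+ 2) F)).
  apply: ler_sum => x _; rewrite normrM norm_conjC.
  have : 0 <= (`|u x| - `|v x|) ^+ 2 by rewrite real_exprn_even_ge0// rpredB// ger0_real.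
  have -> : (`|u x| - `|v x|) ^+ 2 = `|u x| ^+ 2 + `|v x| ^+ 2 - 2 * (`|u x| * `|v x|) by ring.
  rewrite subr_ge0; apply: le_trans; rewrite ler_peMl ?mulr_ge0// ler1n//.
by rewrite /psum big_split /= lerD//; [have := uM F|have := vN F]; rewrite psum_sqE.
Qed.

Definition ip u v : C := usum (fun x => u x * (v x)^*).

Lemma ipDl u v w : ip (u + v) w = ip u w + ip v w.
Proof.
rewrite -usumD; [|exact: ell2_prod_bounded|exact: ell2_prod_bounded].
by congr usum; apply/funext => x; rewrite ell2D mulrDl.
Qed.

Lemma ipZl c u v : ip (c *: u) v = c * ip u v.
Proof.
rewrite -usumZ; last exact: ell2_prod_bounded.
by congr usum; apply/funext => x; rewrite ell2Z mulrA.
Qed.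

Lemma ip_conj u v : (ip u v)^* = ip v u.
Proof.
rewrite -usum_conj; last exact: ell2_prod_bounded.
by congr usum; apply/funext => x; rewrite cjM conjCK mulrC.
Qed.

Lemma ipDr u v w : ip w (u + v) = ip w u + ip w v.
Proof. by rewrite -ip_conj ipDl cjD !ip_conj. Qed.
Lemma ipZr c u v : ip u (c *: v) = c^* * ip u v.
Proof. by rewrite -ip_conj ipZl cjM ip_conj. Qed.
Lemma ip0l v : ip 0 v = 0.
Proof. by rewrite -(scale0r 0) ipZl mul0r. Qed.
Lemma ip0r v : ip v 0 = 0.
Proof. by rewrite -ip_conj ip0l cj0. Qed.

Lemma ip_sqE u : ip u u = usum (fun x => `|u x| ^+ 2).
Proof. by congr usum; apply/funext => x; rewrite normCK. Qed.

Lemma ip_ge u F : psum (fun x => `|u x| ^+ 2) F <= ip u u.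
Proof.
by rewrite ip_sqE; apply: usum_ge => [x|]; [rewrite exprn_ge0|exact: ell2_sqb].
Qed.

Lemma ip_le u (M : C) : (forall F, psum (fun x => `|u x| ^+ 2) F <= M) -> ip u u <= M.
Proof. by move=> uM; rewrite ip_sqE; apply: usum_le => // x; rewrite exprn_ge0. Qed.

Lemma ip_ge0 u : 0 <= ip u u.
Proof. by apply: le_trans (ip_ge u fset0); rewrite sumr_ge0// => x _; rewrite exprn_ge0. Qed.

Lemma ip_ge_at u x : `|u x| ^+ 2 <= ip u u.
Proof. by apply: le_trans (ip_ge u [fset x]%fset); rewrite /psum big_seq_fset1. Qed.

Lemma ip_eq0 u : ip u u = 0 -> u = 0.
Proof.
move=> u0; apply: ell2P => x; apply/eqP; rewrite -normr_eq0 -sqrf_eq0.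
by rewrite eq_le exprn_ge0// -u0 ip_ge_at.
Qed.

Definition ell2_norm u : C := sqrtC (ip u u).

Lemma ell2_norm_ge0 u : 0 <= ell2_norm u. Proof. by rewrite sqrtC_ge0 ip_ge0. Qed.
Lemma ell2_normK u : ell2_norm u ^+ 2 = ip u u. Proof. exact: sqrtCK. Qed.

Lemma cauchy_schwarz u v : `|ip u v| <= ell2_norm u * ell2_norm v.
Proof.
have [v0|v0] := eqVneq (ip v v) 0.
  by rewrite (ip_eq0 v0) ip0r normr0 mulr_ge0 ?ell2_norm_ge0.
have vgt : 0 < ip v v by rewrite lt_def v0 ip_ge0.
rewrite -(@ler_pXn2r _ 2) ?nnegrE ?mulr_ge0 ?ell2_norm_ge0// exprMn !ell2_normK.
have := ip_ge0 (u + (- (ip u v / ip v v)) *: v).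
rewrite ipDl !ipDr !ipZl !ipZr.
have vr : (ip v v)^* = ip v v by rewrite ip_conj.
have -> : (- (ip u v / ip v v))^* = - ((ip u v)^* / ip v v).
  by rewrite cjN cjM cjV vr.
rewrite -(ip_conj u v) normCK.
have -> : ip u u + - ((ip u v)^* / ip v v) * ip u v + (- (ip u v / ip v v) * (ip u v)^* +
   - (ip u v / ip v v) * (- ((ip u v)^* / ip v v) * ip v v)) =
   ip u u - ip u v * (ip u v)^* / ip v v by field.
by rewrite subr_ge0 ler_pdivrMr.
Qed.

Fact ell2_normD u v : ell2_norm (u + v) <= ell2_norm u + ell2_norm v.
Proof.
rewrite -(@ler_pXn2r _ 2) ?nnegrE ?addr_ge0 ?ell2_norm_ge0//.
rewrite sqrrD !ell2_normK ipDl !ipDr -!addrA lerD2l !addrA lerD2r.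
rewrite -(ip_conj u v); have -> : ip u v + (ip u v)^* = 2 * 'Re (ip u v).
  by rewrite ReE mulrCA divff ?mulr1// pnatr_eq0.
rewrite -[leRHS]mulr2n -[leRHS]mulr_natl ler_wpM2l//; apply: le_trans (cauchy_schwarz u v).
exact: le_trans (real_ler_norm (Creal_Re _)) (leif_normC_Re_Creal _).
Qed.

Fact ell2_normZ (c : C) u : ell2_norm (c *: u) = `|c| * ell2_norm u.
Proof.
rewrite /ell2_norm ipZl ipZr mulrA -normCK rootCMl ?exprn_ge0//.
by rewrite sqrCK.
Qed.

Fact ell2_norm0 u : ell2_norm u = 0 -> u = 0.
Proof. by move=> u0; apply: ip_eq0; rewrite -ell2_normK u0 expr0n. Qed.

HB.instance Definition _ := Lmodule_isNormed.Build C ell2 ell2_normD ell2_normZ ell2_norm0.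

Lemma ell2_normE u : `|u| = ell2_norm u. Proof. by []. Qed.
Lemma ip_norm u : ip u u = `|u| ^+ 2. Proof. by rewrite ell2_normE ell2_normK. Qed.

Lemma ell2_norm_ge_at u x : `|u x| <= `|u|.
Proof. by rewrite -(@ler_pXn2r _ 2) ?nnegrE// -ip_norm ip_ge_at. Qed.

Lemma ell2_norm_le u (M : C) : 0 <= M ->
  (forall F, psum (fun x => `|u x| ^+ 2) F <= M ^+ 2) -> `|u| <= M.
Proof. by move=> M0 uM; rewrite -(@ler_pXn2r _ 2) ?nnegrE// -ip_norm ip_le. Qed.

Fact ell2_complete (FF : set_system ell2) : ProperFilter FF -> cauchy FF -> cvg FF.
Proof.
move=> PF /cauchyP Fc.
have near_ball (e : C) : 0 < e -> exists f : ell2, FF [set g : ell2 | `|f - g| < e].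
  by move=> e0; have [f Ff] := Fc _ e0; exists f; rewrite -ball_normE in Ff.
have evcvg x : cvg ((fun u : ell2 => u x : C^o) @ FF).
  apply: complex_complete; apply: cauchy_exP => e /near_ball[f Ff].
  exists (f x : C^o); change (FF ((fun u : ell2 => u x : C^o) @^-1` ball (f x : C^o) e)).
  apply: filterS Ff => g /= fg; rewrite -ball_normE /=.
  exact: le_lt_trans (ell2_norm_ge_at (f - g) x) fg.
pose l x : C := lim ((fun u : ell2 => u x : C^o) @ FF).
have lP (e : C) (f : ell2) F : 0 < e -> FF [set g : ell2 | `|f - g| < e] ->
    psum (fun x => `|l x - f x| ^+ 2) F <= 4 * e ^+ 2.
  (* Pointwise convergence is used on the finite set [F] only; the tolerance [d] depends on its
     cardinality, so that the terms [2 d^2] add up to at most [2 e^2]. *)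
  move=> e0 Ff; pose d := e / (#|` F|.+1)%:R.
  have d0 : 0 < d by rewrite divr_gt0// ltr0n.
  have : FF [set g : ell2 | forall x, x \in (F : seq X) -> `|l x - g x| < d].
    elim: (F : seq X) => [|x s IH]; first by apply: filterE => g x; rewrite in_nil.
    have /(@cvgrPdist_lt C C^o)/(_ _ d0) lx := evcvg x.
    apply: filterS (filterI lx IH) => g [/= gx gs] y.
    by rewrite inE => /predU1P[->|/gs].
  move=> /(filterI Ff)/filter_ex[g [/= fg lg]].
  apply: (@le_trans _ _ (psum (fun x => 2 * `|g x - f x| ^+ 2) F + \sum_(x <- F) 2 * d ^+ 2)).
    rewrite /psum -big_split /= !big_seq; apply: ler_sum => x xF.
    have -> : l x - f x = (g x - f x) + (l x - g x) by ring.
    apply: (le_trans (sqr_normD_le (g x - f x : C^o) (l x - g x : C^o))).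
    rewrite lerD2l.
    by rewrite ler_wpM2l// lerXn2r ?nnegrE ?(ltW d0)// ltW// lg.
  have -> : 4 * e ^+ 2 = 2 * e ^+ 2 + 2 * e ^+ 2 by ring.
  rewrite lerD//.
    rewrite /psum -mulr_sumr ler_wpM2l//.
    apply: (le_trans (ip_ge (g - f) F)); rewrite ip_norm distrC.
    by rewrite lerXn2r ?nnegrE ?(ltW e0)// ltW.
  rewrite -mulr_sumr ler_wpM2l// big_const_seq count_predT iter_addr_0.
  rewrite /d expr_div_n -[leLHS]mulr_natr -mulrA -[leRHS]mulr1 ler_wpM2l//.
    by rewrite exprn_ge0// ltW.
  rewrite mulrC ler_pdivrMr ?exprn_gt0 ?ltr0n// mul1r -natrX ler_nat.
  by rewrite (leq_trans (leqnSn _))// leq_pmulr.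
have lsq : l \in ell2_pred.
  have [f Ff] := near_ball 1 ltr01; apply/asboolP.
  exists (2 * (4 * 1 ^+ 2) + 2 * ip f f) => F; rewrite psum_sqE.
  apply: (@le_trans _ _ (psum (fun x => 2 * `|l x - f x| ^+ 2 + 2 * `|f x| ^+ 2) F)).
    apply: ler_sum => x _; rewrite -{1}(subrK (f x) (l x)).
    exact: (sqr_normD_le (l x - f x : C^o) (f x)).
  rewrite /psum big_split /= -!mulr_sumr lerD// ler_wpM2l//; first exact: lP.
  exact: ip_ge.
apply/cvg_ex; exists (Ell2 lsq); apply/cvgrPdist_lt => e e0.
have e4 : 0 < e / 4 by rewrite divr_gt0.
have [f Ff] := near_ball _ e4.
have Ff' := Ff; apply: filterS Ff => g fg; rewrite -(subrKA f).
have -> : e = 2 * (e / 4) + 2 * (e / 4) by field.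
rewrite (le_lt_trans (ler_normD _ _))// ler_ltD//.
  apply: ell2_norm_le => [|F]; first by rewrite mulr_ge0// ltW.
  rewrite exprMn (_ : 2 ^+ 2 = 4); first exact: (lP _ f F e4 Ff').
  by rewrite -natrX.
apply: lt_le_trans fg _; rewrite ler_peMl ?(ltW e4)// ler1n.
Unshelve. all: by end_near. Qed.

HB.instance Definition _ := Uniform_isComplete.Build ell2 ell2_complete.

End Ell2.

(** * The C*-algebra of bounded operators *)

Section BoundedOperators.
Variables (R : realType) (X : choiceType).
Local Notation C := (R[i]%type).
Local Notation cRe := (@complex.Re R).
Local Notation H := (ell2 R X).
Implicit Types (u v w : H).

Lemma ip_ext u w : (forall v, ip u v = ip w v) -> u = w.
Proof.
move=> uw; apply/eqP; rewrite -subr_eq0; apply/eqP/ip_eq0.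
by rewrite ipDl -scaleN1r ipZl uw mulN1r subrr.
Qed.

Lemma ipBl u v w : ip (u - v) w = ip u w - ip v w.
Proof. by rewrite ipDl -scaleN1r ipZl mulN1r. Qed.
Lemma ipBr u v w : ip w (u - v) = ip w u - ip w v.
Proof. by rewrite -ip_conj ipBl cjD cjN !ip_conj. Qed.

(** A bounded operator is stored together with its adjoint. *)
Record bop := Bop {
  bop_fun :> H -> H;
  bop_adj : H -> H;
  bop_adjP : forall u v, ip (bop_fun u) v = ip u (bop_adj v);
  bop_bounded : exists M : C, forall u, `|bop_fun u| <= M * `|u| }.
Implicit Types S T : bop.

HB.instance Definition _ := gen_eqMixin bop.
HB.instance Definition _ := gen_choiceMixin bop.

Lemma bopP S T : (S : H -> H) =1 T -> S = T.
Proof.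
move=> /funext; case: S T => [f f' fP fb] [g g' gP gb] /= fg; subst g.
have fg' : f' = g'.
  apply/funext => v; apply: ip_ext => u.
  by apply: (inv_inj (@conjCK C)); rewrite !ip_conj -fP.
by subst g'; congr Bop; exact: Prop_irrelevance.
Qed.

Lemma bopD T : {morph (T : H -> H) : u v / u + v}.
Proof. by move=> u v; apply: ip_ext => w; rewrite !(ipDl, bop_adjP). Qed.
Lemma bopZ T (c : C) u : T (c *: u) = c *: T u.
Proof. by apply: ip_ext => w; rewrite !(ipZl, bop_adjP). Qed.
Lemma bop0 T : T 0 = 0. Proof. by rewrite -(scale0r 0) bopZ !scale0r. Qed.

Lemma bop_adjP' T u v : ip (bop_adj T u) v = ip u (T v).
Proof. by rewrite -ip_conj -bop_adjP ip_conj. Qed.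

(** [|T^* v|^2 = <T T^* v, v>], which Cauchy-Schwarz bounds by [M |T^* v| |v|]. *)
Lemma adj_le T (M : C) : (forall u, `|T u| <= M * `|u|) ->
  forall v, `|bop_adj T v| <= M * `|v|.
Proof.
move=> TM v; have [->|v0] := eqVneq (bop_adj T v) 0.
  by rewrite normr0 (le_trans _ (TM v)).
have vgt : 0 < `|bop_adj T v| by rewrite normr_gt0.
rewrite -(ler_pM2l vgt) -expr2 -ip_norm -bop_adjP.
have nn : 0 <= ip (T (bop_adj T v)) v by rewrite bop_adjP ip_ge0.
rewrite -(ger0_norm nn) (le_trans (cauchy_schwarz _ _))//.
by rewrite -!ell2_normE mulrA [_ * M]mulrC ler_wpM2r.
Qed.

Definition bop_sup T : R := sup [set cRe `|T u| | u in [set u : H | `|u| <= 1]].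
Definition bop_norm T : C := (bop_sup T)%:C%C.

Lemma bop_has_sup T : has_sup [set cRe `|T u| | u in [set u : H | `|u| <= 1]].
Proof.
split; first by exists (cRe `|T 0|), 0 => //=; rewrite normr0 ler01.
have [M TM] := bop_bounded T; exists (cRe `|M|) => _ [u /= u1 <-].
rewrite -lecR -!norm_cReE -[leRHS]mulr1.
have -> : `|T u| = `| `|T u| | by rewrite normr_id.
have := TM u; have := normr_ge0 (T u) => p0 le.
rewrite normr_id (le_trans le)//.
have M0 : 0 <= M * `|u| by exact: le_trans le.
by rewrite -(ger0_norm M0) normrM normr_id ler_wpM2l.
Qed.

Lemma bop_norm_le T (M : C) : 0 <= M -> (forall u, `|T u| <= M * `|u|) -> bop_norm T <= M.
Proof.
move=> M0 TM; have MR : M = (cRe M)%:C%C by rewrite RRe_real// ger0_real.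
rewrite /bop_norm MR lecR; apply: ge_sup; first by case: (bop_has_sup T).
move=> _ [u /= u1 <-]; rewrite -lecR -norm_cReE -MR (le_trans (TM u))//.
by rewrite -[leRHS]mulr1 ler_wpM2l.
Qed.

Lemma bop_norm_ge T u : `|T u| <= bop_norm T * `|u|.
Proof.
have [->|u0] := eqVneq u 0; first by rewrite bop0 !normr0 mulr0.
have ugt : 0 < `|u| by rewrite normr_gt0.
have n1 : `| `|u|^-1 *: u | = 1 by rewrite normrZ normfV normr_id mulVf// gt_eqF.
rewrite -ler_pdivrMr// mulrC -[(`|u|)^-1]ger0_norm ?invr_ge0// -normrZ -bopZ.
rewrite norm_cReE lecR; apply: ub_le_sup; first by case: (bop_has_sup T).
by exists (`|u|^-1 *: u) => //=; rewrite n1.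
Qed.

Lemma bop_norm_ge0 T : 0 <= bop_norm T.
Proof.
rewrite ler0c; apply: le_trans (_ : cRe `|T 0| <= _); first exact: cRe_norm_ge0.
by apply: ub_le_sup; [case: (bop_has_sup T)|exists 0 => //=; rewrite normr0 ler01].
Qed.

Fact bopzero_adj u v : ip (0 : H) v = ip u (0 : H). Proof. by rewrite ip0l ip0r. Qed.
Fact bopzero_bdd : exists M : C, forall u, `|0 : H| <= M * `|u|.
Proof. by exists 0 => u; rewrite normr0 mul0r. Qed.
Definition bop_zero := Bop bopzero_adj bopzero_bdd.

Fact bopadd_adj S T u v : ip (S u + T u) v = ip u (bop_adj S v + bop_adj T v).
Proof. by rewrite ipDl ipDr !bop_adjP. Qed.
Fact bopadd_le S T u : `|S u + T u| <= (bop_norm S + bop_norm T) * `|u|.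
Proof. by rewrite (le_trans (ler_normD _ _))// mulrDl lerD ?bop_norm_ge. Qed.
Definition bop_add S T :=
  Bop (bopadd_adj S T) (ex_intro _ _ (bopadd_le S T)).

Fact bopscale_adj (c : C) T u v : ip (c *: T u) v = ip u (c^* *: bop_adj T v).
Proof. by rewrite ipZl ipZr conjCK bop_adjP. Qed.
Fact bopscale_le (c : C) T u : `|c *: T u| <= (`|c| * bop_norm T) * `|u|.
Proof. by rewrite normrZ -mulrA ler_wpM2l// bop_norm_ge. Qed.
Definition bop_scale (c : C) T :=
  Bop (bopscale_adj c T) (ex_intro _ _ (bopscale_le c T)).

Fact bop_addA : associative bop_add.
Proof. by move=> S T U; apply: bopP => u; exact: addrA. Qed.
Fact bop_addC : commutative bop_add.
Proof. by move=> S T; apply: bopP => u; exact: addrC. Qed.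
Fact bop_add0 : left_id bop_zero bop_add.
Proof. by move=> S; apply: bopP => u; exact: add0r. Qed.
Fact bop_addN : left_inverse bop_zero (bop_scale (-1)) bop_add.
Proof. by move=> S; apply: bopP => u; rewrite /= scaleN1r addNr. Qed.
HB.instance Definition _ := GRing.isZmodule.Build bop bop_addA bop_addC bop_add0 bop_addN.

Lemma bop_addE S T u : (S + T) u = S u + T u. Proof. by []. Qed.
Lemma bop_subE S T u : (S - T) u = S u - T u.
Proof. by rewrite bop_addE; congr (_ + _); exact: scaleN1r. Qed.

Fact bop_scaleA (a b : C) T : bop_scale a (bop_scale b T) = bop_scale (a * b) T.
Proof. by apply: bopP => u; exact: scalerA. Qed.
Fact bop_scale1 : left_id 1 bop_scale.
Proof. by move=> T; apply: bopP => u; exact: scale1r. Qed.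
Fact bop_scaleDr : right_distributive bop_scale +%R.
Proof. by move=> a S T; apply: bopP => u; exact: scalerDr. Qed.
Fact bop_scaleDl T : {morph bop_scale^~ T : a b / a + b}.
Proof. by move=> a b; apply: bopP => u; exact: scalerDl. Qed.
HB.instance Definition _ := GRing.Zmodule_isLmodule.Build C bop
  bop_scaleA bop_scale1 bop_scaleDr bop_scaleDl.

Fact bop_normD S T : bop_norm (S + T) <= bop_norm S + bop_norm T.
Proof. by apply: bop_norm_le => [|u]; [rewrite addr_ge0 ?bop_norm_ge0|exact: bopadd_le]. Qed.

Fact bop_normZ (c : C) T : bop_norm (c *: T) = `|c| * bop_norm T.
Proof.
have le (a : C) S : bop_norm (a *: S) <= `|a| * bop_norm S.
  by apply: bop_norm_le => [|u]; [rewrite mulr_ge0 ?bop_norm_ge0|exact: bopscale_le].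
apply/eqP; rewrite eq_le le /=; have [->|c0] := eqVneq c 0.
  by rewrite normr0 mul0r bop_norm_ge0.
rewrite -[T in leLHS](scale1r T) -(mulVf c0) -scalerA.
rewrite (le_trans (ler_wpM2l _ (le _ _)))//.
by rewrite mulrA normfV divff ?mul1r// normr_eq0.
Qed.

Fact bop_norm0 T : bop_norm T = 0 -> T = 0.
Proof.
move=> T0; apply: bopP => u; have := bop_norm_ge T u.
by rewrite T0 mul0r normr_le0 => /eqP.
Qed.
HB.instance Definition _ := Lmodule_isNormed.Build C bop bop_normD bop_normZ bop_norm0.

Lemma bop_normE T : `|T| = bop_norm T. Proof. by []. Qed.

Lemma adj_norm_ge T v : `|bop_adj T v| <= `|T| * `|v|.
Proof. exact/adj_le/bop_norm_ge. Qed.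

Lemma bop_adjB S T v : bop_adj (S - T) v = bop_adj S v - bop_adj T v.
Proof. by apply: ip_ext => u; rewrite ipBl !bop_adjP' bop_subE ipBr. Qed.

(** Since adjoints are part of the data, pointwise limits are taken of the operators and of their
    adjoints; continuity of the inner product makes the two limits adjoint to each other. *)
Fact bop_complete (FF : set_system bop) : ProperFilter FF -> cauchy FF -> cvg FF.
Proof.
move=> PF /cauchyP Fc.
have near_ball (e : C) : 0 < e -> exists f : bop, FF [set g : bop | `|f - g| < e].
  by move=> e0; have [f Ff] := Fc _ e0; exists f; rewrite -ball_normE in Ff.
have evcvg (ev : bop -> H) (M : C) : 0 <= M ->
    (forall S T, `|ev S - ev T| <= `|S - T| * M) -> cvg (ev @ FF).
  move=> M0 evM; apply: cauchy_cvg; apply: cauchy_exP => e e0.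
  have M1 : 0 < M + 1 by rewrite ltr_wpDl.
  have [f Ff] := near_ball (e / (M + 1)) (divr_gt0 e0 M1).
  exists (ev f); change (FF (ev @^-1` ball (ev f) e)).
  apply: filterS Ff => g /= fg; rewrite -ball_normE /=.
  rewrite (le_lt_trans (evM _ _))// (le_lt_trans (_ : _ <= `|f - g| * (M + 1)))//.
    by rewrite ler_wpM2l// lerDl.
  by rewrite -ltr_pdivlMr.
have cv1 u : cvg ((fun T : bop => T u) @ FF).
  by apply: (evcvg _ `|u|) => // S T; rewrite -bop_subE bop_norm_ge.
have cv2 v : cvg ((fun T : bop => bop_adj T v) @ FF).
  by apply: (evcvg _ `|v|) => // S T; rewrite -bop_adjB adj_norm_ge.
pose l u : H := lim ((fun T : bop => T u) @ FF).
pose l' v : H := lim ((fun T : bop => bop_adj T v) @ FF).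
have lP (e : C) (f : bop) u : FF [set g : bop | `|f - g| < e] -> `|l u - f u| <= e * `|u|.
  move=> Ff; apply/ler_addgt0Pr => d d0.
  have /cvgrPdist_lt/(_ _ d0) lu := cv1 u.
  have [g [/= fg lg]] := filter_ex (filterI Ff lu).
  rewrite -(subrKA (g u)) addrC (le_trans (ler_normD _ _))// lerD//; last exact: ltW.
  by rewrite distrC -bop_subE (le_trans (bop_norm_ge _ _))// ler_wpM2r// ltW.
have ladj u v : ip (l u) v = ip u (l' v).
  apply/eqP; rewrite -subr_eq0 -normr_eq0 eq_le normr_ge0 andbT.
  apply/ler_addgt0Pr => d d0; rewrite add0r.
  have K0 : 0 < `|u| + `|v| + 1 by rewrite ltr_wpDl ?addr_ge0.
  have d1 : 0 < d / (`|u| + `|v| + 1) by rewrite divr_gt0.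
  have /cvgrPdist_lt/(_ _ d1) lu := cv1 u; have /cvgrPdist_lt/(_ _ d1) lv := cv2 v.
  have [g [/= /ltW gu /ltW gv]] := filter_ex (filterI lu lv).
  have -> : ip (l u) v - ip u (l' v) = ip (l u - g u) v - ip u (l' v - bop_adj g v).
    by rewrite ipBl ipBr bop_adjP; ring.
  rewrite (le_trans (ler_normB _ _))//.
  apply: (@le_trans _ _ (d / (`|u| + `|v| + 1) * (`|u| + `|v| + 1))); last first.
    by rewrite divfK// gt_eqF.
  rewrite (le_trans (_ : _ <= d / (`|u| + `|v| + 1) * `|v| + `|u| * (d / (`|u| + `|v| + 1))))//.
    apply: lerD; apply: le_trans (cauchy_schwarz _ _) _.
      by rewrite -!ell2_normE ler_wpM2r.
    by rewrite -!ell2_normE ler_wpM2l.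
  by rewrite [_ * (d / _)]mulrC -mulrDr ler_wpM2l ?(ltW d1)// addrC lerDl.
have [f1 Ff1] := near_ball 1 ltr01.
have lb u : `|l u| <= (1 + `|f1|) * `|u|.
  have -> : l u = (l u - f1 u) + f1 u by rewrite subrK.
  apply: (le_trans (ler_normD _ _)); rewrite mulrDl; apply: lerD; first exact: lP.
  exact: bop_norm_ge.
apply/cvg_ex; exists (Bop ladj (ex_intro _ _ lb)); apply/cvgrPdist_lt => e e0.
have e3 : 0 < e / 3 by rewrite divr_gt0.
have [f Ff] := near_ball _ e3; have Ff' := Ff.
apply: filterS Ff => g fg; rewrite -(subrKA f).
have lt2 : e / 3 + e / 3 < e.
  have -> : e / 3 + e / 3 = e - e / 3 by field.
  by rewrite ltrBlDr ltrDl.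
apply: le_lt_trans lt2; apply: (le_trans (ler_normD _ _)); apply: lerD; last exact: ltW.
apply: bop_norm_le => [|u]; first exact: ltW.
by rewrite bop_subE; exact: lP.
Unshelve. all: by end_near. Qed.
HB.instance Definition _ := Uniform_isComplete.Build bop bop_complete.

Fact bopmul_adj S T u v : ip (S (T u)) v = ip u (bop_adj T (bop_adj S v)).
Proof. by rewrite !bop_adjP. Qed.
Fact bopmul_le S T u : `|S (T u)| <= (bop_norm S * bop_norm T) * `|u|.
Proof.
by rewrite (le_trans (bop_norm_ge _ _))// -mulrA ler_wpM2l ?bop_norm_ge0 ?bop_norm_ge.
Qed.
Definition bop_mul S T := Bop (bopmul_adj S T) (ex_intro _ _ (bopmul_le S T)).
Definition bop_star T := Bop (bop_adjP' T) (ex_intro _ _ (adj_norm_ge T)).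

Fact bop_mulA : associative bop_mul. Proof. by move=> S T U; apply: bopP. Qed.
Fact bop_mulDl : left_distributive bop_mul +%R.
Proof. by move=> S T U; apply: bopP. Qed.
Fact bop_mulDr : right_distributive bop_mul +%R.
Proof. by move=> S T U; apply: bopP => u; exact: bopD. Qed.
Fact bop_mulZl (c : C) S T : bop_mul (c *: S) T = c *: bop_mul S T.
Proof. by apply: bopP. Qed.
Fact bop_mulZr (c : C) S T : bop_mul S (c *: T) = c *: bop_mul S T.
Proof. by apply: bopP => u; exact: bopZ. Qed.
Fact bop_starK : involutive bop_star. Proof. by move=> T; apply: bopP. Qed.
Fact bop_starD : {morph bop_star : S T / S + T}. Proof. by move=> S T; apply: bopP. Qed.
Fact bop_starZ (c : C) T : bop_star (c *: T) = c^* *: bop_star T.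
Proof. by apply: bopP. Qed.
Fact bop_starM S T : bop_star (bop_mul S T) = bop_mul (bop_star T) (bop_star S).
Proof. by apply: bopP. Qed.
Fact bop_normM S T : `|bop_mul S T| <= `|S| * `|T|.
Proof. by apply: bop_norm_le => [|u]; [rewrite mulr_ge0|exact: bopmul_le]. Qed.

Fact bop_cstar T : `|bop_mul (bop_star T) T| = `|T| ^+ 2.
Proof.
apply/eqP; rewrite eq_le; apply/andP; split.
  rewrite (le_trans (bop_normM _ _))// expr2 ler_wpM2r//.
  by apply: bop_norm_le => // u; exact: adj_norm_ge.
set N := `|bop_mul _ _|; have N0 : 0 <= N by exact: normr_ge0.
rewrite -[leRHS]sqrtCK lerXn2r ?nnegrE ?sqrtC_ge0//.
apply: bop_norm_le => [|u]; first by rewrite sqrtC_ge0.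
have q0 : 0 <= sqrtC N by rewrite sqrtC_ge0.
have le2 : `|T u| ^+ 2 <= N * `|u| ^+ 2.
  rewrite -ip_norm -bop_adjP'.
  have -> : ip (bop_adj T (T u)) u = ip (bop_mul (bop_star T) T u) u by [].
  have nn : 0 <= ip (bop_mul (bop_star T) T u) u by rewrite /= bop_adjP' ip_ge0.
  rewrite -(ger0_norm nn); apply: (le_trans (cauchy_schwarz _ _)).
  rewrite -!ell2_normE expr2 mulrA; apply: ler_wpM2r => //.
  by rewrite /N bop_normE bop_norm_ge.
rewrite -(@ler_pXn2r _ 2)// ?nnegrE ?normr_ge0//; last by rewrite mulr_ge0.
by rewrite exprMn (sqrtCK N).
Qed.

HB.instance Definition _ := CompleteNormedModule_isCStarAlgebra.Build C bop
  bop_mulA bop_mulDl bop_mulDr bop_mulZl bop_mulZr bop_starK bop_starD bop_starZ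
  bop_starM bop_normM bop_cstar.

Lemma bop_cmulE S T u : (S ** T : bop) u = S (T u). Proof. by []. Qed.
Lemma bop_scaleE (c : C) T u : (c *: T : bop) u = c *: T u. Proof. by []. Qed.
Lemma bop_starE T u : (star T : bop) u = bop_adj T u. Proof. by []. Qed.

End BoundedOperators.

(** * The boundary path representation *)

Section PartialBijections.
Variables (R : realType) (X : choiceType).
Local Notation C := (R[i]%type).
Local Notation H := (ell2 R X).
Implicit Types (f g : X -> option X) (u v : H).

Lemma pullback_psum f g u F : pinverse f g ->
  psum (fun y => `|oapp u 0 (g y)| ^+ 2 : C) F <= `|u| ^+ 2.
Proof.
move=> fg; rewrite -ip_norm.
have -> : psum (fun y => `|oapp u 0 (g y)| ^+ 2 : C) F =
    psum (fun y => oapp (fun x => `|u x| ^+ 2) 0 (g y)) F.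
  by apply: eq_bigr => y _; case: (g y) => //=; rewrite normr0 expr0n.
by rewrite (psum_pmap _ _ (pinverse_sym fg)) ip_ge.
Qed.

Fact pullback_ell2 f g u : pinverse f g ->
  (fun y => oapp u 0 (g y)) \in @ell2_pred R X.
Proof.
move=> fg; apply/asboolP; exists (`|u| ^+ 2) => F; rewrite psum_sqE.
exact: pullback_psum fg.
Qed.

(** Composition with the inverse [g] sends the basis vector at [x] to the one at [f x], or to 0
    where [f] is undefined. *)
Definition pullback f g (fg : pinverse f g) u : H := Ell2 (pullback_ell2 u fg).

Fact pullback_adj f g (fg : pinverse f g) u v :
  ip (pullback fg u) v = ip u (pullback (pinverse_sym fg) v).
Proof.
pose h x : C := u x * (oapp v 0 (f x))^*.
rewrite /ip; transitivity (usum (fun y => oapp h 0 (g y))).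
  congr usum; apply/funext => y /=; case gy: (g y) => [x|] /=; last by rewrite mul0r.
  by rewrite /h; move/fg: gy => ->.
rewrite (usum_pinverse (pinverse_sym fg))// => [x fx|]; first by rewrite /h fx cj0 mulr0.
exact: (ell2_prod_bounded u (pullback (pinverse_sym fg) v)).
Qed.

Fact pullback_le f g (fg : pinverse f g) u : `|pullback fg u| <= 1 * `|u|.
Proof. by rewrite mul1r; apply: ell2_norm_le => // F; exact: pullback_psum fg. Qed.

Definition pbop f g (fg : pinverse f g) : bop R X :=
  Bop (pullback_adj fg) (ex_intro _ _ (pullback_le fg)).

Lemma pbopE f g (fg : pinverse f g) u y : pbop fg u y = oapp u 0 (g y).
Proof. by []. Qed.
Lemma star_pbopE f g (fg : pinverse f g) u x : star (pbop fg) u x = oapp u 0 (f x).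
Proof. by []. Qed.

Fact delta_ell2 x : (fun y => (y == x)%:R : C) \in @ell2_pred R X.
Proof.
apply/asboolP; exists 1 => F; rewrite psum_sqE.
have [xF|xF] := boolP (x \in F).
  rewrite /psum (big_fsetD1 x)//= big_seq big1 ?addr0 ?eqxx ?normr1 ?expr1n// => y.
  by rewrite !inE => /andP[/negbTE -> _]; rewrite normr0 expr0n.
rewrite /psum big_seq big1 ?ler01// => y yF.
by case: eqP yF xF => [-> ->|] //; rewrite normr0 expr0n.
Qed.
Definition delta x : H := Ell2 (delta_ell2 x).

Lemma deltaE x y : delta x y = (y == x)%:R. Proof. by []. Qed.

Lemma ip_delta u x : ip u (delta x) = u x.
Proof.
rewrite /ip (@usum1 _ _ _ x) /= ?eqxx ?conjC1 ?mulr1// => y /negbTE yx.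
by rewrite yx cj0 mulr0.
Qed.

Lemma bop_sumE (I : eqType) (r : seq I) (F : I -> bop R X) u x :
  (\sum_(i <- r) F i) u x = \sum_(i <- r) F i u x.
Proof. by elim: r => [|i r IH]; rewrite ?big_nil// !big_cons -IH. Qed.

End PartialBijections.

Section BoundaryPathRepresentation.
Variables (R : realType) (k : nat) (L : kgraph k).
Hypotheses (rfin : kgraph_row_finite L) (lconv : kgraph_locally_convex L).
Local Notation C := (R[i]%type).
Local Notation X := (bpath L).
Implicit Types (v w : kobj L) (la mu nu : L) (x y : X).

Lemma kle_finite v n : finite_set (krange v (kpaths_le (L := L) n)).
Proof.
pose N := (\sum_i n i).+1.
pose D (g : {ffun 'I_k -> 'I_N}) : {ffun 'I_k -> nat} := [ffun i => nat_of_ord (g i)].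
apply: (@sub_finite_set _ _ (\bigcup_(g in [set: {ffun 'I_k -> 'I_N}]) krange v (kpaths L (D g)))).
  move=> la [/kleP[d _] r].
  have lt i : (kdeg la i < N)%N.
    by rewrite ltnS (leq_trans (d i))// (bigD1 i)//= leq_addr.
  exists [ffun i => Ordinal (lt i)] => //; split=> //.
  by apply/degP => i; rewrite !ffunE.
by apply: bigcup_finite => [|g _]; [exact: finite_finset|exact: rfin].
Qed.

Definition bfun la x : option X := if ksrc la == brng x then Some (bcons lconv la x) else None.
Definition bfun_inv la y : option X :=
  if y (kdeg la) == la then Some (bshift (kdeg la) y) else None.

Lemma bfunP la x y : bfun la x = Some y <-> ksrc la = brng x /\ bcons lconv la x = y.
Proof. by rewrite /bfun; case: eqP => [E|E]; split=> [[]|[]]// _ ->. Qed.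

Lemma bfun_pinverse la : pinverse (bfun la) (bfun_inv la).
Proof.
move=> x y; rewrite bfunP /bfun_inv; split=> [[c <-]|].
  by rewrite (bcons_seg _ (kle_deg _) c) eqxx bconsK.
case: eqP => // yE [<-]; rewrite -ksrc_bseg yE; split=> //.
by rewrite -{1}yE bshiftK.
Qed.

Definition brep la : bop R X := pbop R (bfun_pinverse la).

Lemma brep_idE v u y : brep (kid v) u y = if v == brng y then u y else 0.
Proof.
rewrite pbopE; have [->|nv] := eqVneq v (brng y).
  have /bfun_pinverse -> // : bfun (kid (brng y)) y = Some y.
  by apply/bfunP; rewrite ksrc_id bcons_id.
case E: (bfun_inv _ y) => [x|] //=; move/bfun_pinverse/bfunP: E => [].
rewrite ksrc_id => vx; rewrite vx bcons_id => xy.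
by rewrite vx xy eqxx in nv.
Qed.

Lemma brep_ssE la u y : (brep la ** star (brep la)) u y = if y (kdeg la) == la then u y else 0.
Proof.
rewrite [LHS]/(oapp _ 0 (bfun_inv la y)) /bfun_inv; case: eqP => //= yE.
rewrite [LHS]/(oapp u 0 (bfun la _)).
have /bfun_pinverse -> // : bfun_inv la y = Some (bshift (kdeg la) y).
by rewrite /bfun_inv yE eqxx.
Qed.

Lemma brep_ck : is_ck_family brep.
Proof.
split.
- move=> v; have E u y := brep_idE v u y; split; apply: bopP => u; apply: ell2P => y.
    by rewrite [LHS]brep_idE !brep_idE; case: (v == brng y).
  rewrite brep_idE star_pbopE /bfun ksrc_id; case: eqP => //= ->.
  by rewrite bcons_id.
- move=> v w vw; apply: bopP => u; apply: ell2P => y.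
  rewrite [LHS]brep_idE brep_idE; case: eqP => // <-.
  by rewrite eq_sym (negbTE vw).
- move=> mu nu c; apply: bopP => u; apply: ell2P => y.
  rewrite pbopE [LHS]/(oapp _ 0 (bfun_inv mu y)).
  case E: (bfun_inv mu y) => [x|] /=; last first.
    case E': (bfun_inv _ y) => [z|] //; move/bfun_pinverse/bfunP: E' => [].
    rewrite ksrc_comp// => cz; rewrite bcons_comp// => yE.
    have /bfun_pinverse : bfun mu (bcons lconv nu z) = Some y.
      by apply/bfunP; rewrite brng_cons.
    by rewrite E.
  move/bfun_pinverse/bfunP: E => [cx xy].
  congr (oapp u 0 _); case E: (bfun_inv nu x) => [z|].
    move/bfun_pinverse/bfunP: E => [cz zx]; apply/esym/bfun_pinverse/bfunP.
    by rewrite ksrc_comp// bcons_comp// zx.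
  case E': (bfun_inv _ y) => [z|] //; move/bfun_pinverse/bfunP: E' => [].
  rewrite ksrc_comp// => cz; rewrite bcons_comp// => yE.
  have : bfun_inv mu y = Some (bcons lconv nu z).
    by apply/bfun_pinverse/bfunP; rewrite brng_cons.
  have -> : bfun_inv mu y = Some x by apply/bfun_pinverse/bfunP.
  move=> [xz]; have : bfun_inv nu x = Some z by apply/bfun_pinverse/bfunP.
  by rewrite E.
- move=> mu; apply: bopP => u; apply: ell2P => x.
  rewrite brep_idE [LHS]/(oapp _ 0 (bfun mu x)).
  case E: (bfun mu x) => [y|] /=; last first.
    by move: E; rewrite /bfun; case: eqP.
  move/bfun_pinverse: (E) => ->; move/bfunP: E => [-> _].
  by rewrite eqxx.
- move=> v n; rewrite fsbig_finite /=; last exact: kle_finite.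
  apply: bopP => u; apply: ell2P => y; rewrite brep_idE bop_sumE.
  under eq_bigr do rewrite brep_ssE.
  (* For [la] in [Lambda^{<= n}], the boundary path [y] begins with [la] exactly when its segment
     [y n] is [la]. Hence exactly one summand of the last relation acts at [y]. *)
  have segE la : kpaths_le n la -> (y (kdeg la) == la) = (y n == la).
    move=> le; have [d _] := (kleP n la).1 le.
    apply/eqP/eqP => [yE|yE].
      have := ksrc_bseg (kdeg la) y; rewrite yE => c.
      by rewrite -[y in LHS](bshiftK lconv (kdeg la)) yE bcons_seg.
    by rewrite (bseg_take y d) yE ktake_full.
  have memE la : (la \in (fset_set (krange v (kpaths_le n)) : seq L)) =
      (la \in krange v (kpaths_le n)) by exact/in_fset_set/kle_finite.
  case: eqP => [vE|vE].
    rewrite (bigD1_seq (y n)) ?fset_uniq//=; last first.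
      rewrite memE; apply/mem_set; split; first exact: bseg_le.
      by rewrite krng_bseg.
    rewrite segE; last exact: bseg_le.
    rewrite eqxx big_seq_cond big1 => [|la /andP[]]; first by rewrite addr0.
    rewrite memE => /set_mem[le _].
    by rewrite segE// eq_sym => /negbTE ->.
  rewrite big_seq big1// => la; rewrite memE => /set_mem[le r].
  by rewrite segE//; case: eqP => // yn; case: vE; rewrite -r -yn krng_bseg.
Qed.

Lemma kga_vertex_neq0 (A : cstarAlgType C) (s : L -> A) v :
  is_kgraph_algebra s -> s (kid v) != 0.
Proof.
move=> sU; have [phi [_ phiZ _ _] phis] := kga_universal sU brep_ck.
have [x xv] := bpath_exists lconv v; apply/eqP => s0.
have t0 : brep (kid v) = 0 by rewrite -phis s0 -(scale0r 0) phiZ scale0r.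
have : brep (kid v) (delta R x) x = 0 by rewrite t0.
rewrite brep_idE xv eqxx deltaE eqxx => /eqP.
by rewrite oner_eq0.
Qed.

Definition zpow (z : 'I_k -> C) (n : {ffun 'I_k -> nat}) : C := \prod_i z i ^+ n i.

Lemma zpowD z n m : zpow z (n + m) = zpow z n * zpow z m.
Proof. by rewrite /zpow -big_split; apply: eq_bigr => i _; rewrite naddE exprD. Qed.

Lemma zpow_norm z n : (forall i, `|z i| = 1) -> `|zpow z n| = 1.
Proof.
by move=> z1; rewrite normr_prod big1// => i _; rewrite normrX z1 expr1n.
Qed.

Lemma zpow0 z : zpow z 0 = 1.
Proof. by rewrite /zpow big1// => i _; rewrite nzeroE expr0. Qed.

Lemma unit_conj (a : C) : `|a| = 1 -> a * a^* = 1.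
Proof. by move=> a1; rewrite -normCK a1 expr1n. Qed.

(** The gauge twist by a point of [T^k]: degrees add up along composites, and in [s_la s_la^*] the
    scalar cancels against its conjugate. It provides one character for each [z]. *)
Lemma gauge_ck (A : cstarAlgType C) (s : L -> A) (z : 'I_k -> C) :
  (forall i, `|z i| = 1) -> is_ck_family s ->
  is_ck_family (fun la => zpow z (kdeg la) *: s la).
Proof.
move=> z1 [sp so sc ss sum]; have e v : zpow z (kdeg (kid v)) *: s (kid v) = s (kid v).
  by rewrite kdeg_id zpow0 scale1r.
have u la := unit_conj (zpow_norm (kdeg la) z1).
split=> [v|v w vw|mu nu c|mu|v n]; rewrite ?e//.
- exact: so.
- by rewrite cmulZl cmulZr scalerA sc// kdeg_comp// zpowD.
- by rewrite starZ cmulZl cmulZr scalerA ss mulrC u scale1r.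
- rewrite (sum v n); apply: eq_fsbigr => la _.
  by rewrite starZ cmulZl cmulZr scalerA u scale1r.
Qed.

(** When [x] is the only boundary path with range [w], the projection of [w]
    acts on [l2] as the rank one projection onto [delta x], so that compression
    to [delta x] is multiplicative on the corner at [w]. *)
Lemma kga_character (A : cstarAlgType C) (s : L -> A) (w : kobj L) (z : 'I_k -> C) :
  is_kgraph_algebra s -> (forall i, `|z i| = 1) ->
  (forall x y, brng x = w -> brng y = w -> x = y) ->
  exists chi : A -> C, [/\ (forall a b, chi (a + b) = chi a + chi b),
    (forall (c : C) a, chi (c *: a) = c * chi a),
    (forall a b, s (kid w) ** b = b -> chi (a ** b) = chi a * chi b),
    (forall a, chi (star a) = (chi a)^*) &
    forall ta ta', krng ta = w -> krng ta' = w -> ksrc ta = ksrc ta' ->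
      chi (s ta ** star (s ta')) = zpow z (kdeg ta) * (zpow z (kdeg ta'))^*].
Proof.
move=> sU z1 wuniq.
have [phi [phiD phiZ phiM phiS] phis] := kga_universal sU (gauge_ck z1 brep_ck).
have [x xw] := bpath_exists lconv w.
exists (fun a => phi a (delta R x) x); split.
- by move=> a b; rewrite phiD.
- by move=> c a; rewrite phiZ.
- move=> a b wb; rewrite phiM bop_cmulE.
  (* As [b = s_w b], the vector [phi b (delta x)] is supported on boundary paths of range [w], that
     is, on [x] alone. *)
  have -> : phi b (delta R x) = phi b (delta R x) x *: delta R x.
    apply: ell2P => y; rewrite -wb phiM phis kdeg_id zpow0 scale1r.
    rewrite ell2Z deltaE !bop_cmulE !brep_idE.
    rewrite xw eqxx; case: eqP => [/esym yw|yw].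
      by rewrite (wuniq _ _ yw xw) eqxx mulr1.
    by case: eqP yw => [->|_]; rewrite ?xw// mulr0.
  by rewrite bopZ !ell2Z deltaE eqxx mulr1 mulrC.
- move=> a; rewrite phiS -[LHS]ip_delta bop_starE bop_adjP'.
  by rewrite -ip_conj ip_delta.
- move=> ta ta' rt rt' st; have [y ys] := bpath_exists lconv (ksrc ta).
  have y1 : bfun ta y = Some x.
    by apply/bfunP; split=> //; apply: wuniq => //; rewrite brng_cons.
  have y2 : bfun ta' y = Some x.
    by apply/bfunP; rewrite -st; split=> //; apply: wuniq => //; rewrite brng_cons -?st.
  rewrite phiM phiS !phis starZ cmulZl cmulZr scalerA.
  rewrite bop_scaleE ell2Z -[RHS]mulr1; congr (_ * _).
  rewrite bop_cmulE pbopE; move/bfun_pinverse: y1 => ->.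
  by rewrite [LHS]/(oapp (delta R x) 0 (bfun ta' y)) y2 /= eqxx.
Qed.

End BoundaryPathRepresentation.

(** * Cuntz-Krieger families without infinite projections *)

Section CuntzKriegerFamilies.
Variables (R : realType) (k : nat) (L : kgraph k) (A : cstarAlgType R[i]) (s : L -> A).
Hypotheses (rfin : kgraph_row_finite L) (ck : is_ck_family s).
Local Notation C := (R[i]%type).
Implicit Types (n m : {ffun 'I_k -> nat}) (v w : kobj L) (la mu nu ta : L).

Lemma ck_src la : s la ** s (kid (ksrc la)) = s la.
Proof. by rewrite (ck_comp ck) ?kcomp_idr// krng_id. Qed.
Lemma ck_rng la : s (kid (krng la)) ** s la = s la.
Proof. by rewrite (ck_comp ck) ?kcomp_idl// ksrc_id. Qed.
Lemma ck_vv v : s (kid v) ** s (kid v) = s (kid v).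
Proof. by have [] := ck_proj ck v. Qed.
Lemma ck_vstar v : star (s (kid v)) = s (kid v).
Proof. by have [] := ck_proj ck v. Qed.

Definition rproj la : A := s la ** star (s la).

Lemma rproj_s la : rproj la ** s la = s la.
Proof. by rewrite /rproj -cmulA (ck_star ck) ck_src. Qed.

Lemma rproj_proj la : is_projection (rproj la).
Proof.
split; last by rewrite /rproj starM starK.
by rewrite {2}/rproj cmulA rproj_s.
Qed.

Lemma rng_rproj la : s (kid (krng la)) ** rproj la = rproj la.
Proof. by rewrite /rproj cmulA ck_rng. Qed.

Lemma rproj_rng la : rproj la ** s (kid (krng la)) = rproj la.
Proof.
by apply: starI; rewrite starM ck_vstar (rproj_proj la).2 rng_rproj.
Qed.

Lemma ck_mul0 mu nu : ksrc mu <> krng nu -> s mu ** s nu = 0.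
Proof.
move=> /eqP c; rewrite -(ck_src mu) -(ck_rng nu) -cmulA (cmulA (s (kid _))).
by rewrite (ck_orth ck c) cmul0l cmul0r.
Qed.

Lemma ck_star_mul0 mu nu : krng mu <> krng nu -> star (s mu) ** s nu = 0.
Proof.
move=> /eqP c; rewrite -(ck_rng mu) -(ck_rng nu) starM ck_vstar -cmulA.
by rewrite (cmulA (s (kid _))) (ck_orth ck c) cmul0l cmul0r.
Qed.

(** The relation at the common range says that the range projections of [v Lambda^{<= n}] add up to
    a projection, which forces them to be orthogonal; different ranges are separated by the vertex
    projections. *)
Lemma ck_orth_le n la mu : kpaths_le n la -> kpaths_le n mu -> la != mu ->
  star (s la) ** s mu = 0.
Proof.
move=> lle mle lm; have [r|r] := pselect (krng la = krng mu); last exact: ck_star_mul0.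
set K := krange (krng mu) (kpaths_le (L := L) n).
have Kfin : finite_set K by exact: kle_finite.
pose F := fset_set K.
have inF x : K x -> x \in F by move=> Kx; rewrite in_fset_set//; exact/mem_set.
have lF : la \in F by apply: inF.
have mF : mu \in F by apply: inF.
have sE : s (kid (krng mu)) = \sum_(i : F) rproj (val i).
  by rewrite (ck_sum ck _ n) fsbig_finite//= big_seq_fsetE.
have := @sum_proj_orth R A F xpredT (fun i => rproj (val i)) (s (kid (krng mu)))
  (fun i _ => rproj_proj (val i)) _ sE [` lF]%fset [` mF]%fset isT isT lm.
have rngF (i : F) : true -> s (kid (krng mu)) ** rproj (val i) = rproj (val i).
  move=> _; have := fsvalP i; rewrite in_fset_set// => /set_mem[_ <-].
  exact: rng_rproj.
move=> /(_ rngF) /= o.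
rewrite -(rproj_s mu) -[s la](rproj_s la) starM (rproj_proj la).2 -cmulA.
by rewrite (cmulA (rproj la)) o cmul0l cmul0r.
Qed.

(** In a nonzero family this expresses that [la] has no entrance: it is the only path of its range
    in any [Lambda^{<= n}] that contains it ([full_unique]). *)
Definition full la : Prop := rproj la = s (kid (krng la)).

(** The range projection of the composite lies below that of [mu], which lies below the projection
    of [r(mu)]. *)
Lemma full_prefix mu nu : ksrc mu = krng nu -> full (kcomp mu nu) -> full mu.
Proof.
move=> c f; rewrite /full -[LHS]rproj_rng; have := f; rewrite /full krng_comp// => <-.
by rewrite {2}/rproj cmulA -(ck_comp ck c) cmulA rproj_s /rproj -(ck_comp ck c).
Qed.

Hypothesis s0 : forall v, s (kid v) != 0.

Lemma ck_neq0 la : s la != 0.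
Proof.
apply/eqP => l0; have := s0 (ksrc la).
by rewrite -(ck_star ck) l0 cmul0r eqxx.
Qed.

(** A second path would have its range orthogonal to the whole vertex projection, contradicting
    [s_nu != 0]. *)
Lemma full_unique n mu nu : full mu -> kpaths_le n mu -> kpaths_le n nu ->
  krng nu = krng mu -> nu = mu.
Proof.
move=> f mle nle r; apply: contrapT => /eqP nm; have := ck_neq0 nu.
rewrite -[s nu]ck_rng r -f /rproj -cmulA (ck_orth_le mle nle) 1?eq_sym//.
by rewrite cmul0r eqxx.
Qed.

Hypothesis noinf : ~ (exists p : A, is_infinite_projection p).

(** The range projection of a cycle is equivalent to the projection of its
    base vertex, hence equal to it. *)
Lemma cycle_full mu : ksrc mu = krng mu -> full mu.
Proof.
move=> c; apply: contrapT => /eqP nf; apply: noinf; exists (s (kid (krng mu))).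
split; first exact: ck_proj.
by exists (s mu); split; rewrite ?(ck_star ck) ?c//; [exact: rproj_proj|exact: rng_rproj].
Qed.

Definition terminal w : Prop := forall ta, krng ta = w -> full ta.

(** Conjugation by [s ta] carries the range projection of the composite of [ta] and [nu] to that of
    [nu], and the projection of [r(ta)] to that of [s(ta)]. *)
Lemma terminal_src ta : terminal (krng ta) -> terminal (ksrc ta).
Proof.
move=> T nu /esym c; have f := T (kcomp ta nu) (krng_comp c).
have ft := T ta erefl; rewrite /full -c.
have : star (s ta) ** rproj (kcomp ta nu) ** s ta = star (s ta) ** s (kid (krng ta)) ** s ta.
  by rewrite f krng_comp.
rewrite -[in RHS]cmulA ck_rng (ck_star ck) => <-.
rewrite /rproj -(ck_comp ck c) starM !cmulA (ck_star ck) c ck_rng -!cmulA.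
by rewrite (ck_star ck) c -{2}(ck_rng nu) starM ck_vstar.
Qed.

Fixpoint cpow mu j : L := if j is j'.+1 then kcomp mu (cpow mu j') else kid (krng mu).

Lemma cpowP mu j : ksrc mu = krng mu -> [/\ krng (cpow mu j) = krng mu,
  ksrc (cpow mu j) = krng mu & forall i, kdeg (cpow mu j) i = (j * kdeg mu i)%N].
Proof.
move=> c; elim: j => [|j [r e d]] /=.
  by split=> [||i]; rewrite ?krng_id ?ksrc_id ?kdeg_id ?nzeroE.
by split=> [||i]; rewrite ?krng_comp ?ksrc_comp ?kdegE ?d ?r.
Qed.

(** Composing powers of the given cycles yields a cycle [c] at [w] of degree at least that of [ta].
    As [c] is full, a prolongation of [ta] in [Lambda^{<= d(c)}] equals [c], and initial segments of
    full paths are full. *)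
Lemma terminal_of_cycles w :
  (forall i, has_edge w i -> exists nu, [/\ krng nu = w, ksrc nu = w & (0 < kdeg nu i)%N]) ->
  terminal w.
Proof.
move=> cyc ta rta.
have [c [rc sc dc]] : exists c, [/\ krng c = w, ksrc c = w &
    forall i, i \in enum 'I_k -> (kdeg ta i <= kdeg c i)%N].
  elim: (enum 'I_k) => [|i r [c [rc sc dc]]].
    by exists (kid w); rewrite krng_id ksrc_id.
  have [ti|/cyc[nu [rn sn dn]]] : kdeg ta i = 0%N \/ has_edge w i.
    by case: (posnP (kdeg ta i)) => [->|/kdeg_has_edge]; [left|rewrite rta; right].
    exists c; split=> // j; rewrite inE => /predU1P[->|/dc//].
    by rewrite ti.
  have cn : ksrc nu = krng nu by rewrite sn rn.
  have [r' s' d'] := cpowP (kdeg ta i) cn.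
  have cc : ksrc (cpow nu (kdeg ta i)) = krng c by rewrite s' rn rc.
  exists (kcomp (cpow nu (kdeg ta i)) c).
  rewrite krng_comp// ksrc_comp//; split=> // [|j]; first by rewrite r'.
  rewrite kdegE// d' inE => /predU1P[->|/dc]; last by lia.
  by rewrite (leq_trans _ (leq_addr _ _))// leq_pmulr.
have [ga cg le] := kle_extend (n := kdeg c) (la := ta) (fun i => dc i (mem_enum _ i)).
have cf : full c by apply: cycle_full; rewrite sc.
have := full_unique cf (kle_deg c) le; rewrite krng_comp// rta rc => /(_ erefl) E.
by apply: (full_prefix cg); rewrite E.
Qed.

Definition emul (i : 'I_k) (j : nat) : {ffun 'I_k -> nat} := [ffun l => if l == i then j else 0%N].
Lemma emulE i j l : emul i j l = if l == i then j else 0%N. Proof. exact: ffunE. Qed.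

Hypothesis fin : finite_set (kpaths L 0).

(** Pigeonhole: [la] passes through a cycle of degree a multiple of [e_i]; that
    cycle has no entrance, so the rest of [la] stays on it. *)
Lemma long_path_cycle la i : kdeg la i = #|` fset_set (kpaths L 0)| ->
  exists nu, [/\ krng nu = ksrc la, ksrc nu = ksrc la & (0 < kdeg nu i)%N].
Proof.
set F := fset_set _; set N := #|` F| => dN.
(* The cut makes [b] the final segment of [la], of degree [N e_i]: what follows the cycle inside [b]
   ends at the source of [la]. *)
pose n0 : {ffun 'I_k -> nat} := [ffun l => if l == i then 0%N else kdeg la l].
pose b := kdrop n0 la.
have db : kdeg b = emul i N.
  apply/degP => l; have := kdegE l (ksrc_take n0 la).
  rewrite ktakeK kdeg_take nminE ffunE emulE.
  by have [->|_] := eqVneq l i; rewrite ?dN -/b; lia.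
pose c j := ktake (emul i j) b.
have dc j l : kdeg (c j) l = if l == i then minn j N else 0%N.
  by rewrite /c kdeg_take nminE db !emulE; case: ifP => //; rewrite minnn.
have vF j : kid (ksrc (c j)) \in F by rewrite in_fset_set//; apply/mem_set; exact: kdeg_id.
pose f (j : 'I_N.+1) : F := [` vF j]%fset.
have [j [j' [lt jN vE]]] : exists j j', [/\ (j < j')%N, (j' <= N)%N & ksrc (c j) = ksrc (c j')].
  have : ~~ injectiveb f.
    apply/negP => /injectiveP/leq_card; rewrite card_ord -cardfE -/N.
    by rewrite ltnn.
  move=> /injectivePn[x [y xy /(congr1 val)/= fxy]].
  have E : ksrc (c x) = ksrc (c y) by rewrite -(krng_id (ksrc (c x))) fxy krng_id.
  have := ltn_ord x; have := ltn_ord y; rewrite !ltnS => yN xN.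
  case: (ltngtP x y) => [lt|lt|/val_inj E']; [by exists x, y|by exists y, x|].
  by rewrite E' eqxx in xy.
have cE : ktake (emul i j) (c j') = c j.
  by apply: ktake_take => l; rewrite !emulE; case: ifP => // _; lia.
pose mu := kdrop (emul i j) (c j').
have cmu : ksrc (c j) = krng mu by rewrite -cE ksrc_take.
have dmu : kdeg mu i = (j' - j)%N.
  have := kdegE i (ksrc_take (emul i j) (c j')).
  by rewrite ktakeK cE !dc eqxx -/mu; lia.
have dmu0 l : l != i -> kdeg mu l = 0%N.
  move=> li; have := kdegE l (ksrc_take (emul i j) (c j')).
  by rewrite ktakeK cE !dc (negbTE li) -/mu; lia.
have smu : ksrc mu = krng mu by rewrite -cmu vE ksrc_drop.
pose be := kdrop (emul i j') b.
have rbe : krng be = krng mu by rewrite -smu ksrc_drop -ksrc_take.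
have sbe : ksrc be = ksrc la by rewrite !ksrc_drop.
have dbe l : kdeg be l = if l == i then (N - j')%N else 0%N.
  have := kdegE l (ksrc_take (emul i j') b); rewrite ktakeK -/(c j') -/be dc db emulE.
  by case: ifP => _; lia.
(* The extra turn keeps the degree positive even when [be] is a vertex. This power dominates [be]
   and, being a cycle, is full, so it equals [be ga]; the rotation [ga be] is a cycle at the source
   of [la]. *)
have [rp sp dp] := cpowP (N - j').+1 smu.
have le l : (kdeg be l <= kdeg (cpow mu (N - j').+1) l)%N.
  rewrite dp dbe; case: eqP => // ->; rewrite dmu.
  by rewrite (leq_trans (leqnSn _))// leq_pmulr// subn_gt0.
have [ga cg lega] := kle_extend le.
have E : kcomp be ga = cpow mu (N - j').+1.
  apply: (full_unique _ (kle_deg _) lega); last by rewrite krng_comp// rbe rp.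
  by apply: cycle_full; rewrite rp sp.
have sga : ksrc ga = krng be by rewrite -(ksrc_comp cg) E sp rbe.
exists (kcomp ga be); rewrite krng_comp// ksrc_comp// -cg sbe; split=> //.
have := kdegE i cg; rewrite E dp dmu kdegE// addnC => <-.
by rewrite muln_gt0 subn_gt0.
Qed.

(** In a direction where the source of [la] still has an edge, [la] has used its whole allowance,
    the number of vertices; the pigeonhole cycle is then available. *)
Lemma terminal_long la : kpaths_le (nconst k #|` fset_set (kpaths L 0)|) la ->
  terminal (ksrc la).
Proof.
move=> /kleP[d no]; apply: terminal_of_cycles => i E; apply: long_path_cycle.
apply/eqP; rewrite eqn_leq; have := d i; rewrite ffunE => -> /=.
by rewrite leqNgt; apply/negP => lt; apply: (no i) => //; rewrite ffunE.
Qed.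

End CuntzKriegerFamilies.

(** * Corners between terminal vertices *)

Section TerminalCorners.
Variables (R : realType) (k : nat) (L : kgraph k) (A : cstarAlgType R[i]) (s : L -> A).
Hypotheses (rfin : kgraph_row_finite L) (ck : is_ck_family s).
Hypothesis s0 : forall v, s (kid v) != 0.
Local Notation C := (R[i]%type).
Implicit Types (n m : {ffun 'I_k -> nat}) (v w : kobj L) (la mu nu ta : L).
Local Notation terminal := (terminal s).

Definition nmax n m : {ffun 'I_k -> nat} := [ffun i => maxn (n i) (m i)].

Lemma common_extension al be : exists n, exists ta ta', [/\ ksrc al = krng ta,
  ksrc be = krng ta', kpaths_le n (kcomp al ta) & kpaths_le n (kcomp be ta')].
Proof.
pose n := nmax (kdeg al) (kdeg be); exists n.
have [ta c le] : exists2 ga, ksrc al = krng ga & kpaths_le n (kcomp al ga).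
  by apply: kle_extend => i; rewrite ffunE leq_maxl.
have [ta' c' le'] : exists2 ga, ksrc be = krng ga & kpaths_le n (kcomp be ga).
  by apply: kle_extend => i; rewrite ffunE leq_maxr.
by exists ta, ta'.
Qed.

(** Each [Lambda^{<= n}] contains only one path whose range is a given terminal vertex, so
    prolongations into a common one coincide. *)
Lemma terminal_extension ta ta' : terminal (krng ta) -> krng ta' = krng ta ->
  exists si si', [/\ ksrc ta = krng si, ksrc ta' = krng si' & kcomp ta si = kcomp ta' si'].
Proof.
move=> T r; have [n [si [si' [c c' le le']]]] := common_extension ta ta'.
exists si, si'; split=> //; apply: (full_unique rfin ck s0 _ le' le).
  by apply: T; rewrite krng_comp.
by rewrite !krng_comp.
Qed.

Definition corner_gen w w' : set A := [set a | exists ta ta',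
  [/\ krng ta = w, krng ta' = w', ksrc ta = ksrc ta' & a = s ta ** star (s ta')]].
Definition corner w w' : set A := cspan (corner_gen w w').

(** Prolonging [al] and [be] into a common [Lambda^{<= n}] loses nothing, as the added paths [ta]
    and [ta'] have full range. There distinct paths have orthogonal ranges, so only the case of
    equality survives, and it leaves [s_ta' s_ta^*]. *)
Lemma star_mul_terminal al be : terminal (ksrc al) -> terminal (ksrc be) ->
  star (s be) ** s al = 0 \/ corner_gen (ksrc be) (ksrc al) (star (s be) ** s al).
Proof.
move=> Ta Tb; have [n [ta [ta' [c c' le le']]]] := common_extension al be.
have al_ta : s al = s (kcomp al ta) ** star (s ta).
  have f : full s ta by apply: Ta.
  by rewrite -(ck_comp ck c) -cmulA -/(rproj s ta) f -c (ck_src ck).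
have be_ta : s be = s (kcomp be ta') ** star (s ta').
  have f : full s ta' by apply: Tb.
  by rewrite -(ck_comp ck c') -cmulA -/(rproj s ta') f -c' (ck_src ck).
rewrite be_ta al_ta starM starK -cmulA (cmulA (star (s (kcomp be ta')))).
have [E|ne] := eqVneq (kcomp be ta') (kcomp al ta); last first.
  by left; rewrite (ck_orth_le rfin ck le' le ne) cmul0l cmul0r.
have sE : ksrc ta' = ksrc ta by rewrite -(ksrc_comp c') E ksrc_comp.
right; exists ta', ta; split=> //; rewrite E (ck_star ck) ksrc_comp//.
by rewrite cmulA -sE (ck_src ck).
Qed.

Lemma corner_genM w w' w'' : terminal w'' -> forall x y,
  corner_gen w w'' x -> corner_gen w'' w' y -> corner w w' (x ** y).
Proof.
move=> T x y [t1 [t1' [r1 r1' s1 ->]]] [t2 [t2' [r2 r2' s2 ->]]].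
have [S0 SD SZ] := cspan_subspace (corner_gen w w').
have -> : s t1 ** star (s t1') ** (s t2 ** star (s t2')) =
    s t1 ** (star (s t1') ** s t2) ** star (s t2') by rewrite !cmulA.
have [||->|[ta [ta' [ra ra' sa ->]]]] := @star_mul_terminal t2 t1'.
- by apply: terminal_src => //; rewrite r2.
- by apply: terminal_src => //; rewrite r1'.
- by rewrite cmul0r cmul0l.
apply: cspan_gen; exists (kcomp t1 ta), (kcomp t2' ta').
have c1 : ksrc t1 = krng ta by rewrite s1.
have c2 : ksrc t2' = krng ta' by rewrite -s2.
split; rewrite ?krng_comp ?ksrc_comp//.
by rewrite -(ck_comp ck c1) -(ck_comp ck c2) starM !cmulA.
Qed.

Lemma cornerM w w' w'' : terminal w'' -> forall x y,
  corner w w'' x -> corner w'' w' y -> corner w w' (x ** y).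
Proof.
move=> T; apply: cspanM; [exact: cspan_closed|exact: cspan_subspace|exact: corner_genM].
Qed.

Lemma corner_star w w' x : corner w w' x -> corner w' w (star x).
Proof.
apply: cspan_star; [exact: cspan_closed|exact: cspan_subspace|].
move=> {}x [ta [ta' [r r' e ->]]]; apply: cspan_gen; exists ta', ta; split=> //.
by rewrite starM starK.
Qed.

Lemma cornerE w w' x : corner w w' x -> s (kid w) ** x = x /\ x ** s (kid w') = x.
Proof.
have cl1 := closed_fixpoints (@cmull_continuous _ A (s (kid w))).
have cl2 := closed_fixpoints (@cmulr_continuous _ A (s (kid w'))).
move=> xE; split.
  apply: (cspan_sub cl1 _ _ xE); first split=> /= [|y z Ey Ez|c y Ey].
  - by rewrite cmul0r.
  - by rewrite cmulDr Ey Ez.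
  - by rewrite cmulZr Ey.
  by move=> _ [ta [ta' [<- _ _ ->]]] /=; rewrite cmulA (ck_rng ck).
apply: (cspan_sub cl2 _ _ xE); first split=> /= [|y z Ey Ez|c y Ey].
- by rewrite cmul0l.
- by rewrite cmulDl Ey Ez.
- by rewrite cmulZl Ey.
move=> _ [ta [ta' [_ <- _ ->]]] /=; rewrite -cmulA; congr (_ ** _).
by apply: starI; rewrite starM !starK (ck_vstar ck) (ck_rng ck).
Qed.

Variable F : seq L.
Hypothesis Fterm : forall la, la \in F -> terminal (ksrc la).
Hypothesis Fsum : forall v, s (kid v) = \sum_(la <- F | krng la == v) rproj s la.
Hypothesis sgen : generates (range s).

(** By [Fsum] this is the sum of all vertex projections, the unit of [A], cut into ranges of paths
    that end at terminal vertices. *)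
Let one : A := \sum_(la <- F) rproj s la.

Lemma one_l a : one ** a = a.
Proof.
have os : star one = one.
  by rewrite star_sum; apply: eq_bigr => la _; exact: (rproj_proj ck la).2.
have om mu : one ** s mu = s mu.
  rewrite cmul_suml -[RHS](ck_rng ck) Fsum cmul_suml [RHS]big_mkcond.
  apply: eq_bigr => la _; case: eqP => // ne.
  by rewrite /rproj -cmulA (ck_star_mul0 ck ne) cmul0r.
have mo mu : s mu ** one = s mu.
  rewrite cmul_sumr -[RHS](ck_src ck) Fsum cmul_sumr [RHS]big_mkcond.
  apply: eq_bigr => la _; case: eqP => // ne.
  by rewrite /rproj cmulA (ck_mul0 ck) ?cmul0l// => E; apply: ne.
pose S := [set x : A | one ** x = x] `&` [set x : A | x ** one = x].
suff: S a by case.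
have -> : S = setT; last by [].
apply: sgen; last by move=> _ [mu _ <-]; split=> /=.
split.
- apply: closedI; apply: closed_fixpoints; [exact: cmull_continuous|exact: cmulr_continuous].
- split=> [|x y [/= x1 x2] [/= y1 y2]|c x [/= x1 x2]]; split=> /=.
  + by rewrite cmul0r.
  + by rewrite cmul0l.
  + by rewrite cmulDr x1 y1.
  + by rewrite cmulDl x2 y2.
  + by rewrite cmulZr x1.
  + by rewrite cmulZl x2.
- by move=> x y [/= x1 x2] [/= y1 y2]; split=> /=; rewrite ?cmulA ?x1// -cmulA y2.
- by move=> x [/= x1 x2]; split=> /=; apply: starI; rewrite starM starK os ?x1 ?x2.
Qed.

(** For one fixed pair of paths the set of good [a] is not visibly stable under products. Taken over
    all pairs with terminal sources it is a C*-subalgebra: the two factors are separated by the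
    unit, a sum of [s_rho s_rho^*] with [s(rho)] terminal. *)
Lemma corner_compress a la mu : terminal (ksrc la) -> terminal (ksrc mu) ->
  corner (ksrc la) (ksrc mu) (star (s la) ** a ** s mu).
Proof.
move=> Tl Tm; pose P (p : L * L) := terminal (ksrc p.1) /\ terminal (ksrc p.2).
pose S := \bigcap_(p in P) ((fun x => star (s p.1) ** x ** s p.2) @^-1` corner (ksrc p.1) (ksrc p.2)).
suff: S a by move=> /(_ (la, mu)) /=; apply; split.
have -> : S = setT; last by [].
apply: sgen.
- split.
  + apply: closed_bigI => p _; apply: closed_preimage_cont; last exact: cspan_closed.
    move=> x; apply: (@continuous_comp _ _ _ (cmul (star (s p.1))) (fun y => y ** s p.2)).
      exact: cmull_continuous.
    exact: cmulr_continuous.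
  + split=> [p _|x y Sx Sy p Pp|c x Sx p Pp] /=; have [C0 CD CZ] := cspan_subspace (corner_gen (ksrc p.1) (ksrc p.2)).
    * by rewrite cmul0r cmul0l.
    * by rewrite cmulDr cmulDl; apply: CD; [exact: Sx|exact: Sy].
    * by rewrite cmulZr cmulZl; apply: CZ; exact: Sx.
  + move=> x y Sx Sy [p q] [/= Tp Tq].
    have [C0 CD CZ] := cspan_subspace (corner_gen (ksrc p) (ksrc q)).
    have -> : x ** y = \sum_(rho <- F) x ** rproj s rho ** y.
      by rewrite -{1}(one_l y) cmulA /one cmul_sumr cmul_suml.
    rewrite /= cmul_sumr cmul_suml big_seq; elim/big_ind: _ => // rho rF.
    have -> : star (s p) ** (x ** rproj s rho ** y) ** s q =
        (star (s p) ** x ** s rho) ** (star (s rho) ** y ** s q) by rewrite /rproj !cmulA.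
    apply: (cornerM (Fterm rF)).
      exact: (Sx (p, rho) (conj Tp (Fterm rF))).
    exact: (Sy (rho, q) (conj (Fterm rF) Tq)).
  + move=> x Sx [p q] [/= Tp Tq].
    have -> : star (s p) ** star x ** s q = star (star (s q) ** x ** s p).
      by rewrite !starM starK cmulA.
    exact/corner_star/(Sx (q, p) (conj Tq Tp)).
move=> _ [nu _ <-] [p q] [/= Tp Tq].
have [C0 CD CZ] := cspan_subspace (corner_gen (ksrc p) (ksrc q)).
rewrite -cmulA; have [c|nc] := pselect (ksrc nu = krng q); last first.
  by rewrite (ck_mul0 ck nc) cmul0r.
rewrite (ck_comp ck c); have sE := ksrc_comp c.
have [||->//|] := @star_mul_terminal (kcomp nu q) p; rewrite ?sE//.
exact: cspan_gen.
Qed.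

Lemma corner_full w w' a : terminal w -> terminal w' ->
  corner w w' (s (kid w) ** a ** s (kid w')).
Proof.
move=> Tw Tw'; have := @corner_compress a (kid w) (kid w').
by rewrite !ksrc_id (ck_vstar ck); apply.
Qed.

End TerminalCorners.

(** * Fourier analysis of graded commutative algebras *)

Section MultiplicativeFunctionals.
Variables (R : realType) (A : cstarAlgType R[i]).
Local Notation C := (R[i]%type).

(** A functional with [chi b = 1] and [|b| < 1] would satisfy
    [chi S = 1 + chi S] on the Neumann series [S = b + b S]. *)
Lemma functional_norm_le (E : set A) (chi : A -> C) :
  closed E -> is_subspace E -> (forall a b, E a -> E b -> E (a ** b)) ->
  (forall a b, chi (a + b) = chi a + chi b) -> (forall (c : C) a, chi (c *: a) = c * chi a) ->
  (forall a b, E a -> E b -> chi (a ** b) = chi a * chi b) ->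
  forall a, E a -> `|chi a| <= `|a|.
Proof.
move=> clE [E0 ED EZ] EM chiD chiZ chiM a Ea.
rewrite real_leNgt ?normr_real//; apply/negP => lt.
have ca0 : chi a != 0 by rewrite -normr_gt0 (le_lt_trans _ lt).
pose b := (chi a)^-1 *: a; have Eb : E b by exact: EZ.
have chib : chi b = 1 by rewrite chiZ mulVf.
have b1 : `|b| < 1 by rewrite normrZ normfV ltr_pdivrMl ?normr_gt0// mulr1.
pose S n := iter n (fun x => b + b ** x) 0.
have ES n : E (S n) by elim: n => //= n IH; apply: ED => //; exact: EM.
have Sdiff n : `|S n.+1 - S n| <= `|b| ^+ n.
  elim: n => [|n IH]; last first.
    have -> : S n.+2 - S n.+1 = b ** (S n.+1 - S n).
      by rewrite cmulBr {1}/S iterS -/(S _) [X in _ - X]/S iterS -/(S _) opprD addrACA subrr add0r.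
    by rewrite (le_trans (cnormM _ _))// exprS ler_wpM2l.
  by rewrite /S /= cmul0r addr0 subr0 expr0 ltW.
have r1 : 0 < 1 - `|b| by rewrite subr_gt0.
have Stail n m : `|S (n + m)%N - S n| * (1 - `|b|) <= `|b| ^+ n.
  suff : `|S (n + m)%N - S n| * (1 - `|b|) <= `|b| ^+ n - `|b| ^+ (n + m).
    by move=> /le_trans; apply; rewrite gerBl exprn_ge0.
  elim: m => [|m IH]; first by rewrite addn0 !subrr normr0 mul0r.
  rewrite addnS -(subrKA (S (n + m)%N)).
  have := lerD (ler_wpM2r (ltW r1) (Sdiff (n + m)%N)) IH.
  rewrite -mulrDl => h; apply: le_trans (le_trans h _).
    by rewrite ler_wpM2r ?(ltW r1)// ler_normD.
  by rewrite exprS mulrBr mulr1 [X in _ - X]mulrC addrC addrA subrK.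
have bpow (e : C) : 0 < e -> exists n, `|b| ^+ n < e.
  move=> /gt0_complex[r r0 ->]; have : (fun n => complex.Re `|b| ^+ n) @ \oo --> (0 : R).
    apply: cvg_expr; rewrite ger0_norm ?cRe_norm_ge0//.
    by rewrite -ltcR -norm_cReE.
  move=> /(@cvgrPdist_lt R R^o)/(_ _ r0)[N _ /(_ N (leqnn N))].
  rewrite /= sub0r normrN ger0_norm ?exprn_ge0 ?cRe_norm_ge0// => h.
  by exists N; rewrite norm_cReE -rmorphXn ltcR.
have /cvg_ex[l Sl] : cvg (S @ \oo).
  apply: cauchy_cvg; apply: cauchy_exP => e e0.
  have [n bn] := bpow (e * (1 - `|b|)) (mulr_gt0 e0 r1).
  exists (S n); exists n => // m /= nm; rewrite -ball_normE /= distrC.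
  by rewrite -(ltr_pM2r r1) (le_lt_trans _ bn)// -(subnKC nm).
have El : E l by apply: (closed_cvg _ clE _ _ Sl); apply: nearW => n; exact: ES.
have lE : l = b + b ** l.
  have Sl' : (fun n => b + b ** S n) @ \oo --> b + b ** l.
    apply: cvgD; first exact: cvg_cst.
    by apply: (cvg_comp _ _ Sl); exact: cmull_continuous.
  have Sl'' : (fun n => S n.+1) @ \oo --> l by move: Sl; rewrite -(cvg_shiftS S).
  exact: (cvg_unique (@norm_hausdorff C A) Sl'' Sl').
have := congr1 (fun t => chi t - chi l) lE; rewrite chiD chiM// chib mul1r subrr addrK.
by move/eqP; rewrite eq_sym oner_eq0.
Qed.

End MultiplicativeFunctionals.

(** * Exponential against polynomial growth *)

Section PowerTrick.
Variable R : realType.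

Lemma bernoulli (d : R) n : 0 <= d -> 1 + n%:R * d <= (1 + d) ^+ n.
Proof.
move=> d0; elim: n => [|n IH]; first by rewrite mul0r addr0 expr0.
rewrite exprS; apply: le_trans (ler_wpM2l (addr_ge0 ler01 d0) IH).
have -> : (1 + d) * (1 + n%:R * d) = 1 + n.+1%:R * d + n%:R * (d * d).
  by rewrite -natr1; ring.
by rewrite lerDl !mulr_ge0.
Qed.

Lemma pow_le_pow2 (t : R) k : 0 <= t -> t ^+ k.+1 <= (1 + t) ^+ (2 ^ k).
Proof.
move=> t0; have t1 : 1 <= 1 + t by rewrite lerDl.
apply: (@le_trans _ _ ((1 + t) ^+ k.+1)); last by rewrite ler_weXn2l// ltn_expl.
apply: lerXn2r; rewrite ?nnegrE//; first exact: le_trans t1.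
by rewrite lerDr.
Qed.

(** With [d = x/y - 1 > 0], Bernoulli and [k] further squarings give
    [(1 + d)^(2^(m+k)) >= (2^m d)^(k+1)], one power of [2^m] more than the polynomial factor
    allows. *)
Lemma power_trick (x y : R) (D k : nat) : 0 <= y ->
  (forall m, x ^+ (2 ^ m) <= ((D * 2 ^ m + 1) ^ k)%:R * y ^+ (2 ^ m)) -> x <= y.
Proof.
move=> y0 h; rewrite leNgt; apply/negP => yx.
have [y00|yn0] := eqVneq y 0.
  by have := h 0%N; rewrite y00 expn0 !expr1 mulr0 leNgt -y00 yx.
have yp : 0 < y by rewrite lt_def yn0.
pose d := x / y - 1; have d0 : 0 < d by rewrite subr_gt0 ltr_pdivlMr// mul1r.
have qE : x / y = 1 + d by rewrite /d addrC subrK.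
have h1 m : (1 + d) ^+ (2 ^ m) <= ((D * 2 ^ m + 1) ^ k)%:R.
  by rewrite -qE expr_div_n ler_pdivrMr ?exprn_gt0.
(* What remains of the polynomial factor at level [m + k] once [(2^m)^k] is split off, by
   [D 2^(m+k) + 1 <= (D 2^k + 1) 2^m]. *)
pose K := ((D * 2 ^ k + 1) ^ k)%N.
have h2 m : d ^+ k.+1 * (2 ^ m)%:R <= K%:R.
  have t0 : (0 : R) < (2 ^ m)%:R by rewrite ltr0n expn_gt0.
  have td : 0 <= (2 ^ m)%:R * d by rewrite mulr_ge0// ltW.
  have : ((2 ^ m)%:R * d) ^+ k.+1 <= K%:R * (2 ^ m)%:R ^+ k.
    apply: (@le_trans _ _ ((1 + d) ^+ (2 ^ (m + k)))); last first.
      apply: (le_trans (h1 _)); rewrite -natrX -natrM ler_nat /K -expnMn.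
      have [->|k0] := posnP k; first by rewrite !expn0.
      rewrite leq_exp2r// mulnDl mul1n expnD mulnA mulnAC leq_add2l.
      by rewrite expn_gt0.
    apply: (le_trans (pow_le_pow2 k td)); rewrite expnD exprM.
    have d1 : 0 <= 1 + d by rewrite addr_ge0// ltW.
    have := bernoulli (2 ^ m) (ltW d0); set p := (1 + d) ^+ (2 ^ m) => le.
    apply: lerXn2r => //; rewrite nnegrE; first by rewrite addr_ge0.
    exact: exprn_ge0.
  rewrite exprMn exprS -mulrA [(2 ^ m)%:R ^+ k * _]mulrC mulrA ler_pM2r ?exprn_gt0//.
  by rewrite mulrC.
have dk : 0 < d ^+ k.+1 by exact: exprn_gt0.
have := h2 (Num.trunc (K%:R / d ^+ k.+1)).+1.
rewrite leNgt -ltr_pdivrMl// mulrC => /negP; apply.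
apply: lt_trans (truncnS_gt _) _; rewrite ltr_nat; exact: ltn_expl.
Qed.

End PowerTrick.

(** * Fourier coefficients of polynomials on the torus *)

Section FourierCoefficients.
Variables (R : realType) (k n : nat).
Local Notation C := (R[i]%type).

Definition unitary_point (z : 'I_k -> C) := forall i, `|z i| = 1.

(** Finite Fourier inversion: an average over the points whose coordinates are [m]-th roots of
    unity, with [m > n], recovers each coefficient exactly. *)
Lemma fourier_coef_le (c : {ffun 'I_k -> 'I_n} -> C) (M : C) :
  (forall z, unitary_point z -> `|\sum_j c j * \prod_i z i ^+ j i| <= M) ->
  forall j, `|c j| <= M.
Proof.
move=> cM j0; have [w wp] := prim_root_2exp C n.
have w1 := prim_root_norm wp.
have {wp} [m nm wp] : exists2 m, (n < m)%N & m.-primitive_root w.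
  exists (2 ^ n.+1)%N => //; exact: ltn_trans (ltnSn n) (ltn_expl _ _).
have m0 : (0 < m)%N by exact: leq_ltn_trans nm.
pose J := {ffun 'I_k -> 'I_m}.
pose p (t : J) : C := \sum_j c j * \prod_i (w ^+ t i) ^+ j i.
have pM t : `|p t| <= M.
  by apply: (cM (fun i => w ^+ t i)) => i; rewrite normrX w1 expr1n.
have jn (j : {ffun 'I_k -> 'I_n}) i : (j i < m)%N by exact: ltn_trans (ltn_ord _) nm.
(* The exponent [m - j0 i] stands for [- j0 i] modulo [m]. *)
have E : \sum_(t : J) (\prod_i w ^+ (t i * (m - j0 i))) * p t = (m ^ k)%:R * c j0.
  transitivity (\sum_j c j * \prod_(i < k) \sum_(t < m) w ^+ (t * (m - j0 i + j i))).
    under eq_bigr do rewrite /p mulr_sumr.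
    rewrite exchange_big /=; apply: eq_bigr => j _.
    rewrite bigA_distr_bigA mulr_sumr; apply: eq_bigr => t _.
    rewrite mulrCA -big_split /=; congr (_ * _); apply: eq_bigr => i _.
    by rewrite -exprM -exprD mulnDr.
  rewrite (bigD1 j0)//= [X in _ + X]big1 ?addr0 => [|j jj0].
    rewrite (eq_bigr (fun=> m%:R)) ?prodr_const ?card_ord ?natrX 1?mulrC// => i _.
    by rewrite (sum_prim_root _ wp) subnK ?dvdnn// ltnW.
  have [i ij] : exists i, j i != j0 i.
    apply/existsP; apply: contraR jj0; rewrite negb_exists => /forallP h.
    by apply/eqP/ffunP => i; apply/eqP; have := h i; rewrite negbK.
  rewrite (bigD1 i)//= (sum_prim_root _ wp); case: ifPn => [|_]; last by rewrite mul0r mulr0.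
  have := jn j i; have := jn j0 i; move: ij; rewrite -val_eqE /= => ij l0 l1.
  move=> /dvdnP[q qE]; move/eqP: ij => []; case: q qE => [|[|q]]; first by lia.
    by rewrite mul1n; lia.
  by rewrite !mulSn; lia.
have mk : (0 : C) < (m ^ k)%:R by rewrite ltr0n expn_gt0 m0.
rewrite -(ler_pM2l mk) -[X in X * `|_|](ger0_norm (ltW mk)) -normrM -E.
rewrite (le_trans (ler_norm_sum _ _ _))//.
apply: (@le_trans _ _ (\sum_(t : J) M)).
  apply: ler_sum => t _; rewrite normrM normr_prod big1 ?mul1r// => i _.
  by rewrite normrX w1 expr1n.
by rewrite sumr_const card_ffun !card_ord mulr_natl.
Qed.

End FourierCoefficients.

Section SpanLemmas.
Variables (C : numClosedFieldType) (A : cstarAlgType C).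
Implicit Types (G H K : set A).

Lemma lspan_gen G : G `<=` lspan G.
Proof. by move=> x Gx S _; apply. Qed.

Lemma lspan_mono G H : G `<=` H -> lspan G `<=` lspan H.
Proof. by move=> GH x Gx S sS HS; apply: Gx => // y /GH /HS. Qed.

Lemma lspanM G H K : (forall x y, G x -> H y -> lspan K (x ** y)) ->
  forall x y, lspan G x -> lspan H y -> lspan K (x ** y).
Proof.
move=> GHK x y Gx Hy; have [K0 KD KZ] := lspan_subspace K.
apply: (Gx [set x | lspan K (x ** y)]) => [|{Gx}x Gx /=].
  split=> /= [|a b Ka Kb|c a Ka]; first by rewrite cmul0l.
    by rewrite cmulDl; exact: KD.
  by rewrite cmulZl; exact: KZ.
apply: (Hy [set y | lspan K (x ** y)]) => [|{Hy}y Hy /=]; last exact: GHK.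
split=> /= [|a b Ka Kb|c a Ka]; first by rewrite cmul0r.
  by rewrite cmulDr; exact: KD.
by rewrite cmulZr; exact: KZ.
Qed.

Lemma lspan_star G H : (forall x, G x -> lspan H (star x)) ->
  forall x, lspan G x -> lspan H (star x).
Proof.
move=> GH x Gx; have [H0 HD HZ] := lspan_subspace H.
apply: (Gx [set x | lspan H (star x)]) => //.
split=> /= [|a b Ka Kb|c a Ka]; first by rewrite star0.
  by rewrite starD; exact: HD.
by rewrite starZ; exact: HZ.
Qed.

End SpanLemmas.

Lemma abszD_le (x y : int) : (`|(x + y)%R|%N <= `|x|%N + `|y|%N)%N.
Proof. by lia. Qed.

Lemma absz_shift (x : int) (N : nat) : (`|x|%N <= N)%N ->
  (`|(x + N%:Z)%R|%N < N.*2.+1)%N /\ `|(x + N%:Z)%R|%N%:Z = x + N%:Z.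
Proof. by lia. Qed.

(** * Characters determine the norm of a graded commutative algebra *)

Section CharacterIsometry.
Variables (R : realType) (k : nat) (A : cstarAlgType R[i]).
Local Notation C := (R[i]%type).
Local Notation zk := {ffun 'I_k -> int}.
Implicit Types (g h : zk) (z : 'I_k -> C).

Definition zpowz z g : C := \prod_i z i ^ g i.

(** Abstract form of a terminal corner: [U g a] says that [a] is its element of degree [g], and
    [chi z] is the character at the point [z] of [T^k]. Some degrees may carry no element, hence a
    relation; uniqueness in each degree forces commutativity. *)
Variables (U : zk -> A -> Prop) (chi : ('I_k -> C) -> A -> C).
Hypothesis U_uniq : forall g a b, U g a -> U g b -> a = b.
Hypothesis U_norm : forall g a, U g a -> `|a| <= 1.
Hypothesis U_mul : forall g h a b, U g a -> U h b -> U (g + h) (a ** b).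
Hypothesis U_star : forall g a, U g a -> U (- g) (star a).
Let EU : set A := [set a | exists g, U g a].
Hypothesis chiD : forall z, unitary_point z -> forall a b, chi z (a + b) = chi z a + chi z b.
Hypothesis chiZ : forall z, unitary_point z -> forall (c : C) a, chi z (c *: a) = c * chi z a.
Hypothesis chiM : forall z, unitary_point z -> forall a b,
  cspan EU a -> cspan EU b -> chi z (a ** b) = chi z a * chi z b.
Hypothesis chiS : forall z, unitary_point z -> forall a, chi z (star a) = (chi z a)^*.
Hypothesis chiU : forall z, unitary_point z -> forall g a, U g a -> chi z a = zpowz z g.

Lemma chi_norm_le z a : unitary_point z -> cspan EU a -> `|chi z a| <= `|a|.
Proof.
move=> z1; apply: functional_norm_le.
- exact: cspan_closed.
- exact: cspan_subspace.
- move=> x y; apply: cspanM; [exact: cspan_closed|exact: cspan_subspace|].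
  move=> {}x {}y [g Ux] [h Uy]; apply: cspan_gen; exists (g + h); exact: U_mul.
- exact: chiD.
- exact: chiZ.
- exact: chiM.
Qed.

Let UN N : set A := [set a | exists2 g : zk, (forall i, `|g i|%N <= N)%N & U g a].

Let UN_mono N M : (N <= M)%N -> UN N `<=` UN M.
Proof. by move=> NM a [g gN ga]; exists g => // i; rewrite (leq_trans (gN i)). Qed.

Let lspan_UN a : lspan EU a -> exists N, lspan (UN N) a.
Proof.
move=> /(_ [set a | exists N, lspan (UN N) a]); apply.
  split=> /= [|x y [N xN] [M yM]|c x [N xN]].
  - by exists 0%N; have [] := lspan_subspace (UN 0%N).
  - exists (maxn N M); have [_ D _] := lspan_subspace (UN (maxn N M)).
    apply: D; [apply: lspan_mono xN|apply: lspan_mono yM]; apply: UN_mono.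
      exact: leq_maxl.
    exact: leq_maxr.
  - by exists N; have [_ _ Z] := lspan_subspace (UN N); exact: Z.
move=> x [g gx]; exists (\max_i `|g i|%N)%N; apply: lspan_gen; exists g => // i.
exact: leq_bigmax.
Qed.

Let UN_mul N M a b : lspan (UN N) a -> lspan (UN M) b -> lspan (UN (N + M)) (a ** b).
Proof.
apply: lspanM => x y [g gN gx] [h hM hy]; apply: lspan_gen; exists (g + h); last exact: U_mul.
by move=> i; rewrite ffunE (leq_trans (abszD_le _ _))// leq_add.
Qed.

Let UN_star N a : lspan (UN N) a -> lspan (UN N) (star a).
Proof.
apply: lspan_star => x [g gN gx]; apply: lspan_gen; exists (- g); last exact: U_star.
by move=> i; rewrite ffunE abszN.
Qed.

(** The value is 0 in a degree that carries no element; the bound by 1 holds in both cases, so sums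
    may run over a whole box of degrees. *)
Let v g : A := match pselect (exists a, U g a) with left p => projT1 (cid p) | right _ => 0 end.

Let vE g a : U g a -> v g = a.
Proof.
move=> ga; rewrite /v; case: pselect => [p|[]]; last by exists a.
by apply: (U_uniq (g := g)) => //; exact: (projT2 (cid p)).
Qed.

Let v_norm g : `|v g| <= 1.
Proof.
rewrite /v; case: pselect => [p|_]; last by rewrite normr0.
exact: U_norm (projT2 (cid p)).
Qed.

Let shift N (j : {ffun 'I_k -> 'I_(N.*2.+1)}) : zk := [ffun i => (j i)%:Z - N%:Z].

(** The unimodular factor with exponent [N] in each coordinate turns a Laurent polynomial into one
    with exponents between 0 and [2N], the form that [fourier_coef_le] expects. *)
Let expand N a : lspan (UN N) a -> exists c : {ffun 'I_k -> 'I_(N.*2.+1)} -> C,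
  a = \sum_j c j *: v (shift j) /\ forall z, unitary_point z ->
  chi z a * \prod_i z i ^+ N = \sum_j c j * \prod_i z i ^+ j i.
Proof.
move=> /(_ [set a | exists c : {ffun 'I_k -> 'I_(N.*2.+1)} -> C,
  a = \sum_j c j *: v (shift j) /\ forall z, unitary_point z ->
  chi z a * \prod_i z i ^+ N = \sum_j c j * \prod_i z i ^+ j i]); apply.
  split=> /= [|x y [c [xc cE]] [d [yd dE]]|t x [c [xc cE]]].
  - exists (fun=> 0); split=> [|z z1].
      by rewrite big1// => j _; rewrite scale0r.
    rewrite -(scale0r 0) chiZ// mul0r mul0r big1// => j _; exact: mul0r.
  - exists (fun j => c j + d j); split=> [|z z1].
      by rewrite xc yd -big_split; apply: eq_bigr => j _; rewrite scalerDl.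
    by rewrite chiD// mulrDl cE// dE// -big_split; apply: eq_bigr => j _; rewrite mulrDl.
  - exists (fun j => t * c j); split=> [|z z1].
      by rewrite xc scaler_sumr; apply: eq_bigr => j _; rewrite scalerA.
    by rewrite chiZ// -mulrA cE// mulr_sumr; apply: eq_bigr => j _; rewrite mulrA.
move=> x [g gN gx].
have lt i := (absz_shift (gN i)).1.
pose j0 : {ffun 'I_k -> 'I_(N.*2.+1)} := [ffun i => Ordinal (lt i)].
have j0E : shift j0 = g by apply/ffunP => i; rewrite !ffunE /= (absz_shift (gN i)).2 addrK.
exists (fun j => (j == j0)%:R); split=> [|z z1].
  rewrite (bigD1 j0)//= eqxx scale1r j0E (vE gx) big1 ?addr0// => j /negbTE ->.
  exact: scale0r.
rewrite (chiU z1 gx) [RHS](bigD1 j0)//= eqxx mul1r [X in _ + X]big1 ?addr0 => [|j /negbTE ->]; last first.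
  exact: mul0r.
rewrite -big_split; apply: eq_bigr => i _ /=.
have zi : z i != 0 by rewrite -normr_eq0 z1 oner_eq0.
rewrite (exprnP _ N) (exprnP _ (j0 i)) -expfzDr// ffunE /=; congr (_ ^ _).
by rewrite (absz_shift (gN i)).2.
Qed.

Let growth N a (M : C) : lspan (UN N) a ->
  (forall z, unitary_point z -> `|chi z a| <= M) ->
  `|a| <= ((N.*2.+1) ^ k)%:R * M.
Proof.
move=> /expand[c [aE cE]] aM.
have cM j : `|c j| <= M.
  apply: fourier_coef_le => z z1; rewrite -cE// normrM normr_prod [X in _ * X]big1.
    by rewrite mulr1 aM.
  by move=> i _; rewrite normrX z1 expr1n.
rewrite {1}aE (le_trans (ler_norm_sum _ _ _))//.
apply: (@le_trans _ _ (\sum_(j : {ffun 'I_k -> 'I_(N.*2.+1)}) M)).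
  apply: ler_sum => j _; rewrite normrZ -[leRHS]mulr1.
  by apply: ler_pM => //; exact: v_norm.
by rewrite sumr_const card_ffun !card_ord mulr_natl.
Qed.

(** With [b = a^* a] self-adjoint, [|b^(2^m)| = |b|^(2^m)], whereas the number of
    coefficients of [b^(2^m)] grows polynomially in [2^m]: the constant in
    [growth] disappears in the limit. *)
Let lspan_isometry a (M : R) : 0 <= M -> lspan EU a ->
  (forall z, unitary_point z -> `|chi z a| <= M%:C%C) -> `|a| <= M%:C%C.
Proof.
move=> M0 /lspan_UN[N aN] aM.
pose b := star a ** a; have bN : lspan (UN N.*2) b.
  by rewrite -addnn; apply: UN_mul => //; exact: UN_star.
pose p m := iter m (fun x => x ** x) b.
have ps m : star (p m) = p m.
  elim: m => [|m IH]; first by rewrite /p /= /b starM starK.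
  by rewrite /p /= -/(p m) starM IH.
have pn m : `|p m| = `|b| ^+ (2 ^ m).
  elim: m => [|m IH]; first by rewrite expr1.
  by rewrite [p _]/(p m ** p m) -{1}ps cstar_norm IH expnS mulnC exprM.
have pN m : lspan (UN (N.*2 * 2 ^ m)) (p m).
  elim: m => [|m IH]; first by rewrite muln1.
  rewrite [p _]/(p m ** p m) (_ : (_ * _)%N = (N.*2 * 2 ^ m + N.*2 * 2 ^ m)%N).
    exact: UN_mul.
  by rewrite expnS; lia.
have inE0 n x : lspan (UN n) x -> cspan EU x.
  move=> xn; apply: subset_closure; apply: lspan_mono xn => y [g _ gy].
  by exists g.
have bM z : unitary_point z -> `|chi z b| <= (M ^+ 2)%:C%C.
  move=> z1; rewrite chiM ?chiS//; first last.
  - exact: inE0 aN.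
  - exact: (inE0 N _ (UN_star aN)).
  rewrite normrM norm_conjC -expr2 rmorphXn /=.
  have MC : 0 <= M%:C%C :> C by rewrite ler0c.
  apply: lerXn2r; [exact: normr_ge0|exact: MC|exact: aM].
have pM m z : unitary_point z -> `|chi z (p m)| <= ((M ^+ 2) ^+ (2 ^ m))%:C%C.
  move=> z1; elim: m => [|m IH]; first by rewrite expr1; exact: bM.
  rewrite [p _]/(p m ** p m) chiM; [|exact: z1|exact: inE0 (pN m)|exact: inE0 (pN m)].
  rewrite normrM expnS mulnC exprM expr2 rmorphM.
  by apply: ler_pM.
have bR : `|b| = (complex.Re `|a| ^+ 2)%:C%C by rewrite cstar_norm {1}norm_cReE -rmorphXn.
have : complex.Re `|a| ^+ 2 <= M ^+ 2.
  (* The degrees in [p m] have coordinates of size at most [2N 2^m], which leaves [4N 2^m + 1]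
     values for each coordinate. *)
  apply: (@power_trick R _ _ (N.*2.*2) k) => [|m]; first by rewrite exprn_ge0.
  have := growth (pN m) (pM m); rewrite pn bR -rmorphXn -(rmorph_nat (real_complex R)).
  rewrite -rmorphM lecR; congr (_ <= (_ ^ _)%:R * _).
  by rewrite addn1 -!mul2n mulnA.
by rewrite ler_pXn2r ?nnegrE ?cRe_norm_ge0// -lecR -norm_cReE.
Qed.

Lemma character_isometry a (M : R) : 0 <= M -> cspan EU a ->
  (forall z, unitary_point z -> `|chi z a| <= M%:C%C) -> `|a| <= M%:C%C.
Proof.
move=> M0 Ea aM; apply/ler_addgt0Pr => e e0.
have e2 : 0 < e / 2 by rewrite divr_gt0.
have [r r0 er] := gt0_complex e2.
have /closureP_norm/(_ _ e2)[b Sb ab] := Ea.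
have Eb : cspan EU b by exact: subset_closure.
have bM z : unitary_point z -> `|chi z b| <= (M + r)%:C%C.
  move=> z1; have -> : chi z b = chi z a + chi z (-1 *: (a - b)).
    by rewrite -chiD// scaleN1r opprB addrCA subrr addr0.
  rewrite rmorphD /= (le_trans (ler_normD _ _))// lerD ?aM//.
  apply: le_trans (chi_norm_le _ _) _ => //.
    have [S0 SD SZ] := cspan_subspace EU.
    by apply/SZ/SD => //; rewrite -scaleN1r; exact: SZ.
  by rewrite scaleN1r normrN -er ltW.
have := lspan_isometry (addr_ge0 M0 (ltW r0)) Sb bM; rewrite rmorphD /= -er => bM'.
rewrite -(subrK b a) (le_trans (ler_normD _ _))//.
apply: le_trans (lerD (ltW ab) bM') _.
by rewrite addrCA -splitr.
Qed.

End CharacterIsometry.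

(** * Subgroups of [Z^k] and their characters *)

Section Lattices.
Variables (R : realType) (k : nat).
Local Notation C := (R[i]%type).
Local Notation zk := {ffun 'I_k -> int}.
Implicit Types (g h : zk) (z : 'I_k -> C).

Lemma unitary_neq0 z i : unitary_point z -> z i != 0.
Proof. by move=> z1; rewrite -normr_eq0 z1 oner_eq0. Qed.

Lemma zpowzD z g h : unitary_point z -> zpowz z (g + h) = zpowz z g * zpowz z h.
Proof.
move=> z1; rewrite /zpowz -big_split; apply: eq_bigr => i _.
by rewrite ffunE expfzDr// unitary_neq0.
Qed.

Lemma zpowz0 z : zpowz z 0 = 1.
Proof. by rewrite /zpowz big1// => i _; rewrite ffunE. Qed.

Lemma norm_exprz1 (a : C) (n : int) : `|a| = 1 -> `|a ^ n| = 1.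
Proof.
by move=> a1; case: n => n; rewrite -?exprnP ?NegzE -?exprnN ?normfV normrX a1 expr1n ?invr1.
Qed.

Lemma zpowz_norm z g : unitary_point z -> `|zpowz z g| = 1.
Proof. by move=> z1; rewrite normr_prod big1// => i _; exact/norm_exprz1/z1. Qed.

Lemma zpowzN z g : unitary_point z -> zpowz z (- g) = (zpowz z g)^-1.
Proof.
move=> z1; have n0 : zpowz z g != 0 by rewrite -normr_eq0 zpowz_norm// oner_eq0.
by apply: (mulfI n0); rewrite divff// -zpowzD// subrr zpowz0.
Qed.

Lemma zpowzMz z g (n : int) : unitary_point z -> zpowz z (g *~ n) = zpowz z g ^ n.
Proof.
move=> z1; have nat m : zpowz z (g *+ m) = zpowz z g ^+ m.
  by elim: m => [|m IH]; rewrite ?mulr0n ?zpowz0// mulrS exprS zpowzD// IH.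
by case: n => m; [exact: nat|rewrite NegzE mulrNz zpowzN// -exprnN; congr (_^-1); exact: nat].
Qed.

Lemma zpowz_sum z (I : finType) (g : I -> zk) (n : I -> int) : unitary_point z ->
  zpowz z (\sum_i g i *~ n i) = \prod_i zpowz z (g i) ^ n i.
Proof.
move=> z1; transitivity (\prod_i zpowz z (g i *~ n i)); last first.
  by apply: eq_bigr => i _; exact: zpowzMz.
by apply: (big_morph (zpowz z)) => [x y|]; [exact: zpowzD|exact: zpowz0].
Qed.

Variable G : set zk.
Hypotheses (G0 : G 0) (GD : forall g h, G g -> G h -> G (g + h))
  (GN : forall g, G g -> G (- g)).

Let GMz g n : G g -> G (g *~ n).
Proof.
move=> Gg; have nat m : G (g *+ m) by elim: m => [|m IH]; rewrite ?mulr0n// mulrS; exact: GD.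
by case: n => m; [exact: nat|rewrite NegzE mulrNz; apply: GN; exact: nat].
Qed.

Let Gt (t : nat) h : Prop := G h /\ forall i : 'I_k, (t <= i)%N -> h i = 0.

(** Besides generating, [gs] has to admit a section [sec] that realises arbitrary unimodular values
    on [gs] by a point of [T^k]. This takes the place of linear independence and lets every point of
    [T^l] occur as a character. *)
Let basis_for t (gs : seq zk) (sec : (nat -> C) -> 'I_k -> C) : Prop :=
  [/\ (size gs <= t)%N, forall j, (j < size gs)%N -> Gt t gs`_j,
      forall h, Gt t h -> exists n : nat -> int, h = \sum_(j < size gs) gs`_j *~ n j &
      forall zeta, (forall j, `|zeta j| = 1) -> unitary_point (sec zeta) /\
        forall j, (j < size gs)%N -> zpowz (sec zeta) gs`_j = zeta j].

(** The coordinates at [t] of the elements of [G] supported on the first [t + 1] coordinates form a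
    subgroup of [Z]. If it is nonzero, an element [h0] attaining its least positive value [d + 1]
    joins the basis, and Euclidean division reduces all others to the previous stage. *)
Let basis_step t gs sec : (t < k)%N -> basis_for t gs sec ->
  exists gs' sec', basis_for t.+1 gs' sec'.
Proof.
move=> tk [sz Ggs gen secP]; pose i0 := Ordinal tk.
have Gt_le h : Gt t h -> Gt t.+1 h.
  by move=> [Gh h0]; split=> // i ti; apply: h0; exact: ltnW.
have Gt_of h : Gt t.+1 h -> h i0 = 0 -> Gt t h.
  move=> [Gh h0] hi; split=> // i; rewrite leq_eqVlt => /predU1P[ti|/h0//].
  by have -> : i = i0 by apply: val_inj.
have [P|noP] := pselect (exists d : nat, exists2 h, Gt t.+1 h & h i0 = d.+1%:Z); last first.
  exists gs, sec; split=> //; first exact: leqW.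
    by move=> j /Ggs /Gt_le.
  move=> h ht; apply: gen; apply: Gt_of => //; apply: contrapT => hi.
  case: noP; case E: (h i0) hi => [[|d]|d] // _; first by exists d, h.
  exists d; exists (- h); last by rewrite ffunE E NegzE opprK.
  case: ht => Gh h0; split; first exact: GN.
  by move=> i /h0; rewrite ffunE => ->; rewrite oppr0.
have exP : exists d : nat, `[< exists2 h, Gt t.+1 h & h i0 = d.+1%:Z >].
  by have [d hd] := P; exists d; apply/asboolP.
case: (ex_minnP exP) => d /asboolP[h0 Gh0 h0d] dmin.
have [Gh0' h00] := Gh0.
(* The earlier basis vectors vanish at [i0], so this coordinate is free; a root of order [d + 1]
   adjusts the value on [h0]. *)
pose newz (zeta : nat -> C) : 'I_k -> C :=
  fun i => if i == i0 then
    d.+1.-root (zeta (size gs) / \prod_(i < k | i != i0) sec zeta i ^ h0 i) else sec zeta i.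
exists (rcons gs h0), newz; split.
- by rewrite size_rcons.
- move=> j; rewrite size_rcons ltnS leq_eqVlt nth_rcons => /predU1P[->|lt].
    by rewrite ltnn eqxx.
  by rewrite lt; apply/Gt_le/Ggs.
- move=> h ht; have [Gh hh] := ht.
  pose q := (h i0 %/ d.+1%:Z)%Z; pose h' := h - h0 *~ q.
  have intE (x : zk) (m : int) i : (x *~ m) i = x i * m.
    have nat p : (x *+ p) i = x i *+ p.
      by elim: p => [|p IH]; rewrite ?mulr0n ?ffunE// !mulrS ffunE IH.
    case: m => m; first by rewrite -[x *~ _]/(x *+ m) nat -mulr_natr natz.
    by rewrite NegzE mulrNz ffunE -[x *~ _]/(x *+ m.+1) nat -mulr_natr natz mulrN.
  have h'i : h' i0 = (h i0 %% d.+1%:Z)%Z.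
    by rewrite /h' !ffunE intE h0d {1}(divz_eq (h i0) d.+1%:Z) mulrC addrAC subrr add0r.
  have Gh' : Gt t.+1 h'.
    split; first by apply: GD => //; apply/GN/GMz.
    by move=> i ti; rewrite /h' !ffunE intE hh// h00// mul0r subr0.
  have h'0 : h' i0 = 0.
    apply: contrapT => h'n; have := ltz_pmod (h i0) (isT : 0 < d.+1%:Z).
    have := modz_ge0 (h i0) (isT : d.+1%:Z != 0); rewrite -h'i.
    case E: (h' i0) h'n => [[|r]|r] // _ _ rd.
    have := dmin r; rewrite asboolE => /(_ _)/= -/(_ (ex_intro2 _ _ h' Gh' E)).
    by move: rd; rewrite ltz_nat; lia.
  have [n nE] := gen _ (Gt_of _ Gh' h'0).
  exists (fun j => if j == size gs then q else n j).
  rewrite size_rcons big_ord_recr /= eqxx nth_rcons ltnn eqxx.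
  rewrite (eq_bigr (fun j : 'I_(size gs) => gs`_j *~ n j)) -?nE ?subrK// => j _.
  by rewrite nth_rcons ltn_ord (ltn_eqF (ltn_ord j)).
- move=> zeta z1; have [s1 sE] := secP _ z1.
  have p1 : `|\prod_(i < k | i != i0) sec zeta i ^ h0 i| = 1.
    by rewrite normr_prod big1// => i _; exact/norm_exprz1/s1.
  have nu : unitary_point (newz zeta).
    move=> i; rewrite /newz; case: eqP => // _; apply/eqP.
    by rewrite -(pexpr_eq1 (n := d.+1))// -normrX rootCK// normf_div p1 z1 divr1.
  split=> // j; rewrite size_rcons ltnS leq_eqVlt nth_rcons => /predU1P[->|lt].
    rewrite ltnn eqxx /zpowz (bigD1 i0)//= h0d {1}/newz eqxx -exprnP rootCK//.
    rewrite [X in _ * X](eq_bigr (fun i => sec zeta i ^ h0 i)) => [|i ni]; last by rewrite /newz (negbTE ni).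
    by rewrite divfK// -normr_eq0 p1 oner_eq0.
  rewrite lt -(sE _ lt); apply: eq_bigr => i _; rewrite /newz; case: eqP => // ->.
  by have [_ -> //] := Ggs _ lt; rewrite !expr0z.
Qed.

Lemma lattice_basis : exists l : nat, (l <= k)%N /\
  exists (g : 'I_l -> zk) (sec : ('I_l -> C) -> 'I_k -> C),
  [/\ forall j, G (g j), forall h, G h -> exists n : 'I_l -> int, h = \sum_j g j *~ n j &
      forall zeta, (forall j, `|zeta j| = 1) -> unitary_point (sec zeta) /\
        forall j, zpowz (sec zeta) (g j) = zeta j].
Proof.
have [gs [sec [sz Ggs gen secP]]] : exists gs sec, basis_for k gs sec.
  suff H t : (t <= k)%N -> exists gs sec, basis_for t gs sec by exact: H.
  elim: t => [_|t IH tk].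
    exists [::], (fun _ _ => 1); split=> // [h [_ h0]|zeta z1].
      exists (fun=> 0); rewrite big_ord0; apply/ffunP => i; rewrite ffunE; exact: h0.
    by split=> // i; rewrite normr1.
  by have [gs [sec b]] := IH (ltnW tk); exact: basis_step b.
exists (size gs); split=> //; exists (fun j => gs`_j).
exists (fun zeta => sec (fun j => if insub j is Some j' then zeta j' else 1)); split.
- by move=> j; have [] := Ggs j (ltn_ord j).
- move=> h Gh; have [|n nE] := gen h; first by split=> // i; rewrite leqNgt ltn_ord.
  by exists (fun j => n j).
- move=> zeta z1; set zeta' := fun j : nat => _.
  have [|u uE] := secP zeta'; first by rewrite /zeta' => j; case: insub => [j'|]; rewrite ?normr1.
  split=> // j; rewrite uE// /zeta' insubT//= => jl.
  by congr zeta; apply: val_inj.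
Qed.

End Lattices.

(** * The Stone-Weierstrass theorem *)

Section StoneWeierstrass.
Variables (R : realType) (X : topologicalType) (cptX : compact [set: X]).
Local Notation C := (R[i]%type).
Local Notation CX := (cont_alg R cptX).
Variable S : set CX.
Hypothesis Ssub : is_cstar_subalgebra S.
Hypothesis S1 : exists2 h, S h & forall x, cont_fun h x = 1.
Hypothesis Ssep : forall x y : X, x <> y -> exists2 h, S h & cont_fun h x <> cont_fun h y.
Implicit Types f g : X -> R.

Definition real_part f : Prop := exists2 h, S h & forall x, cont_fun h x = (f x)%:C%C.
Local Notation T := real_part.

Lemma real_partD f g : T f -> T g -> T (fun x => f x + g x).
Proof.
move=> [h Sh hE] [h' Sh' hE']; have [_ [_ SD _] _ _] := Ssub.
exists (h + h'); first exact: SD.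
by move=> x; rewrite rmorphD /= -hE -hE'.
Qed.

Lemma real_partM f g : T f -> T g -> T (fun x => f x * g x).
Proof.
move=> [h Sh hE] [h' Sh' hE']; have [_ _ SM _] := Ssub.
exists (h ** h'); first exact: SM.
by move=> x; rewrite rmorphM /= -hE -hE'.
Qed.

Lemma real_part_cst (r : R) : T (fun=> r).
Proof.
have [h Sh hE] := S1; have [_ [_ _ SZ] _ _] := Ssub.
exists ((r%:C)%C *: h); first exact: SZ.
by move=> x; rewrite -[LHS]/((r%:C)%C * cont_fun h x) hE mulr1.
Qed.

Lemma real_partZ (r : R) f : T f -> T (fun x => r * f x).
Proof. exact/real_partM/real_part_cst. Qed.

Lemma real_part_ext f g : f =1 g -> T f -> T g.
Proof. by move=> fg [h Sh hE]; exists h => // x; rewrite -fg. Qed.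

Lemma real_part_cont f : T f -> continuous (f : X -> R^o).
Proof.
move=> [h _ hE] x; have /(@cvgrPdist_lt C C^o) hc := cont_funP (f := h) (x := x).
apply/(@cvgrPdist_lt R R^o) => e e0; have e0' : 0 < e%:C%C :> C by rewrite ltcR.
apply: filterS (hc _ e0') => y; rewrite !hE -rmorphB.
by rewrite (norm_real_complex (f x - f y)) ltcR.
Qed.

Lemma real_part_bounded f : T f -> exists2 M : R, 0 < M & forall x, `|f x| <= M.
Proof.
move=> [h _ hE]; exists (cont_sup h + 1); first by rewrite ltr_wpDl// cont_sup_ge0.
move=> x; have := cont_sup_ge h x; rewrite hE norm_real_complex lecR => /le_trans; apply.
by rewrite lerDl.
Qed.

Lemma real_part_lim f : continuous (f : X -> R^o) ->
  (forall e : R, 0 < e -> exists2 g, T g & forall x, `|f x - g x| <= e) -> T f.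
Proof.
move=> fc fa.
have fc' : continuous (fun x => (f x +i* 0)%C : C^o).
  by apply: complex_continuous => // x; exact: cvg_cst.
exists (cont_mk cptX fc') => //; have [Scl _ _ _] := Ssub.
apply: Scl; apply/closureP_norm => e /gt0_complex[r r0 ->].
have r2 : 0 < r / 2 by rewrite divr_gt0.
have [g [h Sh hE] fg] := fa _ r2; exists h => //.
apply: (@le_lt_trans _ _ (r / 2)%:C%C); last first.
  by rewrite ltcR ltr_pdivrMr// ltr_pMr// ltr1n.
apply: cont_norm_le => [|x]; first exact: ltW.
have -> : cont_fun (cont_mk cptX fc' - h) x = (f x)%:C%C - cont_fun h x by [].
by rewrite hE -rmorphB norm_real_complex lecR.
Qed.

(** The classical iteration of polynomials in [u], increasing to the square root of [u] on [[0, 1]];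
    at [u = f^2] it approximates [|f|]. *)
Fixpoint sqrt_approx (n : nat) (u : R) : R :=
  if n is n'.+1 then sqrt_approx n' u + 2^-1 * (u - sqrt_approx n' u * sqrt_approx n' u) else 0.

(** Each step multiplies the error [t - q] by [1 - (t + q)/2 <= 1 - t/2], and
    [(1 - t/2) (2 + (n+1) t) <= 2 + n t]. The resulting bound [2t / (2 + n t)] is small uniformly in
    [t]. *)
Lemma sqrt_approxP n (t : R) : 0 <= t <= 1 ->
  let q := sqrt_approx n (t * t) in [/\ 0 <= q, q <= t & (t - q) * (2 + n%:R * t) <= 2 * t].
Proof.
move=> /andP[t0 t1]; elim: n => [|n [q0 qt qn]] /=; first by split=> //; lra.
set q := sqrt_approx n _ in q0 qt qn *.
have n0 : (0 : R) <= n%:R by [].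
have e0 : 0 <= t - q by rewrite subr_ge0.
have step : t - (q + 2^-1 * (t * t - q * q)) = (t - q) * (1 - (t + q) / 2) by field.
split.
- by rewrite addr_ge0// mulr_ge0 ?invr_ge0// subr_ge0 ler_pM.
- by rewrite -subr_ge0 step mulr_ge0//; lra.
rewrite step; apply: (@le_trans _ _ ((t - q) * (1 - t / 2) * (2 + n.+1%:R * t))).
  rewrite ler_wpM2r//; first by rewrite addr_ge0// mulr_ge0.
  by rewrite ler_wpM2l//; lra.
apply: le_trans qn; rewrite -mulrA ler_wpM2l//.
have -> : (1 - t / 2) * (2 + n.+1%:R * t) =
  2 + n%:R * t - (n%:R * (t * t) + t * t) / 2.
  by rewrite -[n.+1%:R]natr1; field.
by rewrite gerBl divr_ge0 ?addr_ge0 ?mulr_ge0.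
Qed.

Lemma real_part_sqrt_approx n f : T f -> T (fun x => sqrt_approx n (f x)).
Proof.
move=> Tf; elim: n => [|n IH] /=; first exact: real_part_cst.
apply: real_partD => //; apply: real_partZ; apply: real_partD => //.
apply: (@real_part_ext (fun x => -1 * (sqrt_approx n (f x) * sqrt_approx n (f x)))).
  by move=> x; rewrite mulN1r.
by apply: real_partZ; exact: real_partM.
Qed.

Lemma real_part_norm f : T f -> T (fun x => `|f x|).
Proof.
move=> Tf; have [M M0 fM] := real_part_bounded Tf.
pose g x := M^-1 * f x; have Tg : T g by exact: real_partZ.
have g1 x : 0 <= `|g x| <= 1.
  by rewrite normr_ge0 /g normrM gtr0_norm ?invr_gt0// ler_pdivrMl// mulr1 fM.
suff : T (fun x => `|g x|).
  move=> /(real_partZ M); apply: real_part_ext => x.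
  by rewrite /g normrM gtr0_norm ?invr_gt0// mulrA divff ?mul1r// gt_eqF.
apply: real_part_lim => [x|e e0].
  by apply: continuous_comp; [exact: (real_part_cont Tg)|exact: norm_continuous].
(* Cancelling [t] in the error bound leaves [(t - q) n <= 2], so [n > 2/e] works at all points at
   once. *)
pose n := (Num.trunc (2 / e)).+1; exists (fun x => sqrt_approx n (g x * g x)).
  by apply: real_part_sqrt_approx; exact: real_partM.
move=> x; have -> : g x * g x = `|g x| * `|g x| by rewrite -normrM ger0_norm// -expr2 sqr_ge0.
have [q0 qt qn] := sqrt_approxP n (g1 x); rewrite ger0_norm ?subr_ge0//.
set t := `|g x| in qt qn *; set q := sqrt_approx _ _ in q0 qt qn *.
have n2 : 2 / e < n%:R by exact: truncnS_gt.
have [t0|tn] := eqVneq t 0; first by move: qt q0; rewrite t0; lra.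
have tp : 0 < t by rewrite lt_def tn; case/andP: (g1 x).
have : (t - q) * n%:R <= 2.
  rewrite -(ler_pM2r tp) -mulrA; apply: le_trans qn.
  by rewrite ler_wpM2l ?subr_ge0// lerDr.
move=> h; rewrite leNgt; apply/negP => lt.
move: n2; rewrite ltr_pdivrMr// => n2.
have : 2 < (t - q) * n%:R.
  by apply: (lt_trans n2); rewrite mulrC ltr_pM2r ?ltr0n.
by rewrite ltNge h.
Qed.

Lemma real_part_min f g : T f -> T g -> T (fun x => Num.min (f x) (g x)).
Proof.
move=> Tf Tg; apply: (@real_part_ext (fun x => 2^-1 * (f x + g x + -1 * `|f x + -1 * g x|))).
  move=> x; rewrite !mulN1r; case: (leP (f x) (g x)) => fg.
    by rewrite ler0_norm ?subr_le0//; field.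
  by rewrite gtr0_norm ?subr_gt0//; field.
apply: real_partZ; apply: real_partD; first exact: real_partD.
by apply: real_partZ; apply: real_part_norm; apply: real_partD => //; exact: real_partZ.
Qed.

(** The compactness argument for a family stable under minimum: finitely many of the sets where a
    member stays below [F + e] cover the space. It serves for [F] with a prescribed value at one
    point, then for [-F]. *)
Lemma min_cover (P : set (X -> R)) (F : X -> R) (e : R) :
  continuous (F : X -> R^o) -> (forall f, P f -> continuous (f : X -> R^o)) ->
  (forall f g, P f -> P g -> P (fun x => Num.min (f x) (g x))) -> P !=set0 ->
  (forall y, exists2 f, P f & f y < F y + e) ->
  exists2 f, P f & forall z, f z < F z + e.
Proof.
move=> Fc Pc Pmin [f0 Pf0] Py.
pose f y := projT1 (cid2 (Py y)).
have fP y : P (f y) by rewrite /f; case: cid2.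
have fy y : f y y < F y + e by rewrite /f; case: cid2.
pose V y := [set z | f y z < F z + e].
have Vo y : open (V y).
  rewrite (_ : V y = (fun z => f y z - F z) @^-1` [set u : R^o | u < e]).
    apply: open_comp => [z _|]; last exact: open_lt.
    by apply: cvgB; [exact: (Pc _ (fP y))|exact: Fc].
  by apply/seteqP; split=> z; rewrite /V /= ltrBlDl.
(* Compactness along the filter of finite sets [D]: near each [z], every large [D] contains a [y]
   whose [V y] holds the point, so one [D] works everywhere. *)
have cov : near_covering [set: X] by rewrite -compact_near_coveringP; exact: cptX.
have [D Dcov] : exists D : {fset X}, forall z, exists2 y, y \in D & V y z.
  have [|E _ EP] := cov {fset X} (@totally X)
    (fun D z => exists2 y, y \in D & V y z) (@filter_filter _ _ (@totally_filter X)).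
    move=> z _.
    exists (V z, [set D | (([fset z] : {fset X}) `<=` D)%fset]) => /=.
      split; last by exists [fset z]%fset.
      by apply: open_nbhs_nbhs; split; [exact: Vo|exact: fy].
    by move=> [z' D] /= [Vz']; rewrite fsub1set => zD; exists z.
  by exists E => z; exact: (EP E (fsubset_refl _) z I).
have [h Ph hD] : exists2 h, P h & forall y, y \in (D : seq X) -> forall z, V y z -> h z < F z + e.
  elim: (D : seq X) => [|y s [h Ph hs]]; first by exists f0.
  exists (fun x => Num.min (f y x) (h x)); first exact: Pmin.
  move=> y' /predU1P[-> z Vz|ys z Vz]; rewrite gt_min.
    by rewrite Vz.
  by rewrite (hs _ ys z Vz) orbT.
exists h => // z; have [y yD Vz] := Dcov z.
exact: hD yD z Vz.
Qed.

Lemma real_part_sep x y (a b : R) : x <> y -> exists2 f, T f & f x = a /\ f y = b.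
Proof.
move=> xy; suff [f Tf fxy] : exists2 f, T f & f x <> f y.
  have d0 : f y - f x != 0 by rewrite subr_eq0; apply/eqP => E; apply: fxy.
  exists (fun z => a + (b - a) / (f y - f x) * (f z + - f x)).
    apply: real_partD; first exact: real_part_cst.
    by apply: real_partZ; apply: real_partD => //; exact: real_part_cst.
  by split; [rewrite subrr mulr0 addr0|rewrite divfK// addrC subrK].
have [h Sh hxy] := Ssep xy; have [_ [_ SD SZ] _ SS] := Ssub.
have Tre : T (fun z => complex.Re (cont_fun h z)).
  exists (2^-1 *: (h + star h)); first by apply/SZ/SD => //; exact: SS.
  move=> z; have -> : cont_fun (2^-1 *: (h + star h)) z = 2^-1 * (cont_fun h z + (cont_fun h z : C)^*) by [].
  by rewrite mulrC -ReE -complexRe.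
have Tim : T (fun z => complex.Im (cont_fun h z)).
  exists (2^-1 *: (- 'i *: (h - star h))).
    apply/SZ/SZ/SD => //; rewrite -scaleN1r; apply: SZ; exact: SS.
  move=> z; have -> : cont_fun (2^-1 *: (- 'i *: (h - star h))) z =
    2^-1 * (- 'i * (cont_fun h z - (cont_fun h z : C)^*)) by [].
  rewrite (_ : - 'i * _ = 'i * ((cont_fun h z : C)^* - cont_fun h z)); last by rewrite mulNr -mulrN opprB.
  by rewrite mulrC -ImE -complexIm.
have [re|re] := eqVneq (complex.Re (cont_fun h x)) (complex.Re (cont_fun h y)); last first.
  by exists (fun z => complex.Re (cont_fun h z)) => //; exact/eqP.
exists (fun z => complex.Im (cont_fun h z)) => // im; apply: hxy.
by apply/eqP; rewrite eq_complex re im !eqxx.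
Qed.

Lemma real_stone_weierstrass F : continuous (F : X -> R^o) -> T F.
Proof.
move=> Fc; apply: real_part_lim => // e e0.
have interp x y : exists2 f, T f & f x = F x /\ f y = F y.
  have [->|xy] := pselect (x = y); last exact: real_part_sep.
  by exists (fun=> F y) => //; exact: real_part_cst.
have below x : exists2 f, (T f /\ f x = F x) & forall z, f z < F z + e.
  apply: min_cover => // [f [Tf _]|f g [Tf fx] [Tg gx]||y].
  - exact: real_part_cont.
  - by split; [exact: real_part_min|rewrite fx gx minxx].
  - by exists (fun=> F x); split=> //; exact: real_part_cst.
  - by have [f Tf [fx fy]] := interp x y; exists f => //; rewrite fy ltrDl.
(* Signs are reversed for the second pass: [P] consists of the functions whose negatives belong to
   [T] and stay below [F + e], and its minima are compared with [-F]. *)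
pose P f := T (fun z => - f z) /\ forall z, - f z < F z + e.
have opp f : T f -> T (fun z => - f z).
  by move=> Tf; apply: (@real_part_ext (fun z => -1 * f z)) => [z|]; [rewrite mulN1r|exact: real_partZ].
have oppK f : T (fun z => - f z) -> T f.
  by move=> /opp; apply: real_part_ext => z; rewrite opprK.
have [|||||f [Tf fu] fl] := @min_cover P (fun z => - F z) e.
- by move=> x; apply: cvgN; exact: Fc.
- by move=> f [/oppK Tf _]; exact: real_part_cont.
- move=> f g [/oppK Tf fF] [/oppK Tg gF]; split.
    by apply/opp/real_part_min.
  by move=> z; rewrite /Num.min; case: ifP.
- have [[x _]|nx] := pselect (exists x : X, True); last first.
    exists (fun=> 0); split; first exact/opp/real_part_cst.
    by move=> z; case: nx; exists z.
  have [f [Tf _] fF] := below x; exists (fun z => - f z); split.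
    by apply: real_part_ext Tf => z; rewrite opprK.
  by move=> z; rewrite opprK.
- move=> y; have [f [Tf fy] fF] := below y; exists (fun z => - f z); last by rewrite fy ltrDl.
  split; first by apply: real_part_ext Tf => z; rewrite opprK.
  by move=> z; rewrite opprK.
exists (fun z => - f z) => // z; rewrite ler_norml; have := fu z; have := fl z; lra.
Qed.

Lemma stone_weierstrass : S = setT.
Proof.
apply/seteqP; split=> // F _; have [_ [_ SD SZ] _ _] := Ssub.
have part (pr : C -> R) : (forall a b, `|pr a - pr b|%:C%C <= `|a - b|) ->
    exists2 h, S h & forall x, cont_fun h x = (pr (cont_fun F x))%:C%C.
  move=> le; apply: (@real_stone_weierstrass (fun x => pr (cont_fun F x))) => x.
  have /(@cvgrPdist_lt C C^o) Fc := cont_funP (f := F) (x := x).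
  apply/(@cvgrPdist_lt R R^o) => e e0; have e0' : 0 < e%:C%C :> C by rewrite ltcR.
  apply: filterS (Fc _ e0') => y h; rewrite -ltcR; exact: le_lt_trans (le _ _) h.
have [|re Sre reE] := part (@complex.Re R).
  by move=> a b; rewrite -raddfB; exact: norm_cRe_le.
have [|im Sim imE] := part (@complex.Im R).
  by move=> a b; rewrite -raddfB; exact: norm_cIm_le.
have -> : F = re + 'i *: im; last by apply: SD => //; exact: SZ.
apply: cont_ext => x; have -> : cont_fun (re + 'i *: im) x = cont_fun re x + 'i * cont_fun im x by [].
rewrite reE imE; exact: complexE.
Qed.

End StoneWeierstrass.

(** * Morita equivalence from full corners *)

Section LeftIdeal.
Variables (R : realType) (A : cstarAlgType R[i]) (p : A).
Local Notation C := (R[i]%type).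

Definition left_ideal_pred : {pred A} := [pred x | x ** p == x].

Fact left_ideal_submod_closed : submod_closed left_ideal_pred.
Proof.
split; first by rewrite inE cmul0l.
by move=> c x y /eqP xp /eqP yp; rewrite inE cmulDl cmulZl xp yp.
Qed.
HB.instance Definition _ :=
  GRing.isSubmodClosed.Build C A left_ideal_pred left_ideal_submod_closed.

Record left_ideal := LeftIdeal { left_ideal_val :> A; left_idealP : left_ideal_val \in left_ideal_pred }.
HB.instance Definition _ := [isSub for left_ideal_val].
HB.instance Definition _ := [Choice of left_ideal by <:].
HB.instance Definition _ := [SubChoice_isSubLmodule of left_ideal by <:].

Implicit Types x y : left_ideal.

Lemma left_idealE x : x ** p = x :> A. Proof. exact/eqP/left_idealP. Qed.

(** Both inner products define norms equivalent to that of [A] on the closed left ideal [A p]; [K]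
    absorbs the maximum norm of the direct sum. *)
Lemma left_ideal_complete (B : cstarAlgType C) (ip : left_ideal -> left_ideal -> B) (K : C) :
  0 < K -> (forall x, `|ip x x| <= `|x : A| ^+ 2) ->
  (forall x, `|x : A| ^+ 2 <= K * `|ip x x|) -> ip_complete ip.
Proof.
move=> K0 ip_le le_ip u uC; pose v n : A := u n.
have vB m n : u m - u n = v m - v n :> A by [].
have /cvg_ex[l vl] : cvg (v @ \oo).
  apply: cauchy_cvg; apply: cauchy_exP => e e0.
  have [N uN] := uC (e ^+ 2 / K) (divr_gt0 (exprn_gt0 2 e0) K0).
  exists (v N); exists N => // m /= Nm; rewrite -ball_normE /= -vB.
  rewrite -(@ltr_pXn2r _ 2) ?nnegrE ?(ltW e0)//.
  apply: le_lt_trans (le_ip _) _.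
  by rewrite mulrC -ltr_pdivlMr// uN.
have lP : l \in left_ideal_pred.
  rewrite inE; apply/eqP.
  have cl := closed_fixpoints (@cmulr_continuous _ A p).
  by apply: (closed_cvg _ cl _ _ vl); apply: nearW => n; exact: left_idealE.
exists (LeftIdeal lP) => e e0.
have s0 : 0 < sqrtC e by rewrite sqrtC_gt0.
move/(@cvgrPdist_lt C A)/(_ _ s0): vl => [N _ vN]; exists N => n Nn.
apply: le_lt_trans (ip_le _) _.
rewrite -[ltRHS]sqrtCK ltr_pXn2r ?nnegrE ?(ltW s0)//.
have -> : (u n - LeftIdeal lP : left_ideal) = v n - l :> A by [].
by rewrite distrC; exact: vN.
Qed.

End LeftIdeal.

Section MoritaFromCorners.
Variables (R : realType) (A : cstarAlgType R[i]) (I : finType) (B : I -> cstarAlgType R[i]).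
Local Notation C := (R[i]%type).
Variables (e : I -> A) (Psi : forall i, B i -> A).
Arguments Psi : clear implicits.
Hypothesis e_proj : forall i, is_projection (e i).
(** Stronger than orthogonality: different corners are not linked by any element, so [p A p] is the
    direct sum of the [e i A e i]. *)
Hypothesis e_orth : forall i j, i != j -> forall a, e i ** a ** e j = 0.
Hypothesis Psi_hom : forall i, is_star_hom (Psi i).
Hypothesis Psi_norm : forall i b, `|Psi i b| = `|b|.
Hypothesis Psi_corner : forall i b, e i ** Psi i b = Psi i b.
Hypothesis Psi_onto : forall i a, exists b, Psi i b = e i ** a ** e i.
(** Positivity in [B i] asks for a root inside [B i], whereas [x ** e i] need not lie in the
    corner. *)
Hypothesis Psi_pos : forall i x, exists b, Psi i (star b ** b) = e i ** (star x ** x) ** e i.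
Hypothesis e_full : has_dense_span [set a | exists i x y, a = x ** e i ** star y].

Local Notation D := (dsum B).
Let p : A := \sum_i e i.
Local Notation X := (left_ideal p).
Implicit Types (b d : D) (x y z : X).

Let ee i : e i ** e i = e i. Proof. by have [] := e_proj i. Qed.
Let es i : star (e i) = e i. Proof. by have [] := e_proj i. Qed.

Let Psi_corner' i (b : B i) : Psi i b ** e i = Psi i b.
Proof.
by apply: starI; rewrite starM es -(star_hom_star (Psi_hom i)) Psi_corner.
Qed.

Let e_ij i j : i != j -> e i ** e j = 0.
Proof. by move=> ij; have := e_orth ij (e i); rewrite ee. Qed.

Let ep i : e i ** p = e i.
Proof.
rewrite cmul_sumr (bigD1 i)//= big1 ?addr0 ?ee// => j ji.
by rewrite e_ij// eq_sym.
Qed.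

Let ps : star p = p.
Proof. by rewrite star_sum; apply: eq_bigr => i _; exact: es. Qed.

Let pap a : p ** a ** p = \sum_i e i ** a ** e i.
Proof.
rewrite /p !cmul_suml; apply: eq_bigr => i _; rewrite cmul_sumr (bigD1 i)//= big1 ?addr0// => j ji.
by apply: e_orth; rewrite eq_sym.
Qed.

Let PsiT b : A := \sum_i Psi i (b i).

Let e_PsiT i b : e i ** PsiT b = Psi i (b i).
Proof.
rewrite cmul_sumr (bigD1 i)//= Psi_corner big1 ?addr0// => j ji.
by rewrite -Psi_corner cmulA e_ij ?cmul0l// eq_sym.
Qed.

Let PsiT_e i b : PsiT b ** e i = Psi i (b i).
Proof.
rewrite cmul_suml (bigD1 i)//= Psi_corner' big1 ?addr0// => j ji.
by rewrite -Psi_corner' -cmulA e_ij ?cmul0r.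
Qed.

Let PsiT_p b : PsiT b ** p = PsiT b.
Proof. by rewrite /p cmul_sumr; apply: eq_bigr => i _; exact: PsiT_e. Qed.

Let Psi0 i : Psi i 0 = 0.
Proof. by apply/eqP; rewrite -normr_eq0 Psi_norm normr0. Qed.

Let Psi_inj i : injective (Psi i).
Proof.
move=> a b ab; apply/eqP; rewrite -subr_eq0 -normr_eq0 -Psi_norm.
rewrite (star_homD (Psi_hom i)) -scaleN1r (star_homZ (Psi_hom i)) ab scaleN1r subrr.
by rewrite normr0.
Qed.

Let PsiT_inj : injective PsiT.
Proof.
move=> b d bd; apply: dsum_ext => i; apply: Psi_inj.
by rewrite -!e_PsiT bd.
Qed.

Let PsiTD : {morph PsiT : b d / b + d}.
Proof.
by move=> b d; rewrite /PsiT -big_split; apply: eq_bigr => i _; exact: (star_homD (Psi_hom i)).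
Qed.

Let PsiTZ (c : C) b : PsiT (c *: b) = c *: PsiT b.
Proof. by rewrite /PsiT scaler_sumr; apply: eq_bigr => i _; exact: (star_homZ (Psi_hom i)). Qed.

Let PsiTM : {morph PsiT : b d / b ** d}.
Proof.
move=> b d; rewrite [in RHS]/PsiT cmul_suml; apply: eq_bigr => i _.
by rewrite -[Psi i (b i)]Psi_corner' -cmulA e_PsiT -(star_homM (Psi_hom i)).
Qed.

Let PsiTS : {morph PsiT : b / star b}.
Proof.
by move=> b; rewrite /PsiT star_sum; apply: eq_bigr => i _; exact: (star_hom_star (Psi_hom i)).
Qed.

(** Compression to [p A p], followed by the inverse of [PsiT] there. *)
Let Phi (a : A) : D := fun i => projT1 (cid (Psi_onto i a)).

Let Psi_Phi a i : Psi i (Phi a i) = e i ** a ** e i.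
Proof. by rewrite /Phi; case: cid. Qed.

Let PsiT_Phi a : PsiT (Phi a) = p ** a ** p.
Proof. by rewrite pap; apply: eq_bigr => i _; exact: Psi_Phi. Qed.

Fact morita_lact_subproof (a : A) x : a ** x \in left_ideal_pred p.
Proof. by rewrite inE -cmulA left_idealE. Qed.
Fact morita_ract_subproof x b : x ** PsiT b \in left_ideal_pred p.
Proof. by rewrite inE -cmulA PsiT_p. Qed.

Let lact (a : A) x : X := LeftIdeal (morita_lact_subproof a x).
Let ract x b : X := LeftIdeal (morita_ract_subproof x b).
Let lip x y : A := x ** star y.
Let rip x y : D := Phi (star x ** y).

Let PsiT_rip x y : PsiT (rip x y) = star x ** y.
Proof.
have px : p ** star x = star x by apply: starI; rewrite starM ps !starK left_idealE.
by rewrite PsiT_Phi -!cmulA left_idealE cmulA px.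
Qed.

Let XP x y : x = y :> A -> x = y. Proof. exact: val_inj. Qed.

Let lip_norm x : `|lip x x| = `|x : A| ^+ 2.
Proof. exact: cstar_norm'. Qed.

Lemma morita_left : is_left_hilbert lact lip.
Proof.
split.
- by move=> a b x; apply: XP; exact: cmulDl.
- by move=> a x y; apply: XP; exact: cmulDr.
- by move=> c a x; apply: XP; exact: cmulZl.
- by move=> c a x; apply: XP; exact: cmulZr.
- by move=> a b x; apply: XP; rewrite /= cmulA.
- by move=> x y z; exact: cmulDl.
- by move=> c x y; exact: cmulZl.
- by move=> a x y; rewrite /lip /= cmulA.
- by move=> x y; rewrite /lip starM starK.
- by move=> x; exists (star x); rewrite starK.
- by move=> x xx; apply: XP; apply: starI; rewrite star0; apply: cmul_star_eq0; rewrite starK.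
- apply: (@left_ideal_complete _ _ _ _ _ 1) => // x; rewrite lip_norm//.
  by rewrite mul1r.
Qed.

Lemma morita_right : is_right_hilbert ract rip.
Proof.
split.
- by move=> x y b; apply: XP; exact: cmulDl.
- by move=> x a b; apply: XP; rewrite /= PsiTD cmulDr.
- by move=> c x b; apply: XP; exact: cmulZl.
- by move=> c x b; apply: XP; rewrite /= PsiTZ cmulZr.
- by move=> x a b; apply: XP; rewrite /= PsiTM cmulA.
- by move=> x y z; apply: PsiT_inj; rewrite PsiTD !PsiT_rip cmulDr.
- by move=> c x y; apply: PsiT_inj; rewrite PsiTZ !PsiT_rip cmulZr.
- by move=> x y b; apply: PsiT_inj; rewrite PsiTM !PsiT_rip cmulA.
- by move=> x y; apply: PsiT_inj; rewrite PsiTS !PsiT_rip starM starK.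
- move=> x; pose b : D := fun i => projT1 (cid (Psi_pos i x)).
  exists b; apply: dsum_ext => i; apply: Psi_inj; rewrite Psi_Phi.
  exact: esym (projT2 (cid (Psi_pos i x))).
- move=> x x0; apply: XP; apply: cmul_star_eq0; rewrite -PsiT_rip x0.
  by rewrite /PsiT big1// => i _; exact: Psi0.
have rip_i x i : `|rip x x i| = `|x ** e i| ^+ 2.
  by rewrite -Psi_norm Psi_Phi -cstar_norm starM es !cmulA.
have e1 i : `|e i| <= 1 by exact: proj_norm_le1.
(* [x] is the sum of the [x ** e i], each of norm at most [q], hence the factor [#|I|]; adding 1
   keeps the constant positive when [I] is empty. *)
apply: (@left_ideal_complete _ _ _ _ _ ((#|I|%:R + 1) ^+ 2)) => [|x|x].
- by rewrite exprn_gt0// ltr_wpDl.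
- rewrite dsum_normE; apply: dsum_norm_le => [|i]; first by rewrite exprn_ge0.
  rewrite rip_i lerXn2r ?nnegrE// (le_trans (cnormM _ _))//.
  by rewrite -[leRHS]mulr1 ler_wpM2l.
- pose q := sqrtC `|rip x x|; have q0 : 0 <= q by rewrite sqrtC_ge0.
  have xq i : `|x ** e i| <= q.
    rewrite -(@ler_pXn2r _ 2) ?nnegrE// sqrtCK -rip_i.
    exact: dsum_norm_ge.
  have xE : `|x : A| <= (#|I|%:R + 1) * q.
    rewrite -(left_idealE x) /p cmul_sumr (le_trans (ler_norm_sum _ _ _))//.
    apply: (@le_trans _ _ (\sum_(i : I) q)); first by apply: ler_sum => i _; exact: xq.
    by rewrite sumr_const -[leLHS]mulr_natl ler_wpM2r// lerDl.
  have -> : `|rip x x| = q ^+ 2 by rewrite sqrtCK.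
  by rewrite -exprMn lerXn2r ?nnegrE ?mulr_ge0 ?addr_ge0.
Qed.

(** The bimodule is [A p], on which [D] acts through its identification [PsiT] with [p A p].
    Fullness over [A] is [e_full]; over [D] it holds because [b] is the inner product of [p] and
    [PsiT b]. *)
Lemma strongly_morita_of_corners : strongly_morita_equivalent A D.
Proof.
apply: inhabits; apply: (ImprimitivityBimodule morita_left morita_right).
- move=> S Scl Ssub SG; apply: e_full => // _ [i [x [y ->]]]; apply: SG.
  have xP a : a ** e i \in left_ideal_pred p by rewrite inE -cmulA ep.
  exists (LeftIdeal (xP x)), (LeftIdeal (xP y)); rewrite /lip /= starM es cmulA.
  by rewrite -(cmulA x (e i) (e i)) ee.
- move=> S Scl Ssub SG; apply/seteqP; split=> // b _; apply: SG.
  have pP : p \in left_ideal_pred p.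
    by rewrite inE {1}/p cmul_suml; apply/eqP/eq_bigr => i _; exact: ep.
  have bP : PsiT b \in left_ideal_pred p by rewrite inE PsiT_p.
  exists (LeftIdeal pP), (LeftIdeal bP); apply: PsiT_inj; rewrite PsiT_rip /= ps.
  by rewrite /p cmul_suml; apply: eq_bigr => i _; rewrite e_PsiT.
- by move=> a x b; apply: XP; rewrite /= cmulA.
- by move=> a x y; apply: PsiT_inj; rewrite !PsiT_rip /= starM cmulA.
- by move=> b x y; rewrite /lip /= starM PsiTS starK cmulA.
- by move=> x y z; apply: XP; rewrite /= PsiT_rip cmulA.
Qed.

End MoritaFromCorners.

(** * Corners at terminal vertices *)

Section TerminalUnits.
Variables (R : realType) (k : nat) (L : kgraph k) (A : cstarAlgType R[i]) (s : L -> A).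
Hypotheses (rfin : kgraph_row_finite L) (ck : is_ck_family s).
Hypothesis s0 : forall v, s (kid v) != 0.
Local Notation C := (R[i]%type).
Local Notation zk := {ffun 'I_k -> int}.
Variable w : kobj L.
Hypothesis Tw : terminal s w.
Implicit Types (ta mu nu : L) (g h : zk) (a b : A) (z : 'I_k -> C).

Definition kdiff ta ta' : zk := [ffun i => (kdeg ta i)%:Z - (kdeg ta' i)%:Z].
Lemma kdiffE ta ta' i : kdiff ta ta' i = (kdeg ta i)%:Z - (kdeg ta' i)%:Z.
Proof. exact: ffunE. Qed.

(** The unitaries [s_ta s_ta'^*] of the corner at [w], graded by degree. *)
Definition unit_at g a : Prop := exists ta ta',
  [/\ krng ta = w, krng ta' = w, ksrc ta = ksrc ta', g = kdiff ta ta' & a = s ta ** star (s ta')].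

Lemma unit_at_gen : corner_gen s w w = [set a | exists g, unit_at g a].
Proof.
apply/seteqP; split=> a [].
  by move=> ta [ta' [r r' e ->]]; exists (kdiff ta ta'), ta, ta'.
by move=> g [ta [ta' [r r' e _ ->]]]; exists ta, ta'.
Qed.

(** The range projection of [si], inserted in the middle, is a whole vertex projection because the
    vertex reached by [ta] is again terminal. *)
Lemma unit_extend ta ta' si : krng ta = w -> ksrc ta = ksrc ta' -> ksrc ta = krng si ->
  s ta ** star (s ta') = s (kcomp ta si) ** star (s (kcomp ta' si)).
Proof.
move=> r e c; have c' : ksrc ta' = krng si by rewrite -e.
have f : full s si.
  apply: (@terminal_src _ _ _ _ s ck ta) => //; first by rewrite r.
rewrite -(ck_comp ck c) -(ck_comp ck c') starM cmulA -(cmulA (s ta)) -/(rproj s si) f -c.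
by rewrite (ck_src ck).
Qed.

Lemma kdiff_extend ta ta' si : ksrc ta = ksrc ta' -> ksrc ta = krng si ->
  kdiff (kcomp ta si) (kcomp ta' si) = kdiff ta ta'.
Proof.
move=> e c; have c' : ksrc ta' = krng si by rewrite -e.
by apply/ffunP => i; rewrite !kdiffE !kdegE//; lia.
Qed.

Lemma terminal_deg_uniq ta ta' : krng ta = w -> krng ta' = w -> kdeg ta = kdeg ta' -> ta = ta'.
Proof.
move=> r r' d; have f' : full s ta' by exact: Tw.
apply: (full_unique rfin ck s0 f' (kle_deg ta')); last by rewrite r r'.
by rewrite -d; exact: kle_deg.
Qed.

(** Both elements are rewritten with a common left path. Equal degrees then force right paths of
    equal degree, and only one path of range [w] has a given degree. *)
Lemma unit_at_uniq g a b : unit_at g a -> unit_at g b -> a = b.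
Proof.
move=> [t1 [t1' [r1 r1' e1 -> ->]]] [t2 [t2' [r2 r2' e2 dE ->]]].
have [||si [si' [c c' E]]] := @terminal_extension _ _ _ _ s rfin ck s0 t1 t2; rewrite ?r1 ?r2//.
rewrite (unit_extend r1 e1 c) (unit_extend r2 e2 c') E.
congr (_ ** star (s _)); apply: terminal_deg_uniq; rewrite ?krng_comp -?e1 -?e2//.
apply/degP => i; rewrite !kdegE -?e1 -?e2//.
have := congr1 (fun f : L => kdeg f i) E; rewrite /= !kdegE//.
have := congr1 (fun f : zk => f i) dE; rewrite /= !kdiffE.
lia.
Qed.

Lemma unit_at_norm g a : unit_at g a -> `|a| <= 1.
Proof.
have sn mu : `|s mu| <= 1.
  rewrite -(@ler_pXn2r _ 2) ?nnegrE// expr1n -cstar_norm (ck_star ck).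
  exact/proj_norm_le1/(ck_proj ck).
move=> [ta [ta' [_ _ _ _ ->]]]; rewrite (le_trans (cnormM _ _))// mulr_ile1//.
by rewrite cnorm_star.
Qed.

(** The two inner paths are prolonged to a common one, whose [s^* s] collapses to a vertex
    projection. *)
Lemma unit_at_mul g h a b : unit_at g a -> unit_at h b -> unit_at (g + h) (a ** b).
Proof.
move=> [t1 [t1' [r1 r1' e1 -> ->]]] [t2 [t2' [r2 r2' e2 -> ->]]].
have [||si [si' [c c' E]]] := @terminal_extension _ _ _ _ s rfin ck s0 t1' t2; rewrite ?r1' ?r2//.
have c1 : ksrc t1 = krng si by rewrite e1.
have c2 : ksrc t2' = krng si' by rewrite -e2.
exists (kcomp t1 si), (kcomp t2' si'); split; rewrite ?krng_comp ?ksrc_comp//.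
- by rewrite -(ksrc_comp c) E ksrc_comp.
- rewrite -(kdiff_extend e1 c1) -(kdiff_extend e2 c') E; apply/ffunP => i.
  by rewrite ffunE !kdiffE; lia.
rewrite (unit_extend r1 e1 c1) (unit_extend r2 e2 c') E.
have sE : ksrc (kcomp t2 si') = ksrc (kcomp t1 si) by rewrite -E !ksrc_comp.
by rewrite -cmulA (cmulA (star _)) (ck_star ck) sE cmulA (ck_src ck).
Qed.

Lemma unit_at_star g a : unit_at g a -> unit_at (- g) (star a).
Proof.
move=> [ta [ta' [r r' e -> ->]]]; exists ta', ta; split=> //; last by rewrite starM starK.
by apply/ffunP => i; rewrite ffunE !kdiffE opprB.
Qed.

Lemma unit_at0 : unit_at 0 (s (kid w)).
Proof.
exists (kid w), (kid w); rewrite krng_id; split=> //.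
  by apply/ffunP => i; rewrite kdiffE subrr ffunE.
by rewrite (ck_vstar ck) (ck_vv ck).
Qed.

Lemma zpow_diff z ta ta' : unitary_point z ->
  zpow z (kdeg ta) * (zpow z (kdeg ta'))^* = zpowz z (kdiff ta ta').
Proof.
move=> z1; rewrite /zpow (big_morph _ (@cjM C) (conjC1 C)) -big_split; apply: eq_bigr => i _ /=.
have zc : (z i ^+ kdeg ta' i)^* = z i ^- kdeg ta' i.
  have zn : z i ^+ kdeg ta' i != 0 by rewrite -normr_eq0 normrX z1 expr1n oner_eq0.
  by apply: (mulfI zn); rewrite divff// unit_conj// normrX z1 expr1n.
rewrite zc kdiffE expfzDr ?unitary_neq0//; congr (_ * _).
by rewrite exprnN.
Qed.

Hypothesis lconv : kgraph_locally_convex L.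
Hypothesis sU : is_kgraph_algebra s.

Lemma terminal_bpath (x y : bpath L) : brng x = w -> brng y = w -> x = y.
Proof.
move=> xw yw; apply: bpathP => n.
have f : full s (y n) by apply: Tw; rewrite krng_bseg.
by apply: (full_unique rfin ck s0 f (bseg_le y n) (bseg_le x n)); rewrite !krng_bseg xw yw.
Qed.

Lemma terminal_characters : exists chi : ('I_k -> C) -> A -> C, forall z, unitary_point z ->
  [/\ (forall a b, chi z (a + b) = chi z a + chi z b),
    (forall (c : C) a, chi z (c *: a) = c * chi z a),
    (forall a b, corner s w w a -> corner s w w b -> chi z (a ** b) = chi z a * chi z b),
    (forall a, chi z (star a) = (chi z a)^*) &
    forall g a, unit_at g a -> chi z a = zpowz z g].
Proof.
have H z : exists c : A -> C, unitary_point z ->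
  [/\ (forall a b, c (a + b) = c a + c b),
    (forall (t : C) a, c (t *: a) = t * c a),
    (forall a b, corner s w w a -> corner s w w b -> c (a ** b) = c a * c b),
    (forall a, c (star a) = (c a)^*) &
    forall g a, unit_at g a -> c a = zpowz z g].
  have [z1|nz] := pselect (unitary_point z); last by exists (fun=> 0).
  have [c [cD cZ cM cS cU]] := kga_character rfin lconv sU z1 terminal_bpath.
  exists c => _; split=> // [a b _ bE|g a [ta [ta' [r r' e -> ->]]]].
    by apply: cM; have [] := cornerE ck bE.
  by rewrite cU// zpow_diff.
by exists (fun z => projT1 (cid (H z))) => z; exact: (projT2 (cid (H z))).
Qed.

End TerminalUnits.

(** * Identification of a graded corner with the functions on a torus *)

Section CornerSpectrum.
Variables (R : realType) (k : nat) (A : cstarAlgType R[i]).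
Local Notation C := (R[i]%type).
Local Notation zk := {ffun 'I_k -> int}.
Implicit Types (g h : zk) (a b : A) (z : 'I_k -> C).

Variables (U : zk -> A -> Prop) (chi : ('I_k -> C) -> A -> C) (e : A).
Hypothesis U_uniq : forall g a b, U g a -> U g b -> a = b.
Hypothesis U_norm : forall g a, U g a -> `|a| <= 1.
Hypothesis U_mul : forall g h a b, U g a -> U h b -> U (g + h) (a ** b).
Hypothesis U_star : forall g a, U g a -> U (- g) (star a).
Hypothesis U_e : U 0 e.
Let EU : set A := [set a | exists g, U g a].
Let E : set A := cspan EU.
Hypothesis chiP : forall z, unitary_point z ->
  [/\ (forall a b, chi z (a + b) = chi z a + chi z b),
    (forall (c : C) a, chi z (c *: a) = c * chi z a),
    (forall a b, E a -> E b -> chi z (a ** b) = chi z a * chi z b),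
    (forall a, chi z (star a) = (chi z a)^*) &
    forall g a, U g a -> chi z a = zpowz z g].

Let chiD z (z1 : unitary_point z) : forall a b, chi z (a + b) = chi z a + chi z b.
Proof. by have [] := chiP z1. Qed.
Let chiZ z (z1 : unitary_point z) : forall (c : C) a, chi z (c *: a) = c * chi z a.
Proof. by have [] := chiP z1. Qed.
Let chiM z (z1 : unitary_point z) : forall a b, E a -> E b -> chi z (a ** b) = chi z a * chi z b.
Proof. by have [] := chiP z1. Qed.
Let chiS z (z1 : unitary_point z) : forall a, chi z (star a) = (chi z a)^*.
Proof. by have [] := chiP z1. Qed.
Let chiU z (z1 : unitary_point z) : forall g a, U g a -> chi z a = zpowz z g.
Proof. by have [] := chiP z1. Qed.

Let chi_le z a : unitary_point z -> E a -> `|chi z a| <= `|a|.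
Proof. exact: (@chi_norm_le _ _ _ U chi). Qed.

Let chi_iso a (M : R) : 0 <= M -> E a ->
  (forall z, unitary_point z -> `|chi z a| <= M%:C%C) -> `|a| <= M%:C%C.
Proof. exact: (@character_isometry _ _ _ U chi). Qed.

Let chiB z a b : unitary_point z -> chi z (a - b) = chi z a - chi z b.
Proof. by move=> z1; rewrite chiD// -scaleN1r chiZ// mulN1r. Qed.

Let E0 : E 0. Proof. by have [] := cspan_subspace EU. Qed.
Let ED a b : E a -> E b -> E (a + b). Proof. by have [_ D _] := cspan_subspace EU; exact: D. Qed.
Let EZ (c : C) a : E a -> E (c *: a). Proof. by have [_ _ Z] := cspan_subspace EU; exact: Z. Qed.
Let EB a b : E a -> E b -> E (a - b).
Proof. by move=> Ea Eb; rewrite -scaleN1r; apply: ED => //; exact: EZ. Qed.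
Let EM a b : E a -> E b -> E (a ** b).
Proof.
apply: cspanM; [exact: cspan_closed|exact: cspan_subspace|].
by move=> x y [g Ux] [h Uy]; apply: cspan_gen; exists (g + h); exact: U_mul.
Qed.
Let ES a : E a -> E (star a).
Proof.
apply: cspan_star; [exact: cspan_closed|exact: cspan_subspace|].
by move=> x [g Ux]; apply: cspan_gen; exists (- g); exact: U_star.
Qed.

Let E_approx a : E a -> forall d : R, 0 < d -> exists2 b, lspan EU b & `|a - b| < d%:C%C.
Proof. by move=> /closureP_norm Ea d d0; apply: Ea; rewrite ltcR. Qed.

Let lE b : lspan EU b -> E b. Proof. exact: subset_closure. Qed.

Let chi_agree z z' : unitary_point z -> unitary_point z' ->
  (forall g a, U g a -> zpowz z g = zpowz z' g) -> forall a, E a -> chi z a = chi z' a.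
Proof.
move=> z1 z1' gen a Ea.
have lagree b : lspan EU b -> chi z b = chi z' b.
  move=> /(_ [set b | chi z b = chi z' b]); apply.
    split=> /= [|x y xE yE|c x xE]; last by rewrite !chiZ// xE.
      by rewrite -(scale0r 0) !chiZ// !mul0r.
    by rewrite !chiD// xE yE.
  by move=> x [g gx] /=; rewrite (chiU z1 gx) (chiU z1' gx); exact: gen gx.
apply/eqP; rewrite -subr_eq0 -normr_eq0 eq_le normr_ge0 andbT.
apply/ler_addgt0Pr => d d0; rewrite add0r.
have [r r0 dE] := gt0_complex d0; have r2 : 0 < r / 2 by rewrite divr_gt0.
have [b lb ab] := E_approx Ea r2; have Eb := lE lb.
have -> : chi z a - chi z' a = chi z (a - b) - chi z' (a - b).
  by rewrite !chiB// (lagree _ lb); ring.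
rewrite (le_trans (ler_normB _ _))// dE [X in X%:C%C]splitr rmorphD /=.
by apply: lerD; apply: le_trans (ltW ab); apply: chi_le => //; exact: EB.
Qed.

Let G : set zk := [set g | exists a, U g a].

(** Elements of [E] become functions on [T^l] through the characters at [sec (zeta t)]. On [E] the
    character [chi z] depends only on the values of [z] on the basis of [G], so the supremum over
    [T^l] is the one over [T^k] and the transform is isometric. [Psi] is its inverse. *)
Lemma corner_torus : exists l : nat, (l <= k)%N /\ exists Psi : cont_torus R l -> A,
  [/\ is_star_hom Psi, forall f, `|Psi f| = `|f|, forall f, E (Psi f) &
      forall a, E a -> exists f, Psi f = a].
Proof.
have [l [lk [gs [sec [Ggs gen secP]]]]] := @lattice_basis R k G
  (ex_intro _ e U_e)
  (fun g h '(ex_intro a ga) '(ex_intro b hb) => ex_intro _ _ (U_mul ga hb))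
  (fun g '(ex_intro a ga) => ex_intro _ _ (U_star ga)).
exists l; split=> //; set T := torus R l.
pose zeta (t : T) (j : 'I_l) : C := sval (t j).
have zeta1 t j : `|zeta t j| = 1 by exact/eqP/(svalP (t j)).
have sec1 t : unitary_point (sec (zeta t)) by have [] := secP _ (zeta1 t).
have secE t j : zpowz (sec (zeta t)) (gs j) = zeta t j by have [_ ->] := secP _ (zeta1 t).
have zeta_cont j : continuous (fun t : T => zeta t j : C^o).
  move=> t; apply: (@continuous_comp _ _ _ (fun t : T => t j) (fun c : circle R => sval c : R[i]^o)).
    exact: (@proj_continuous _ (fun _ : 'I_l => circle R) j).
  exact: initial_continuous.
pose ev a t : C^o := chi (sec (zeta t)) a.
have mono_cont (j : 'I_l) (n : int) : continuous (fun t : T => zeta t j ^ n : C^o).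
  have nat_cont (m : nat) : continuous (fun t : T => zeta t j ^+ m : C^o).
    elim: m => [|m IH].
      by have -> : (fun t : T => zeta t j ^+ 0 : C^o) = (fun=> 1) by []; exact: cst_continuous.
    have -> : (fun t : T => zeta t j ^+ m.+1 : C^o) = (fun t => zeta t j * zeta t j ^+ m).
      by apply/funext => t; rewrite exprS.
    by move=> t; exact: (@cvgZ C C^o _ _ _ _ _ _ _ (zeta_cont j t) (IH t)).
  case: n => m; first exact: nat_cont.
  suff -> : (fun t : T => zeta t j ^ Negz m : C^o) = (fun t => (zeta t j ^+ m.+1)^* : C^o).
    exact/conj_continuous/nat_cont.
  apply/funext => t; rewrite NegzE -exprnN.
  have zn : zeta t j ^+ m.+1 != 0 by rewrite -normr_eq0 normrX zeta1 expr1n oner_eq0.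
  by apply: (mulfI zn); rewrite divff// -normCK normrX zeta1 !expr1n.
(* [sec] is built from roots and need not be continuous; on a homogeneous element only a monomial in
   the coordinates of [t] remains. *)
have U_cont g a : U g a -> continuous (ev a).
  move=> ga; have [n nE] := gen g (ex_intro _ a ga).
  have -> : ev a = fun t => \prod_j zeta t j ^ n j.
    apply/funext => t; rewrite /ev (chiU (sec1 t) ga) nE zpowz_sum//.
    by apply: eq_bigr => j _; rewrite secE.
  elim: (index_enum _) => [|j r IH].
    have -> : (fun t : T => \prod_(j <- [::]) zeta t j ^ n j : C^o) = (fun=> 1).
      by apply/funext => t; rewrite big_nil.
    exact: cst_continuous.
  have -> : (fun t : T => \prod_(j <- j :: r) zeta t j ^ n j : C^o) =
      (fun t => zeta t j ^ n j * \prod_(j <- r) zeta t j ^ n j).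
    by apply/funext => t; rewrite big_cons.
  by move=> t; exact: (@cvgZ C C^o _ _ _ _ _ _ _ (mono_cont j (n j) t) (IH t)).
have l_cont b : lspan EU b -> continuous (ev b).
  move=> /(_ [set b | continuous (ev b)]); apply; last by move=> x [g gx]; exact: U_cont gx.
  split=> /= [|x y xc yc|c x xc].
  - have -> : ev 0 = (fun=> 0); last exact: cst_continuous.
    by apply/funext => t; rewrite /ev -(scale0r 0) chiZ// mul0r.
  - have -> : ev (x + y) = (fun t => ev x t + ev y t).
      by apply/funext => t; rewrite /ev chiD.
    by move=> t; exact: (cvgD (xc t) (yc t)).
  - have -> : ev (c *: x) = (fun t => c *: ev x t).
      by apply/funext => t; rewrite /ev chiZ.
    by move=> t; exact: (@cvgZ C C^o _ _ _ (fun=> c) (ev x) c (ev x t) (@cvg_cst C^o _ _ _ _) (xc t)).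
have E_cont a : E a -> continuous (ev a).
  move=> Ea t; apply/(@cvgrPdist_lt C C^o _ _ (nbhs_filter t)) => d d0.
  have [r r0 dE] := gt0_complex d0; have r3 : 0 < r / 3 by rewrite divr_gt0.
  have [b lb ab] := E_approx Ea r3; have Eb := lE lb.
  have r3' : 0 < (r / 3)%:C%C :> C by rewrite ltcR.
  have /(@cvgrPdist_lt C C^o _ _ (nbhs_filter t))/(_ _ r3') := l_cont _ lb t; apply: (@filterS _ _ (nbhs_filter t)) => u bu.
  have bnd v : `|ev a v - ev b v| <= (r / 3)%:C%C.
    by rewrite /ev -chiB// (le_trans _ (ltW ab))// chi_le//; exact: EB.
  have -> : ev a t - ev a u = (ev a t - ev b t) + (ev b t - ev b u) - (ev a u - ev b u) by ring.
  have -> : d = (r / 3)%:C%C + (r / 3)%:C%C + (r / 3)%:C%C.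
    by rewrite dE -!rmorphD /=; congr (_%:C)%C; field.
  rewrite (le_lt_trans (ler_normB _ _))// ltr_leD//.
  by rewrite (le_lt_trans (ler_normD _ _))// ler_ltD.
(* [f] is the transform of [a]. Kept as a relation, it becomes the map [Psi] once every [f] is known
   to be reached. *)
pose Ph a (f : cont_torus R l) := E a /\ forall t, cont_fun f t = ev a t.
have Ph_ex a : E a -> exists f, Ph a f.
  by move=> Ea; exists (cont_mk (@torus_compact R l) (E_cont _ Ea)).
have Ph_norm a f : Ph a f -> `|a| = `|f|.
  move=> [Ea fE]; apply/eqP; rewrite eq_le; apply/andP; split.
    rewrite cont_normE; apply: chi_iso => //; first exact: cont_sup_ge0.
    (* An arbitrary [z] in [T^k] is replaced by the point of [T^l] formed by its values on the
       basis; the two characters agree on [E]. *)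
    move=> z z1; pose c j : circle R := exist _ (zpowz z (gs j)) (introT eqP (zpowz_norm (gs j) z1)).
    pose t : T := c.
    have -> : chi z a = ev a t.
      apply: chi_agree => // g b gb; have [n ->] := gen g (ex_intro _ b gb).
      rewrite (zpowz_sum _ _ z1) (zpowz_sum _ _ (sec1 t)); apply: eq_bigr => j _.
      by congr (_ ^ _); exact: esym (secE t j).
    by rewrite -fE; exact: cont_sup_ge.
  have aR : `|a| = (complex.Re `|a|)%:C%C by rewrite {1}norm_cReE.
  rewrite aR; apply: cont_norm_le => [|t]; first exact: cRe_norm_ge0.
  by rewrite fE -aR; exact: chi_le.
have PhD a b f f' : Ph a f -> Ph b f' -> Ph (a + b) (f + f').
  move=> [Ea fE] [Eb fE']; split; first exact: ED.
  by move=> t; rewrite /ev chiD// -[RHS]/(ev a t + ev b t) -fE -fE'.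
have PhZ (c : C) a f : Ph a f -> Ph (c *: a) (c *: f).
  move=> [Ea fE]; split; first exact: EZ.
  by move=> t; rewrite /ev chiZ// -[RHS]/(c * ev a t) -fE.
have PhM a b f f' : Ph a f -> Ph b f' -> Ph (a ** b) (f ** f').
  move=> [Ea fE] [Eb fE']; split; first exact: EM.
  by move=> t; rewrite /ev chiM// -[RHS]/(ev a t * ev b t) -fE -fE'.
have PhS a f : Ph a f -> Ph (star a) (star f).
  move=> [Ea fE]; split; first exact: ES.
  by move=> t; rewrite /ev chiS// -[RHS]/((ev a t)^*) -fE.
have PhB a b f f' : Ph a f -> Ph b f' -> Ph (a - b) (f - f').
  by move=> fa fb; rewrite -scaleN1r -(scaleN1r f'); apply: PhD => //; exact: PhZ.
have Ph_inj a b f : Ph a f -> Ph b f -> a = b.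
  move=> fa fb; apply/eqP; rewrite -subr_eq0 -normr_eq0 (Ph_norm _ _ (PhB _ _ _ _ fa fb)).
  by rewrite subrr normr0.
pose S : set (cont_torus R l) := [set f | exists a, Ph a f].
(* The transform is isometric, so preimages of a convergent sequence of transforms form a Cauchy
   sequence. *)
have Scl : closed S.
  move=> f /closureP_norm Sf.
  have inv0 n : (0 : C) < n.+1%:R^-1 by rewrite invr_gt0.
  pose fn n := projT1 (cid2 (Sf _ (inv0 n))).
  have fS n : S (fn n) by rewrite /fn; case: cid2.
  have fn_lt n : `|f - fn n| < n.+1%:R^-1 by rewrite /fn; case: cid2.
  pose an n := projT1 (cid (fS n)).
  have anP n : Ph (an n) (fn n) by exact: (projT2 (cid (fS n))).
  have small (d : C) : 0 < d -> exists N : nat, forall n, (N <= n)%N -> n.+1%:R^-1 < d.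
    move=> /gt0_complex[r r0 ->]; exists (Num.trunc r^-1) => n Nn.
    have -> : n.+1%:R^-1 = (n.+1%:R^-1)%:C%C :> C by rewrite fmorphV rmorph_nat.
    rewrite ltcR invf_plt ?posrE//; apply: lt_le_trans (truncnS_gt _) _.
    by rewrite ler_nat.
  have /cvg_ex[a al] : cvg (an @ \oo).
    apply: cauchy_cvg; apply: cauchy_exP => d d0.
    have d2 : 0 < d / 2 by rewrite divr_gt0.
    have [N NP] := small _ d2; exists (an N); exists N => // m /= Nm.
    rewrite -ball_normE /= (Ph_norm _ _ (PhB _ _ _ _ (anP N) (anP m))).
    rewrite -(subrKA f) (splitr d) (le_lt_trans (ler_normD _ _))// ltrD//.
      by rewrite distrC (lt_trans (fn_lt _))// NP.
    by rewrite (lt_trans (fn_lt _))// NP.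
  have Ea : E a.
    apply: (closed_cvg _ (@cspan_closed _ _ EU) _ _ al); apply: nearW => n.
    by have [] := anP n.
  have [f' f'a] := Ph_ex _ Ea; exists a; suff -> : f = f' by [].
  apply/eqP; rewrite -subr_eq0 -normr_eq0 eq_le normr_ge0 andbT.
  apply/ler_addgt0Pr => d d0; rewrite add0r; have d2 : 0 < d / 2 by rewrite divr_gt0.
  have [N NP] := small _ d2.
  move/(@cvgrPdist_lt C A)/(_ _ d2): al => [M _ MP].
  pose n := maxn N M; rewrite -(subrKA (fn n)) (splitr d) (le_trans (ler_normD _ _))// lerD//.
    by rewrite ltW// (lt_trans (fn_lt _))// NP// leq_maxl.
  rewrite -(Ph_norm _ _ (PhB _ _ _ _ (anP n) f'a)) distrC ltW// MP//=.
  exact: leq_maxr.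
have ST : S = setT.
  apply: stone_weierstrass.
  - split=> //; last by move=> f [a fa]; exists (star a); exact: PhS.
      split=> [|f f' [a fa] [b fb]|c f [a fa]].
      + have [f f0] := Ph_ex _ E0; exists 0; suff <- : f = 0 by [].
        by apply/eqP; rewrite -normr_eq0 -(Ph_norm _ _ f0) normr0.
      + by exists (a + b); exact: PhD.
      + by exists (c *: a); exact: PhZ.
    by move=> f f' [a fa] [b fb]; exists (a ** b); exact: PhM.
  - have Ee : E e by apply: cspan_gen; exists 0.
    have [f fe] := Ph_ex _ Ee; exists f; first by exists e.
    by move=> t; have [_ ->] := fe; rewrite /ev (chiU (sec1 t) U_e) zpowz0.
  - move=> t t' tt'; have [j tj] : exists j, zeta t j <> zeta t' j.
      apply: contrapT => h; apply: tt'; apply: functional_extensionality_dep => j.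
      by apply: val_inj; apply: contrapT => tj; apply: h; exists j.
    have [a ga] := Ggs j; have Ea : E a by apply: cspan_gen; exists (gs j).
    have [f fa] := Ph_ex _ Ea; exists f; first by exists a.
    by have [_ fE] := fa; rewrite !fE /ev !(chiU (sec1 _) ga) !secE.
have Sall f : exists a, Ph a f by rewrite -[exists a, _]/(S f) ST.
pose Psi f := projT1 (cid (Sall f)).
have PsiP f : Ph (Psi f) f by exact: (projT2 (cid (Sall f))).
exists Psi; split.
- split=> [f f'|c f|f f'|f]; apply: (Ph_inj _ _ _ (PsiP _)).
  + exact: PhD.
  + exact: PhZ.
  + exact: PhM.
  + exact: PhS.
- by move=> f; exact: Ph_norm.
- by move=> f; have [] := PsiP f.
- by move=> a /Ph_ex[f fa]; exists f; exact: Ph_inj (PsiP f) fa.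
Qed.

End CornerSpectrum.

(** * Terminal corners and sums of squares of continuous functions *)

Section TerminalCornerTorus.
Variables (R : realType) (k : nat) (L : kgraph k) (A : cstarAlgType R[i]) (s : L -> A).
Hypotheses (rfin : kgraph_row_finite L) (lconv : kgraph_locally_convex L).
Hypothesis sU : is_kgraph_algebra s.
Local Notation C := (R[i]%type).

Lemma terminal_corner_torus (w : kobj L) : terminal s w ->
  exists l : 'I_k.+1, exists Psi : cont_torus R l -> A,
  [/\ is_star_hom Psi, forall f, `|Psi f| = `|f|, forall f, corner s w w (Psi f) &
      forall a, corner s w w a -> exists f, Psi f = a].
Proof.
move=> Tw; have ck := kga_family sU.
have s0 v : s (kid v) != 0 by exact: kga_vertex_neq0.
have [chi chiP] := terminal_characters rfin ck s0 Tw lconv sU.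
have [||||||l [lk [Psi PsiP]]] := @corner_torus R k A (unit_at s w) chi (s (kid w)).
- exact: unit_at_uniq.
- exact: unit_at_norm.
- exact: unit_at_mul.
- by move=> g a; exact: unit_at_star.
- exact: unit_at0.
- move=> z z1; have [? ? ? ? ?] := chiP z z1; split=> //.
  by rewrite -unit_at_gen.
have lk1 : (l < k.+1)%N by [].
exists (Ordinal lk1), Psi; move: PsiP; rewrite -unit_at_gen.
by case.
Qed.

(** Sums of squares in [C(X)] are squares, because [f |-> sqrt f] preserves
    continuity. *)
Lemma cont_sum_squares (X : topologicalType) (cptX : compact [set: X])
    (I : Type) (r : seq I) (F : I -> cont_alg R cptX) :
  exists f : cont_alg R cptX, star f ** f = \sum_(i <- r) star (F i) ** F i.
Proof.
pose q x : R := \sum_(i <- r) complex.Re (`|cont_fun (F i) x| ^+ 2).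
have sqE (c : C) : c^* * c = (complex.Re (`|c| ^+ 2))%:C%C.
  by rewrite mulrC -normCK RRe_real// ger0_real// exprn_ge0.
have q0 x : 0 <= q x.
  apply: sumr_ge0 => i _; rewrite -lecR -sqE mulrC -normCK.
  by rewrite exprn_ge0.
have sumE x : cont_fun (\sum_(i <- r) star (F i) ** F i) x = (q x)%:C%C.
  rewrite /q rmorph_sum /= (big_morph (fun h : cont_alg R cptX => cont_fun h x : C)
    (id1 := 0) (op1 := +%R))//.
  by apply: eq_bigr => i _; exact: sqE.
have qc : continuous (q : X -> R^o).
  move=> x; have /(@cvgrPdist_lt C C^o) hc :=
    cont_funP (f := \sum_(i <- r) star (F i) ** F i) (x := x).
  apply/(@cvgrPdist_lt R R^o) => d d0; have d0' : 0 < d%:C%C :> C by rewrite ltcR.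
  apply: filterS (hc _ d0') => y; rewrite !sumE -rmorphB.
  by rewrite (norm_real_complex (q x - q y)) ltcR.
have sc : continuous (fun x => (Num.sqrt (q x) +i* 0)%C : C^o).
  apply: complex_continuous; last by move=> x; exact: cvg_cst.
  move=> x; apply: (@continuous_comp _ _ _ q (@Num.sqrt R)); first exact: qc.
  exact: sqrt_continuous.
exists (cont_mk cptX sc); apply: cont_ext => x; rewrite sumE.
rewrite -[LHS]/((Num.sqrt (q x))%:C%C^* * (Num.sqrt (q x))%:C%C) conj_Creal.
  by rewrite -rmorphM -expr2 sqr_sqrtr.
by rewrite ger0_real// ler0c sqrtr_ge0.
Qed.

End TerminalCornerTorus.

(** * Representatives of connected terminal vertices *)

Section Representatives.
Variables (R : realType) (k : nat) (L : kgraph k) (A : cstarAlgType R[i]) (s : L -> A).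
Hypotheses (ck : is_ck_family s).

Lemma corner_gen_star w w' x : corner_gen s w w' x -> corner_gen s w' w (star x).
Proof.
move=> [ta [ta' [r r' e ->]]]; exists ta', ta; split=> //.
by rewrite starM starK.
Qed.

Lemma corner_gen_refl w : corner_gen s w w (s (kid w)).
Proof.
by exists (kid w), (kid w); rewrite krng_id; split=> //; rewrite (ck_vstar ck) (ck_vv ck).
Qed.

Lemma corner_eq0 w w' a : (forall x, ~ corner_gen s w w' x) -> corner s w w' a -> a = 0.
Proof.
move=> none; apply: (@cspan_sub _ _ _ [set 0]) => [||x /none //].
  exact: (accessible_closed_set1 (hausdorff_accessible (@norm_hausdorff R[i] A))).
by split=> // [x y -> ->|c x ->]; rewrite ?addr0 ?scaler0.
Qed.

(** Greedy choice: a terminal vertex joins the list unless it is connected with one already chosen,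
    where connected means that two paths with these ranges have the same source. *)
Lemma terminal_representatives (V : seq (kobj L)) : exists ws : seq (kobj L),
  [/\ uniq ws, forall w, w \in ws -> terminal s w,
    forall w w' x, w \in ws -> w' \in ws -> w != w' -> ~ corner_gen s w w' x &
    forall w, w \in V -> terminal s w -> exists2 w', w' \in ws & exists x, corner_gen s w w' x].
Proof.
elim: V => [|v V [ws [uws Tws dws cws]]]; first by exists [::].
have [Tv|nTv] := pselect (terminal s v); last first.
  exists ws; split=> // w; rewrite inE => /predU1P[-> //|]; exact: cws.
have [[w' w'ws [x vw']]|none] := pselect (exists2 w', w' \in ws & exists x, corner_gen s v w' x).
  exists ws; split=> // w; rewrite inE => /predU1P[-> _|]; last exact: cws.
  by exists w' => //; exists x.
exists (v :: ws); split.
- rewrite /= uws andbT; apply/negP => vws; apply: none; exists v => //.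
  by exists (s (kid v)); exact: corner_gen_refl.
- by move=> w; rewrite inE => /predU1P[->|/Tws].
- move=> w w' x; rewrite !inE => /predU1P[->|wws] /predU1P[->|w'ws]; first by rewrite eqxx.
  + by move=> _ vw'; apply: none; exists w' => //; exists x.
  + by move=> _ wv; apply: none; exists w => //; exists (star x); exact: corner_gen_star.
  + exact: dws.
- move=> w; rewrite inE => /predU1P[-> _|wV Tw].
    by exists v; rewrite ?mem_head//; exists (s (kid v)); exact: corner_gen_refl.
  have [w' w'ws ex] := cws w wV Tw; exists w' => //.
  by rewrite inE w'ws orbT.
Qed.

Lemma kle_all_finite n : kgraph_row_finite L -> finite_set (kpaths L 0) ->
  finite_set (kpaths_le (L := L) n).
Proof.
move=> rfin fin.
apply: (@sub_finite_set _ _ (\bigcup_(v in kpaths L 0) krange (krng v) (kpaths_le (L := L) n))).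
  by move=> la le; exists (kid (krng la)); [exact: kdeg_id|split=> //; rewrite krng_id].
by apply: bigcup_finite => // v _; exact: kle_finite.
Qed.

End Representatives.

(** * The strong Morita equivalence *)

Theorem proposition5p9 (R : realType) (k : nat) (L : kgraph k)
    (A : cstarAlgType R[i]) (s : L -> A) :
  (1 <= k)%N ->
  kgraph_row_finite L -> kgraph_locally_convex L ->
  finite_set (kpaths L 0) -> kpaths L 0 !=set0 ->
  is_kgraph_algebra s ->
  ~ (exists p : A, is_infinite_projection p) ->
  exists (n : nat) (l : 'I_n -> 'I_k.+1), (1 <= n)%N /\
    strongly_morita_equivalent A (dsum (fun i : 'I_n => cont_torus R (l i))).
Proof.
move=> _ rfin lconv fin [la0 la00] sU noinf; have ck := kga_family sU.
have s0 v : s (kid v) != 0 by exact: kga_vertex_neq0.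
(* The number of vertices in every coordinate, as the pigeonhole argument on long paths demands. *)
pose N := nconst k #|` fset_set (kpaths L 0)|.
have Tlong la : kpaths_le N la -> terminal s (ksrc la) by exact: terminal_long.
have Ffin := @kle_all_finite k L N rfin fin.
pose F : seq L := fset_set (kpaths_le (L := L) N).
have FE la : (la \in F) = `[< kpaths_le N la >] by exact: in_fset_set.
have Fterm la : la \in F -> terminal s (ksrc la) by rewrite FE => /asboolP /Tlong.
have Fsum v : s (kid v) = \sum_(la <- F | krng la == v) rproj s la.
  rewrite (ck_sum ck v N) fsbig_finite /=; last exact: kle_finite.
  rewrite -[RHS]big_filter; apply: perm_big; apply: uniq_perm; rewrite ?filter_uniq ?fset_uniq//.
  move=> la; rewrite mem_filter FE [LHS]in_fset_set; last exact: kle_finite.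
  apply/idP/andP => [/set_mem[le r]|[/eqP r /asboolP le]]; last exact/mem_set.
  by split; [exact/eqP|exact/asboolP].
have sgen := kga_generates sU.
have oneE a : a = \sum_(la <- F) rproj s la ** a.
  by rewrite -cmul_suml (one_l ck Fsum sgen).
have compress w w' a : terminal s w -> terminal s w' ->
    corner s w w' (s (kid w) ** a ** s (kid w')).
  exact: (corner_full rfin ck Fterm Fsum sgen).
have [ws [uws Tws dws cws]] := terminal_representatives ck (map (@ksrc _ L) F).
pose n := size ws; pose v (i : 'I_n) := tnth (in_tuple ws) i.
have vws i : v i \in ws by exact: mem_tnth.
have vinj i j : i != j -> v i != v j.
  have vE m : v m = nth (v i) ws m by rewrite /v (tnth_nth (v i)).
  by apply: contra; rewrite (vE i) (vE j) nth_uniq.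
have Tv i : terminal s (v i) by exact: Tws.
pose l i := projT1 (cid (terminal_corner_torus rfin lconv sU (Tv i))).
have lP i : exists Psi : cont_torus R (l i) -> A,
  [/\ is_star_hom Psi, forall f, `|Psi f| = `|f|, forall f, corner s (v i) (v i) (Psi f) &
      forall a, corner s (v i) (v i) a -> exists f, Psi f = a].
  exact: (projT2 (cid (terminal_corner_torus rfin lconv sU (Tv i)))).
pose Psi i := projT1 (cid (lP i)).
have PsiP i := projT2 (cid (lP i)); rewrite -/(Psi _) in PsiP.
have conn la : la \in F -> exists i y, corner_gen s (ksrc la) (v i) y.
  move=> laF; have [w' w'ws [y yw]] := cws _ (map_f _ laF) (Fterm _ laF).
  have lt : (index w' ws < n)%N by rewrite index_mem.
  exists (Ordinal lt), y; suff -> : v (Ordinal lt) = w' by [].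
  by rewrite /v (tnth_nth w') nth_index.
(* A connecting [y] carries the projection of [w'] onto that of [w], because paths of range [w] have
   full range. *)
have gen_proj w w' y : terminal s w -> corner_gen s w w' y ->
    s (kid w) = y ** s (kid w') ** star y.
  move=> Tw yc; have [_ ->] := cornerE ck (cspan_gen yc).
  move: yc => [ta [ta' [r r' e ->]]].
  rewrite starM starK -cmulA (cmulA (star (s ta'))) (ck_star ck) -e.
  rewrite cmulA (ck_src ck) -r; apply: esym.
  by apply: Tw; rewrite r.
exists n, l; split.
  (* A vertex yields a path in [F], whose source is connected with some chosen vertex: there is at
     least one summand. *)
  have [la le _] := kle_nonempty (krng la0) N.
  have laF : la \in F by rewrite FE; apply/asboolP.
  by have [[i ltn] _] := conn _ laF; exact: leq_ltn_trans ltn.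
apply: (@strongly_morita_of_corners R A 'I_n _ (fun i => s (kid (v i))) Psi).
- by move=> i; exact: (ck_proj ck).
- move=> i j ij a; apply: corner_eq0 (compress _ _ _ (Tv i) (Tv j)) => x.
  by apply: dws => //; exact: vinj.
- by move=> i; have [] := PsiP i.
- by move=> i; have [] := PsiP i.
- by move=> i b; have [_ _ c _] := PsiP i; have [] := cornerE ck (c b).
- by move=> i a; have [_ _ _ c] := PsiP i; apply: c; exact: compress.
- move=> i x.
  have piece la : exists y, corner s (v i) (v i) y /\ (la \in F ->
      star y ** y = s (kid (v i)) ** (star x ** (rproj s la ** x)) ** s (kid (v i))).
    have c0 : corner s (v i) (v i) 0.
      by have [] := cspan_subspace (corner_gen s (v i) (v i)).
    have [laF|_] := boolP (la \in F); last by exists 0.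
    have [j [y yc]] := conn _ laF.
    (* By [gen_proj], [z^* z] is the term of [la]. The element [z] links [v j] with [v i], so it
       vanishes unless [j = i], and in either case it lies in the corner at [v i]. *)
    pose z := s (kid (v j)) ** (star y ** star (s la) ** x) ** s (kid (v i)).
    have zc : corner s (v j) (v i) z := compress _ _ _ (Tv j) (Tv i).
    exists z; split=> [|_].
      have [ji|ji] := eqVneq j i; first by rewrite -[X in corner s X](congr1 v ji).
      rewrite [z](corner_eq0 _ zc)// => u; apply: dws => //; exact: vinj.
    rewrite /z !starM !starK !(ck_vstar ck) /rproj -{3}(ck_src ck la).
    rewrite (gen_proj _ _ _ (Fterm _ laF) yc) !cmulA; congr (_ ** _ ** _ ** _ ** _).
    by rewrite -(cmulA _ (s (kid (v j)))) (ck_vv ck).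
  have [Y Yc] := boolp.choice piece.
  have [Ph _ _ Psurj] := PsiP i.
  have [G GY] := boolp.choice (fun la => Psurj _ (Yc la).1).
  have [b bE] := cont_sum_squares F G; exists b.
  rewrite bE (big_morph (Psi i) (star_homD Ph) (id1 := 0)); last first.
    by have := star_homZ Ph 0 0; rewrite !scale0r.
  rewrite [X in star x ** X](oneE x) cmul_sumr cmul_sumr cmul_suml big_seq [RHS]big_seq.
  apply: eq_bigr => la laF.
  by rewrite [LHS](star_homM Ph) (star_hom_star Ph) GY (Yc la).2.
- move=> S Scl Ssub SG; apply/seteqP; split=> // a _.
  have [S00 SD SZ] := Ssub.
  rewrite (oneE a) big_seq; elim/big_ind: _ => // la laF.
  have [i [y yc]] := conn _ laF; apply: SG.
  (* By [gen_proj] the middle factor [y s_(v i) y^*] is the projection of [s(la)], so the product is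
     [s_la s_la^* a]. *)
  exists i, (s la ** y), (star a ** s la ** y).
  rewrite !starM starK /rproj -{1}(ck_src ck la) (gen_proj _ _ _ (Fterm _ laF) yc).
  by rewrite !cmulA.
Qed.
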